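(* Let $N\geq 1$. There is a constant $C\leq 64$, and for every $F\in\mathcal{F}$ a positive constant $c(F)$ depending only on $F$, such that for every $\boldsymbol{\xi}\in(\overline{\mathbb{Q}}^\times)^N$ with $\mathrm{h}(\boldsymbol{\xi})\leq 1$ and every $F\in\mathcal{F}$, $$\left|\int_{(\mathbb{C}^\times)^N} F\,d\mu_S-\int_{(\mathbb{C}^\times)^N} F\,d\lambda_{(S^1)^N}\right|\leq c(F)\left(4\,\mathrm{h}(\boldsymbol{\xi})+C\,\frac{\log(\mathscr{D}(\boldsymbol{\xi})+1)}{\mathscr{D}(\boldsymbol{\xi})}\right)^{\frac12},$$ where $S$ is the Galois orbit of $\boldsymbol{\xi}$ and $\mu_S$ is the discrete probability measure associated to $S$.
   Context: Fix an algebraic closure $\overline{\mathbb{Q}}$ of $\mathbb{Q}$ with an embedding $\overline{\mathbb{Q}}\hookrightarrow\mathbb{C}$. The Galois orbit of a point of $(\overline{\mathbb{Q}}^\times)^N$ is its orbit under the (coordinatewise) action of $\mathrm{Gal}(\overline{\mathbb{Q}}/\mathbb{Q})$. For a finite set $T\subset(\mathbb{C}^\times)^N$, $\mu_T=\frac{1}{\#T}\sum_{\alpha\in T}\delta_\alpha$. The unit polycircle is $(S^1)^N=\{(z_1,\dots,z_N)\in\mathbb{C}^N:|z_1|=\dots=|z_N|=1\}$, and $\lambda_{(S^1)^N}$ is its Haar probability measure, considered as a measure on $(\mathbb{C}^\times)^N$. Height: for $\xi\in\overline{\mathbb{Q}}^\times$ with minimal polynomial $f_\xi\in\mathbb{Z}[x]$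 over the integers and degree $\deg(\xi)=[\mathbb{Q}(\xi):\mathbb{Q}]$, the Weil height is $\mathrm{h}(\xi)=\frac{1}{\deg(\xi)}\cdot\frac{1}{2\pi}\int_0^{2\pi}\log|f_\xi(e^{i\theta})|\,d\theta$; for $\boldsymbol{\xi}=(\xi_1,\dots,\xi_N)$, $\mathrm{h}(\boldsymbol{\xi})=\mathrm{h}(\xi_1)+\dots+\mathrm{h}(\xi_N)$. Generalized degree: for $\boldsymbol{n}\in\mathbb{Z}^N$ let $\chi^{\boldsymbol{n}}(\boldsymbol{z})=z_1^{n_1}\cdots z_N^{n_N}$. Then $\mathscr{D}(\boldsymbol{\xi})=\min_{\boldsymbol{n}\in\mathbb{Z}^N\setminus\{\boldsymbol{0}\}}\{\|\boldsymbol{n}\|_1\deg(\chi^{\boldsymbol{n}}(\boldsymbol{\xi}))\}$, where $\|\cdot\|_1$ is the $1$-norm. Identify $(\mathbb{R}/\mathbb{Z})^N\times\mathbb{R}^N$ with $(\mathbb{C}^\times)^N$ via $(\boldsymbol{\theta},\boldsymbol{u})\mapsto(e^{2\pi i\theta_1+u_1},\dots,e^{2\pi i\theta_N+u_N})$, and equip it with the translation invariant distance $\mathrm{d}((\boldsymbol{\theta},\boldsymbol{u}),(\boldsymbol{\theta}',\boldsymbol{u}'))=\left(\sum_{l=1}^N \mathrm{d}_{\mathrm{ang}}(\theta_l,\theta_l')^2+|u_l-u_l'|^2\right)^{1/2}$, where $\mathrm{d}_{\mathrm{ang}}(\theta,\theta')$ is the distance in $S^1$ (arc length) between $e^{2\pi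 i\theta}$ and $e^{2\pi i\theta'}$ divided by $2\pi$. Test functions: $\mathcal{F}$ is the set of functions $F:(\mathbb{C}^\times)^N\to\mathbb{R}$ such that (i) $F$ is Lipschitz with respect to the distance $\mathrm{d}$, and (ii) the restriction $F_0=F|_{(S^1)^N}$ is of class $C^{N+1}$. *)

(* Defs.v *)
From HB Require Import structures.
From mathcomp Require Import all_boot all_order all_algebra all_field.
From mathcomp Require Import all_classical all_reals all_analysis.
From mathcomp.real_closed Require Import complex.

Set Implicit Arguments.
Unset Strict Implicit.
Unset Printing Implicit Defensive.

Import Order.TTheory GRing.Theory Num.Theory.
Import numFieldNormedType.Exports.

Local Open Scope classical_set_scope.
Local Open Scope ring_scope.

(* Throughout, algC is the algebraic closure of Q, and its Galois group over Q
   consists of the ring morphisms algC -> algC: these are all bijective, by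
   algC_autK and algC_invautK, and all fix Q, by fmorph_rat. *)

Section AlgebraicNumbers.

Definition algdeg (x : algC) : nat := (size (minCpoly x)).-1.

(* The monic minimal polynomial over Q, rescaled to a primitive polynomial with
   integer coefficients and positive leading coefficient. *)
Definition minZpoly (x : algC) : {poly int} :=
  zprimitive (projT1 (rat_poly_scale (s2val (minCpolyP x)))).

Lemma minZpolyP (x : algC) :
  [/\ zcontents (minZpoly x) = 1, irreducible_poly (minZpoly x),
      root (map_poly intr (minZpoly x)) x & size (minZpoly x) = (algdeg x).+1].
Proof.
rewrite /minZpoly /algdeg; case: (minCpolyP x) => p [Dp mon_p] min_p /=.
case: (rat_poly_scale p) => q [a a0 Dq] /=.
have a0' : (a%:~R : rat)^-1 != 0 by rewrite invr_eq0 intr_eq0.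
have p0 : p != 0 := monic_neq0 mon_p.
have q0 : q != 0 by apply: contra_neq p0 => q0; rewrite Dq q0 map_poly0 scaler0.
have c0 : (zcontents q)%:~R != 0 :> rat by rewrite intr_eq0 zcontents_eq0.
pose b := (a%:~R : rat)^-1 * (zcontents q)%:~R.
have b0 : b != 0 by rewrite mulf_neq0.
have Dp' : p = b *: map_poly intr (zprimitive q).
  by rewrite {1}Dq {1}(zpolyEprim q) map_polyZ scalerA.
have szp : size p = size (zprimitive q) by rewrite Dp' size_scale// size_rat_int_poly.
have szC : size (minCpoly x) = size p by rewrite Dp size_map_poly.
have rootE r : root (map_poly ratr (map_poly intr r : {poly rat})) x =
               root (map_poly intr r) x.
  rewrite -map_poly_comp (@eq_map_poly _ _ _ (intr : int -> algC))// => z /=.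
  exact: rmorph_int.
have p_root : root (map_poly ratr p) x by rewrite min_p.
have p_dvd r : (p %| map_poly intr r) = (zprimitive q %| r).
  by rewrite Dp' dvdpZl// dvdp_rat_int.
split.
- by rewrite zcontents_primitive q0.
- split=> [|r r1 r_dvd]; first by rewrite -szp -szC size_minCpoly.
  move/Pdiv.Idomain.dvdpP: (r_dvd) => [[k s] /= k0 Ds].
  have zq0 : zprimitive q != 0 by rewrite zprimitive_eq0.
  have : s * r != 0 by rewrite -Ds -mul_polyC mulf_neq0 ?polyC_eq0.
  rewrite mulf_eq0 negb_or => /andP[s0 r0].
  have : root (map_poly intr (s * r) : {poly algC}) x.
    by rewrite -rootE -Ds min_p p_dvd -mul_polyC dvdp_mull.
  rewrite rmorphM rootM -!rootE !min_p !p_dvd => /orP[] d; last first.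
    by rewrite /eqp r_dvd.
  have : (size (zprimitive q) <= size s)%N by apply: dvdp_leq.
  have := congr1 (fun u : {poly int} => size u) Ds.
  rewrite size_scale// size_mul//.
  have : (0 < size r)%N by rewrite size_poly_gt0.
  by case: (size r) r1 => [|[|n]]// _ _ ->; rewrite addnS/= addnS ltnNge leq_addr.
- by rewrite -rootE min_p p_dvd dvdpp.
- by rewrite -szp szC prednK// size_poly_gt0.
Qed.

Definition l1norm N (n : 'I_N -> int) : nat := (\sum_i `|n i|)%N.

Definition chi N (n : 'I_N -> int) (x : 'I_N -> algC) : algC := \prod_i x i ^ n i.

(* The set over which the minimum is taken is nonempty as soon as 0 < N, see
   gen_degP. *)
Definition gen_deg N (x : 'I_N -> algC) : nat :=
  let D := [set d : nat | exists2 n : 'I_N -> int,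
              exists i, n i != 0 & d = (l1norm n * algdeg (chi n x))%N] in
  [get d | D d /\ forall d', D d' -> (d <= d')%N].

Lemma gen_degP N (x : 'I_N -> algC) : (0 < N)%N ->
  (exists2 n : 'I_N -> int,
     exists i, n i != 0 & gen_deg x = (l1norm n * algdeg (chi n x))%N) /\
  forall n : 'I_N -> int, (exists i, n i != 0) ->
    (gen_deg x <= l1norm n * algdeg (chi n x))%N.
Proof.
move=> N0; rewrite /gen_deg.
set D := [set d | _].
have exD : exists d, `[< D d >].
  eexists; apply/asboolP; exists (fun=> 1) => //.
  by exists (Ordinal N0).
case: xgetP => [d _ [Dd dmin]|none].
  by split=> // n n0; apply: dmin; exists n.
case: (none (ex_minn exD)); case: ex_minnP => d /asboolP Dd dmin.
by split=> // d' Dd'; apply: dmin; apply/asboolP.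
Qed.

End AlgebraicNumbers.

Section Height.
Variable R : realType.

Definition expi (t : R) : R[i] := (cos t +i* sin t)%C.

Definition weil_height (x : algC) : R :=
  (algdeg x)%:R^-1 * ((2 * pi)^-1 *
    \int[lebesgue_measure]_(t in `[0, 2 * pi])
      ln (Normc.normc (map_poly intr (minZpoly x)).[expi t])).

Definition weil_heightN N (x : 'I_N -> algC) : R := \sum_i weil_height (x i).

End Height.

Section CTorus.
Variable R : realType.

Definition cstar : Type := {z : R[i] | z != 0}.

HB.instance Definition _ := Choice.on cstar.

Definition cstar1 : cstar := exist _ 1 (oner_neq0 _).

Definition cstarM (z w : cstar) : cstar :=
  exist _ (val z * val w) (mulf_neq0 (valP z) (valP w)).

HB.instance Definition _ := isPointed.Build cstar cstar1.

Lemma expi_neq0 (t : R) : expi t != 0.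
Proof.
apply/eqP => -[c0 s0]; have := cos2Dsin2 t.
by rewrite c0 s0 expr0n addr0 => /eqP; rewrite eq_sym oner_eq0.
Qed.

Definition cstar_expi (t : R) : cstar := exist _ (expi t) (expi_neq0 t).

Variable N : nat.

Definition ctorus0 : Type := {ffun 'I_N -> cstar}.

HB.instance Definition _ := Choice.on ctorus0.
HB.instance Definition _ := isPointed.Build ctorus0 [ffun=> cstar1].

Definition unit_part (z : cstar) : R[i] := val z / (Normc.normc (val z))%:C%C.

(* The arc length between two points of the unit circle is the angle in [0, pi]
   between them. *)
Definition dist_ang (z w : cstar) : R :=
  acos (complex.Re (unit_part z * (unit_part w)^*%C)) / (2 * pi).

(* The coordinate u of z = exp(2 pi i theta + u) is ln |z|. *)
Definition ctorus_dist (z w : ctorus0) : R :=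
  Num.sqrt (\sum_l (dist_ang (z l) (w l) ^+ 2 +
    `|ln (Normc.normc (val (z l))) - ln (Normc.normc (val (w l)))| ^+ 2)).

Definition ctorus_open : set (set ctorus0) :=
  [set U | forall z, U z ->
     exists2 e : R, 0 < e & forall w, ctorus_dist z w < e -> U w].

(* (C^x)^N with its Borel sigma-algebra. *)
Definition ctorus := g_sigma_algebraType ctorus_open.

HB.instance Definition _ := Measurable.on ctorus.

Definition ctorusM (z w : ctorus) : ctorus := [ffun l => cstarM (z l) (w l)].

Definition polycircle : set ctorus :=
  [set z | forall l, Normc.normc (val (z l)) = 1].

(* The Haar probability measure of the group polycircle, as a measure on
   ctorus: it is concentrated on polycircle and invariant under its
   translations. *)
Definition is_haar_polycircle (lambda : probability ctorus R) : Prop :=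
  lambda polycircle = 1%E /\
  forall w : ctorus, polycircle w -> forall A : set ctorus, measurable A ->
    lambda (ctorusM w @^-1` A) = lambda A.

(* For finite T; the sum of Dirac masses runs over an enumeration of T without
   repetition. *)
Definition mu_fin (T : set ctorus) : {measure set ctorus -> \bar R} :=
  let s : seq ctorus := finmap.enum_fset (fset_set T) in
  mscale ((size s)%:R^-1)%:nng (msum (fun k => dirac (nth point s k)) (size s)).

Fixpoint class_C (k : nat) (f : 'rV[R]_N -> R) : Prop :=
  continuous f /\
  match k with
  | 0 => True
  | k'.+1 => forall l : 'I_N,
      (forall x, derivable f x (delta_mx 0 l)) /\
      class_C k' (fun x => 'D_(delta_mx 0 l) f x)
  end.

Definition circle_param (t : 'rV[R]_N) : ctorus :=
  [ffun l => cstar_expi (2 * pi * t 0 l)].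

(* The restriction of F to the polycircle is C^(N+1) iff it is so in the angular
   coordinates theta in (R/Z)^N, i.e. as a Z^N-periodic function on R^N. *)
Definition test_function (F : ctorus -> R) : Prop :=
  (exists k : R, forall z w, `|F z - F w| <= k * ctorus_dist z w) /\
  class_C N.+1 (F \o circle_param).

Definition galois_orbit (iota : {rmorphism algC -> R[i]}) (x : 'I_N -> algC) :
    set ctorus :=
  [set z | exists sigma : {rmorphism algC -> algC},
     forall l, val (z l) = iota (sigma (x l))].

End CTorus.

(* Main.v *)
From HB Require Import structures.
Require Import Defs.
From mathcomp Require Import all_boot all_order all_algebra all_field.
From mathcomp Require Import all_classical all_reals all_analysis.
From mathcomp.real_closed Require Import complex.
From mathcomp Require Import measurable_realfun ring lra.
Set Implicit Arguments.
Unset Strict Implicit.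
Unset Printing Implicit Defensive.
Import Order.TTheory GRing.Theory Num.Theory.
Import numFieldNormedType.Exports.
Local Open Scope classical_set_scope.
Local Open Scope ring_scope.

(** Let S be the Galois orbit of xi, with s points, h the height of xi and D
    its generalized degree.  Three estimates give the theorem.

    Radial part.  For each coordinate, the sum of |ln |x_l|| over the orbit is
    at most 2 s h(xi_l) ([orbit_abs_ln]): Jensen's formula ([jensen_formula])
    turns s h(xi_l) into ln |c| plus the sum of ln max(1, |x_l|), where the
    nonzero integer c clears the denominators of the x_l, so that c times the
    product of the x_l is a nonzero integer too.  As F is Lipschitz, replacing every orbit point by
    its projection to the polycircle changes the mean of F by O(h).

    Angular part.  For a monomial chi of nonzero exponent n, the values
    b_i = chi(x_i) = rho_i exp(i theta_i) are the conjugates of a number of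
    degree d, each repeated s / d times.  The square of the modulus of
    sum_i exp(i theta_i) is sum_(i,j) cos(theta_i - theta_j), which is up to a
    radial error the first term of the series
    sum_k (t r_ij)^k cos(k (theta_i - theta_j)) / k
      = - ln |1 - t r_ij exp(i (theta_i - theta_j))|
    with r_ij = min(rho_i, rho_j) / max(rho_i, rho_j) and 0 <= t < 1.  Each
    power of r_ij is a positive semidefinite kernel ([ratio_kernel_ge0]), so
    every term of the series has a nonnegative sum over the pairs, and the
    first one is at most the whole energy ([ratio_cos_le_energy]).  With
    t = d / (d + 1) the pairs with b_i = b_j contribute s^2 ln(d + 1) / d, and
    the others about - ln |b_i - b_j|; the sum of these is bounded above by
    heights, because the discriminant of the b_i times suitable denominators
    is a nonzero integer ([orbit_discriminant_int]).  The outcome is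
    [orbit_angular_sum], and the definition of D turns it into
    |sum_i exp(i theta_i)| <= s (|n|_1 (4 ln(D + 1) / D + 16 h))^(1/2).

    Fourier analysis.  A test function of class C^(N+1) on the polycircle is
    approximated by its discrete Fourier polynomials on grids of (2 K + 1)^N
    points.  Their coefficients a_n satisfy |n|_oo^(N+1) |a_n| <= B, by finite
    differences, so that the sum of |a_n| |n|_1^(1/2) is bounded independently
    of K ([sum_dft_weighted_le]).  The same bound controls both the
    interpolation error and the mean of the polynomial over the orbit, and the
    coefficient of frequency 0 tends to the Haar integral; letting K grow gives
    [test_function_equidistribution].

    The two errors are O(h), hence O(h^(1/2)) as h <= 1, and O((4 ln(D + 1) / D + 16 h)^(1/2)),
    both bounded by a multiple of (4 h + 64 ln(D + 1) / D)^(1/2). *)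

(** * Rational numbers and algebraic integers *)

(** The roots of the minimal polynomial of x generate a Galois number field.
    Each of its automorphisms extends to algC, so that x is in the field fixed
    by its Galois group. *)
Lemma fixed_by_aut_Crat (x : algC) :
  (forall sigma : {rmorphism algC -> algC}, sigma x = x) -> x \in Crat.
Proof.
move=> fix_x; have [r Dr] := closed_field_poly_normal (minCpoly x).
rewrite (monicP (minCpoly_monic x)) scale1r in Dr.
have [Qs [QsC [s1 Ds1 genQs]]] := num_field_exists r.
have [p [Dp mon_p] dv_p] := minCpolyP x.
pose p1 : {poly Qs} := map_poly (in_alg Qs) p.
have p1C : map_poly QsC p1 = minCpoly x.
  rewrite Dp -map_poly_comp; apply: eq_map_poly => a /=.
  by rewrite alg_num_field fmorph_rat.
have Dp1 : p1 = \prod_(z <- s1) ('X - z%:P).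
  apply: (map_poly_inj QsC); rewrite p1C Dr -Ds1 big_map rmorph_prod.
  by apply: eq_bigr => z _; rewrite /= map_polyXsubC.
have splitQs : splittingFieldFor 1 p1 {:Qs}.
  by exists s1; rewrite ?Dp1 ?eqpxx.
have p1_over : p1 \is a polyOver 1%VS.
  by apply/polyOverP => i; rewrite coef_map /= memvZ ?mem1v.
have splitQ : SplittingField.axiom Qs by exists p1.
pose QsM := FieldExt_isSplittingField.Build rat Qs splitQ.
pose Qn : splittingFieldType rat := HB.pack (FieldExt.sort Qs) QsM.
have galQ : galois 1 {:Qn}.
  apply/and3P; split; first exact: subvf.
    apply/separableP => y _; apply: pcharf0_separable => q.
    by rewrite (pchar_lalg Qn); exact: pchar_num.
  exact: normalFieldf.
have /mapP[x1 _ Dx1] : x \in map QsC s1.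
  by rewrite Ds1 -root_prod_XsubC -Dr root_minCpoly.
have : (x1 : Qn) \in fixedField 'Gal({:Qn} / 1)%g.
  apply/fixedFieldP; first exact: memvf.
  move=> g _; have [nu Dnu] := extend_algC_subfield_aut QsC (g : {rmorphism Qs -> Qs}).
  by apply: (fmorph_inj QsC); rewrite -[LHS]/(QsC (g x1)) Dnu -Dx1 fix_x.
move/galois_fixedField: galQ => -> /vlineP[a Da].
by rewrite Dx1 Da alg_num_field fmorph_rat Crat_rat.
Qed.

Lemma integralOver_Aint (x : algC) :
  integralOver (intr : int -> algC) x <-> x \in Aint.
Proof.
split=> [[p mon_p px0]|].
  apply: root_monic_Aint px0 _ _.
    by rewrite monicE lead_coef_map_inj ?(monicP mon_p)//; exact: intr_inj.
  by apply/polyOverP => i; rewrite coef_map /= rpred_int.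
rewrite unfold_in => /floorpP[p Dp]; exists p.
  move: (minCpoly_monic x); rewrite Dp !monicE lead_coef_map_inj //.
    by rewrite -(rmorph1 intr) => /eqP/intr_inj ->.
  exact: intr_inj.
by rewrite -Dp root_minCpoly.
Qed.

Lemma Aint_integrally_closed (p : {poly algC}) x :
  p \is monic -> p \is a polyOver Aint -> root p x -> x \in Aint.
Proof.
move=> mon_p /allP Ap px0; apply/integralOver_Aint.
by apply: integral_root_monic mon_p px0 _ => y /Ap yA; apply/integralOver_Aint.
Qed.

(** If c is the leading coefficient and n the degree of p, c x is a root of the
    monic polynomial c^(n-1) p(X / c), whose coefficients p_i c^(n-1-i) are
    algebraic integers. *)
Lemma Aint_lead_coef_root (p : {poly algC}) x :
  p \is a polyOver Aint -> root p x -> lead_coef p * x \in Aint.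
Proof.
move=> Ap px0; have [->|p0] := eqVneq p 0; first by rewrite lead_coef0 mul0r rpred0.
have sp : (1 < size p)%N by apply: root_size_gt1 px0.
pose n := (size p).-2; have Dn : size p = n.+2 by rewrite /n; case: (size p) sp => [|[]].
pose c := lead_coef p; have Dc : c = p`_n.+1 by rewrite /c lead_coefE Dn.
pose q := \poly_(i < n.+1) (p`_i * c ^+ (n - i)) + 'X^(n.+1).
apply: (@Aint_integrally_closed q).
- by rewrite monicE lead_coefDr ?lead_coefXn// size_polyXn ltnS size_poly.
- rewrite rpredD ?polyOverXn// polyOver_poly// => i _.
  by rewrite rpredM ?rpredX ?(polyOverP Ap)// Dc (polyOverP Ap).
rewrite /root hornerD horner_poly hornerXn.
have : \sum_(i < n.+2) p`_i * x ^+ i == 0 by rewrite -Dn -horner_coef.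
rewrite big_ord_recr /= -Dc -/c => /eqP/(congr1 (fun y => c ^+ n * y)).
rewrite mulr0 mulrDr mulr_sumr => E; apply/eqP; apply: etrans E; congr (_ + _); last first.
  by rewrite exprMn exprSr; ring.
apply: eq_bigr => i _; have -> : c ^+ n = c ^+ (n - i) * c ^+ i by rewrite -exprD subnK// -ltnS.
rewrite exprMn; ring.
Qed.

(** By induction on the degree: the leading coefficient c of p, and c x, are
    algebraic integers, so the leading monomial of p can be removed without
    losing the hypothesis. *)
Lemma polyOver_Aint_divXsubC (p : {poly algC}) x :
  p * ('X - x%:P) \is a polyOver Aint -> p \is a polyOver Aint.
Proof.
have [m] := ubnP (size p); elim: m p => // m IHm p szp Ap.
have [->|p0] := eqVneq p 0; first exact: rpred0.
pose c := lead_coef p; pose n := (size p).-1.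
have szpn : size p = n.+1 by rewrite /n prednK// size_poly_gt0.
have Dc : lead_coef (p * ('X - x%:P)) = c by rewrite lead_coef_Mmonic// monicXsubC.
have cA : c \in Aint by rewrite -Dc lead_coefE (polyOverP Ap).
have cxA : c * x \in Aint.
  by rewrite -Dc Aint_lead_coef_root// rootM root_XsubC eqxx orbT.
have Dp : p = p - c *: 'X^n + c *: 'X^n by rewrite subrK.
have cXA : c *: 'X^n \is a polyOver Aint by rewrite polyOverZ// polyOverXn.
rewrite Dp rpredD//; apply: IHm.
  apply: leq_trans (_ : n.+1 <= m)%N; last by rewrite -szpn.
  rewrite ltnS; apply/leq_sizeP => j; rewrite leq_eqVlt => /predU1P[<-|nj].
    by rewrite coefB coefZ coefXn eqxx mulr1 /c lead_coefE subrr.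
  rewrite coefB coefZ coefXn gtn_eqF// mulr0 subr0 nth_default//.
  by rewrite szpn.
rewrite mulrBl rpredB// -scalerAl mulrBr scalerBr rpredB//.
  by rewrite -exprSr polyOverZ// polyOverXn.
by rewrite -mul_polyC mulrCA -polyCM mulrC mul_polyC polyOverZ// polyOverXn.
Qed.

(** One coefficient c clears the denominators of all the partial products of
    roots: dividing out the other factors keeps the coefficients integral, and
    up to sign the product is then the constant coefficient. *)
Lemma Aint_lead_subprod (I : finType) (c : algC) (y : I -> algC) (T : pred I) :
  c *: \prod_i ('X - (y i)%:P) \is a polyOver Aint ->
  c * \prod_(i | T i) y i \in Aint.
Proof.
rewrite (bigID T) /= scalerAl => Ap.
have {Ap} : c *: \prod_(i | T i) ('X - (y i)%:P) \is a polyOver Aint.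
  move: (c *: _) Ap => p; rewrite -big_filter.
  elim: [seq _ <- _ | _] p => [|i r IHr] p; first by rewrite big_nil mulr1.
  by rewrite big_cons mulrA => /IHr; apply: polyOver_Aint_divXsubC.
move/polyOverP => /(_ 0%N); rewrite -horner_coef0 hornerZ horner_prod.
under eq_bigr do rewrite hornerXsubC sub0r.
by rewrite prodrN mulrCA rpredMsign.
Qed.

(** * Galois orbits and their integrality *)

Section GaloisOrbit.
Variables (I : finType) (N : nat) (xi : 'I_N -> algC) (x : I -> 'I_N -> algC).
Implicit Types (sigma : {rmorphism algC -> algC}) (n : 'I_N -> int).

(** Sums over the orbit become sums over the index type, hence the exclusion of
    repetitions. *)
Definition enum_orbit : Prop :=
  [/\ forall i, exists sigma, forall l, x i l = sigma (xi l),
      forall sigma, exists i, forall l, x i l = sigma (xi l)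
    & forall i j, (forall l, x i l = x j l) -> i = j].

Definition equivariant (phi : I -> algC) : Prop :=
  forall sigma i j, (forall l, x j l = sigma (x i l)) -> phi j = sigma (phi i).

Hypothesis orbx : enum_orbit.

Lemma orbit_base : exists i, forall l, x i l = xi l.
Proof. by have [_ + _] := orbx => /(_ idfun). Qed.

Lemma orbit_perm sigma : exists2 p : I -> I, injective p & forall i l, x (p i) l = sigma (x i l).
Proof.
have [orb1 orb2 orb3] := orbx.
have ex i : exists j, forall l, x j l = sigma (x i l).
  have [tau Dtau] := orb1 i.
  have [j Dj] := orb2 (GRing.RMorphism.clone _ _ (sigma \o tau) _).
  by exists j => l; rewrite Dj Dtau.
have [f Df] := choice ex.
have finj : injective f.
  move=> i j fij; apply: orb3 => l; apply: (fmorph_inj sigma).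
  by rewrite -!Df fij.
by exists f.
Qed.

Lemma orbit_transitive i j : exists sigma, forall l, x j l = sigma (x i l).
Proof.
have [orb1 _ _] := orbx; have [s Ds] := orb1 i; have [t Dt] := orb1 j.
exists (GRing.RMorphism.clone _ _ (t \o algC_invaut s) _) => l.
by rewrite Ds /= algC_autK Dt.
Qed.

Lemma equivariant_perm phi sigma (p : I -> I) : equivariant phi ->
  (forall i l, x (p i) l = sigma (x i l)) -> forall i, phi (p i) = sigma (phi i).
Proof. by move=> eqv Dp i; apply: eqv. Qed.

Lemma equivariant_coord l : equivariant (fun i => x i l).
Proof. by move=> sigma i j ->. Qed.

Lemma equivariant_chi n : equivariant (fun i => chi n (x i)).
Proof.
move=> sigma i j Dj; rewrite /chi rmorph_prod; apply: eq_bigr => l _.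
by rewrite Dj fmorphXz.
Qed.

(** The Galois group permutes the fibres of phi, transitively. *)
Lemma card_equivariant_fibre phi i j : equivariant phi ->
  #|[pred k | phi k == phi i]| = #|[pred k | phi k == phi j]|.
Proof.
move=> eqv; have [s Ds] := orbit_transitive j i; have [p injp Dp] := orbit_perm s.
have pj : p j = i by have [_ _ orb3] := orbx; apply: orb3 => l; rewrite Dp Ds.
rewrite -[RHS](fintype.card_image injp); apply: eq_card => k.
rewrite -[k](f_invF injp) (fintype.mem_image injp) !inE.
by rewrite (equivariant_perm eqv Dp) -pj (equivariant_perm eqv Dp) fmorph_eq.
Qed.

Lemma rational_poly_minCpoly_dvd (q : {poly algC}) y :
  q \is a polyOver Crat -> root q y -> minCpoly y %| q.
Proof.
move=> /polyOverP Crq; have [p [-> _] dv_p] := minCpolyP y.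
have rq i := sig_eqW (CratP _ (Crq i)).
have -> : q = map_poly ratr (\poly_(i < size q) sval (rq i)).
  apply/polyP => i; rewrite coef_map coef_poly /=.
  by case: ltnP => [_|/(nth_default 0) ->]; [case: (rq i)|rewrite rmorph0].
by rewrite dv_p dvdp_map.
Qed.

(** The product of the X - v over the distinct values v of phi is invariant, so
    it is rational and it is the minimal polynomial of each value; all fibres
    of phi have the same cardinal m. *)
Lemma orbit_charpoly phi i0 : equivariant phi ->
  exists m : nat,
    [/\ \prod_i ('X - (phi i)%:P) = minCpoly (phi i0) ^+ m,
        (m * algdeg (phi i0))%N = #|I|
      & forall i, #|[pred k | phi k == phi i]| = m].
Proof.
move=> eqv; pose m := #|[pred k | phi k == phi i0]|.
pose V := undup [seq phi i | i <- enum I]; pose q := \prod_(v <- V) ('X - v%:P).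
have uV : uniq V by apply: undup_uniq.
have mV v : (v \in V) = [exists i, phi i == v].
  rewrite mem_undup; apply/mapP/existsP => [[i _ ->]|[i /eqP <-]]; first by exists i.
  by exists i; rewrite ?mem_enum.
have q0 : root q (phi i0).
  by rewrite root_prod_XsubC mV; apply/existsP; exists i0.
have Crq : q \is a polyOver Crat.
  apply/polyOverP => k; apply: fixed_by_aut_Crat => s.
  rewrite -coef_map; congr (_`_k); rewrite rmorph_prod /q.
  have [p injp Dp] := orbit_perm s.
  under eq_bigr do rewrite /= map_polyXsubC.
  transitivity (\prod_(v <- map s V) ('X - v%:P)); first by rewrite big_map.
  suff pV : perm_eq (map s V) V by rewrite (perm_big V pV).
  apply: uniq_perm => //; first by rewrite map_inj_uniq//; exact: fmorph_inj.
  move=> v; rewrite mV; apply/mapP/existsP => [[w + ->]|[i /eqP <-]].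
    by rewrite mV => /existsP[i /eqP <-]; exists (p i); rewrite (equivariant_perm eqv Dp).
  exists (phi (invF injp i)); first by rewrite mV; apply/existsP; exists (invF injp i).
  by rewrite -(equivariant_perm eqv Dp) f_invF.
have Dq : q = minCpoly (phi i0).
  apply/eqP; rewrite -eqp_monic ?minCpoly_monic ?monic_prod_XsubC//.
  rewrite /eqp rational_poly_minCpoly_dvd// andbT.
  apply: uniq_roots_dvdp; last by rewrite uniq_rootsE.
  apply/allP => v; rewrite mV => /existsP[i /eqP <-].
  have [s Ds] := orbit_transitive i0 i.
  by rewrite (eqv _ _ _ Ds) -(minCpoly_aut s) root_minCpoly.
have Dprod : \prod_i ('X - (phi i)%:P) = minCpoly (phi i0) ^+ m.
  rewrite -Dq -big_enum -(big_map phi xpredT (fun v => 'X - v%:P)) /=.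
  rewrite -big_undup_iterop_count -/V /q -prodrXl.
  apply: eq_big_seq => v; rewrite mV => /existsP[i /eqP Dv].
  rewrite [RHS]/GRing.exp; congr (iterop _ _ _ _).
  rewrite /m -(card_equivariant_fibre i) // count_map cardE [in RHS]/enum_mem size_filter enumT.
  by apply: eq_count => j /=; rewrite inE Dv.
exists m; split=> [//||i]; last exact: card_equivariant_fibre.
move: Dprod; rewrite -big_enum /= => /(congr1 (fun p : {poly algC} => (size p).-1)).
by rewrite size_prod_XsubC size_exp mulnC -/(algdeg _) -cardE => <-.
Qed.

Variables (c : 'I_N -> int) (n : 'I_N -> int).
Hypothesis xi0 : forall l, xi l != 0.
Hypothesis c0 : forall l, c l != 0.
Hypothesis cP : forall l,
  (c l)%:~R *: \prod_i ('X - (x i l)%:P) \is a polyOver Num.int.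

(** For a negative exponent, a partial product of inverses of conjugates is the
    complementary product divided by the product of all conjugates, hence the
    second factor. *)
Definition orbit_denom l : algC :=
  if 0 <= n l then (c l)%:~R else (c l)%:~R * \prod_i x i l.

Lemma orbit_neq0 i l : x i l != 0.
Proof. by have [+ _ _] := orbx => /(_ i)[s ->]; rewrite fmorph_eq0. Qed.

Lemma orbit_denom_subprod l (T : pred I) :
  orbit_denom l ^+ `|n l| * \prod_(i | T i) x i l ^ n l \in Aint.
Proof.
have cA (U : pred I) : (c l)%:~R * \prod_(i | U i) x i l \in Aint.
  by apply: Aint_lead_subprod; apply: polyOverS (cP l); exact: Aint_Cint.
rewrite /orbit_denom; case: (lerP 0 (n l)) => [n0|n0].
  under eq_bigr do rewrite -[in x _ _ ^ _](gez0_abs n0) -exprnP.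
  by rewrite prodrXl -exprMn rpredX.
have E i : x i l ^ n l = (x i l ^+ `|n l|)^-1.
  by rewrite exprnP ltz0_abs// invr_expz opprK.
rewrite (eq_bigr _ (fun i _ => E i)).
have -> : \prod_(i | T i) (x i l ^+ `|n l|)^-1 =
         (\prod_(i | T i) (x i l)^-1) ^+ `|n l|.
  by rewrite -prodrXl; apply: eq_bigr => i _; rewrite exprVn.
rewrite -exprMn rpredX// (bigID T) /= prodfV mulrAC -!mulrA.
rewrite mulKf ?cA//.
by apply/prodf_neq0 => i _; exact: orbit_neq0.
Qed.

Lemma orbit_denom_int l : orbit_denom l \in Num.int.
Proof.
rewrite /orbit_denom; case: ifP => _; first exact: rpred_int.
have /polyOverP/(_ 0%N) := cP l.
rewrite -horner_coef0 hornerZ horner_prod.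
under eq_bigr do rewrite hornerXsubC sub0r.
by rewrite prodrN mulrCA rpredMsign.
Qed.

Lemma orbit_denom_neq0 l : orbit_denom l != 0.
Proof.
rewrite /orbit_denom; case: ifP => _; first by rewrite intr_eq0.
rewrite mulf_neq0 ?intr_eq0//; apply/prodf_neq0 => i _; exact: orbit_neq0.
Qed.

Lemma chi_orbit_subprod (T : pred I) :
  (\prod_l orbit_denom l ^+ `|n l|) * \prod_(i | T i) chi n (x i) \in Aint.
Proof.
rewrite /chi exchange_big -big_split /=.
by apply: rpred_prod => l _; exact: orbit_denom_subprod.
Qed.

(** The double product is invariant, hence rational.  Once expanded, a term is up
    to sign the product of b i over some pairs (i, j) and of b j over the other
    ones.  For fixed j the former, and for fixed i the latter, is a partial
    product over the orbit, which one factor of denominator makes integral. *)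
Lemma orbit_discriminant_int :
  (\prod_l orbit_denom l ^+ `|n l|) ^+ (2 * #|I|) *
    \prod_i \prod_(j | chi n (x i) != chi n (x j)) (chi n (x i) - chi n (x j))
  \in Num.int.
Proof.
set A := \prod_l _; pose b i := chi n (x i).
rewrite -[X in _ * X]/(\prod_i \prod_(j | b i != b j) (b i - b j)).
have Aint_A : A \in Num.int.
  by apply: rpred_prod => l _; rewrite rpredX// orbit_denom_int.
apply: Cint_rat_Aint.
  rewrite rpredM//; apply: fixed_by_aut_Crat => s.
    by have /intrP[z ->] := Aint_A; rewrite rmorphXn /= rmorph_int.
  have [p injp Dp] := orbit_perm s.
  have bp := equivariant_perm (equivariant_chi n) Dp.
  rewrite rmorph_prod /= [RHS](reindex_inj injp); apply: eq_bigr => i _.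
  rewrite rmorph_prod /= [RHS](reindex_inj injp) /=; apply: eq_big => [j|j _].
    by rewrite /b !bp fmorph_eq.
  by rewrite rmorphB /b !bp.
have subA (T : pred I) : A * \prod_(i | T i) b i \in Aint := chi_orbit_subprod T.
clearbody A b.
(* Each factor contributes either b i or - b j once the product is expanded. *)
under eq_bigr do rewrite big_mkcond.
rewrite pair_big /=.
pose F (u : I * I) := if b u.1 != b u.2 then b u.1 else 1.
pose G (u : I * I) := if b u.1 != b u.2 then - b u.2 else 0.
rewrite (eq_bigr (fun u => F u + G u)); last first.
  by move=> u _; rewrite /F /G; case: ifP => //; rewrite addr0.
rewrite bigA_distr mulr_sumr; apply: rpred_sum => J _.
pose G' (u : I * I) := if b u.1 != b u.2 then -1 else 0 : algC.
have -> : \prod_u (if u \in J then F u else G u) =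
   (\prod_u (if u \in J then 1 else G' u)) *
   ((\prod_i \prod_(j | ((i, j) \in J) && (b i != b j)) b i) *
    (\prod_i \prod_(j | ((i, j) \notin J) && (b i != b j)) b j)).
  rewrite !pair_big_dep /=.
  rewrite [X in _ * (X * _)]big_mkcond [X in _ * (_ * X)]big_mkcond -!big_split /=.
  apply: eq_bigr => -[i j] _ /=; rewrite /F /G /G' /=.
  by case: ifP => _; case: ifP; rewrite ?mulr1 ?mul1r// mulN1r.
rewrite mulrCA mul2n -addnn exprD mulrACA; apply: rpredM.
  apply: rpred_prod => u _; rewrite /G'; case: ifP => _; rewrite ?rpred1//.
  by case: ifP => _; rewrite ?rpredN ?rpred1 ?rpred0.
have Apow (T : I -> pred I) :
    A ^+ #|I| * \prod_i \prod_(j | T i j) b j \in Aint.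
  rewrite -[#|I|]/#|xpredT : pred I| -prodr_const -big_split /=; apply: rpred_prod => i _.
  exact: subA.
apply: rpredM; last exact: Apow.
by rewrite (exchange_big_dep xpredT).
Qed.

End GaloisOrbit.

Lemma map_minZpoly (x : algC) :
  map_poly intr (minZpoly x) = (lead_coef (minZpoly x))%:~R *: minCpoly x.
Proof.
have [_ irr rootx szx] := minZpolyP x.
have lc : lead_coef (map_poly intr (minZpoly x)) = (lead_coef (minZpoly x))%:~R :> algC.
  by rewrite lead_coef_map_inj//; exact: intr_inj.
have sz : size (map_poly intr (minZpoly x) : {poly algC}) = size (minCpoly x).
  rewrite size_map_inj_poly ?szx//; last exact: intr_inj.
  by rewrite prednK// size_poly_gt0 minCpoly_eq0.
have f0 : (lead_coef (minZpoly x))%:~R != 0 :> algC.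
  by rewrite intr_eq0 lead_coef_eq0 -size_poly_eq0 szx.
have : minCpoly x %= map_poly intr (minZpoly x).
  rewrite -dvdp_size_eqp ?sz// rational_poly_minCpoly_dvd//.
  by apply/polyOverP => i; rewrite coef_map /= -ratr_int Crat_rat.
move/eqp_eq; rewrite lc (monicP (minCpoly_monic x)) scale1r => <-.
by [].
Qed.

Lemma orbit_coord_int (I : finType) (N : nat) (xi : 'I_N -> algC)
    (x : I -> 'I_N -> algC) (l : 'I_N) : enum_orbit xi x ->
  exists m : nat, let c := lead_coef (minZpoly (xi l)) ^+ m in
    [/\ (m * algdeg (xi l))%N = #|I|, c != 0 &
        c%:~R *: \prod_i ('X - (x i l)%:P) = map_poly intr (minZpoly (xi l)) ^+ m].
Proof.
move=> orbx; have [i0 Di0] := orbit_base orbx.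
have [m [Dp Dm _]] := orbit_charpoly orbx i0 (equivariant_coord (x := x) l).
rewrite Di0 in Dp Dm; exists m; split => //.
  have [_ _ _ szx] := minZpolyP (xi l).
  by rewrite expf_neq0// lead_coef_eq0 -size_poly_eq0 szx.
by rewrite Dp map_minZpoly exprZn rmorphXn.
Qed.

(** * The logarithmic cosine series *)

Section LogSeries.
Variable R : realType.
Implicit Types (r phi : R) (K : nat).

Lemma cos_mulnS_rec phi (k : nat) :
  cos (k.+2%:R * phi) + cos (k%:R * phi) = 2 * cos phi * cos (k.+1%:R * phi).
Proof.
have -> : k.+2%:R * phi = k.+1%:R * phi + phi by rewrite -[in LHS]natr1; ring.
have -> : k%:R * phi = k.+1%:R * phi - phi by rewrite -[in RHS]natr1; ring.
by rewrite cosD cosB; ring.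
Qed.

Lemma quad_cos_ge phi r : 0 <= r -> (1 - r) ^+ 2 <= 1 - 2 * r * cos phi + r ^+ 2.
Proof. by move=> r0; have := cos_le1 phi; nra. Qed.

(** The real part of a geometric sum of ratio r exp(i phi), multiplied by
    |1 - r exp(i phi)|^2. *)
Lemma sum_cos_geometric phi r K :
  (1 - 2 * r * cos phi + r ^+ 2) *
    (\sum_(k < K) r ^+ k * cos (k.+1%:R * phi)) =
  cos phi - r - r ^+ K * (cos (K.+1%:R * phi) - r * cos (K%:R * phi)).
Proof.
elim: K => [|K IHK]; first by rewrite big_ord0 expr0 !mul1r mul0r cos0; ring.
rewrite big_ord_recr /= mulrDr IHK.
have -> : cos (K.+2%:R * phi) = 2 * cos phi * cos (K.+1%:R * phi) - cos (K%:R * phi).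
  by rewrite -cos_mulnS_rec addrK.
rewrite (exprS r K).
move: (cos _) (cos (K.+1%:R * _)) (cos (K%:R * _)) (r ^+ K) => a b c d; ring.
Qed.

(** The remainder of order K of the series
    - ln |1 - r exp(i phi)| = sum_(k >= 1) r^k cos(k phi) / k. *)
Definition log_remainder phi K r : R :=
  - (2^-1 * ln (1 - 2 * r * cos phi + r ^+ 2)) -
  \sum_(k < K) k.+1%:R^-1 * cos (k.+1%:R * phi) * r ^+ k.+1.

(** Differentiation in r turns the series into a geometric one, whose remainder
    is explicit. *)
Lemma is_derive_log_remainder phi K r : 0 <= r < 1 ->
  is_derive r 1 (log_remainder phi K)
    (r ^+ K * (cos (K.+1%:R * phi) - r * cos (K%:R * phi)) /
     (1 - 2 * r * cos phi + r ^+ 2)).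
Proof.
move=> /andP[r0 r1]; set q := 1 - 2 * r * cos phi + r ^+ 2.
have q0 : 0 < q by apply: lt_le_trans (quad_cos_ge _ r0); rewrite exprn_gt0// subr_gt0.
have dq : is_derive r 1 (fun x : R => 1 - 2 * x * cos phi + x ^+ 2) (2 * (r - cos phi)).
  by apply: is_derive_eq; rewrite /GRing.scale /=; ring.
have dln : is_derive r 1 (fun x : R => ln (1 - 2 * x * cos phi + x ^+ 2))
             (q^-1 * (2 * (r - cos phi))).
  apply: (is_derive1_comp (f := @ln R)); exact: is_derive1_ln.
have dsum : is_derive r 1
    (fun x : R => \sum_(k < K) k.+1%:R^-1 * cos (k.+1%:R * phi) * x ^+ k.+1)
    (\sum_(k < K) r ^+ k * cos (k.+1%:R * phi)).
  have -> : (fun x : R => \sum_(k < K) k.+1%:R^-1 * cos (k.+1%:R * phi) * x ^+ k.+1)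
    = \sum_(k < K) (fun x : R => k.+1%:R^-1 * cos (k.+1%:R * phi) * x ^+ k.+1).
    by apply/funext => x; rewrite fct_sumE.
  apply: is_derive_sum => k.
  have -> : r ^+ k * cos (k.+1%:R * phi) =
      k.+1%:R^-1 * cos (k.+1%:R * phi) * (k.+1%:R * r ^+ k).
    have k0 : k.+1%:R != 0 :> R by rewrite pnatr_eq0.
    by field.
  move: (k.+1%:R^-1 * cos _) => a.
  have dX : is_derive r 1 (fun x : R => x ^+ k.+1) (k.+1%:R * r ^+ k).
    have := @is_deriveX R R (@id R) k.+1 r 1 1 (is_derive_id _ _).
    by rewrite exprfctE /GRing.scale /= mulr1.
  by apply: is_derive_eq; rewrite /GRing.scale /=; ring.
apply: is_derive_eq.
have := sum_cos_geometric phi r K; rewrite -/q => E.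
apply: (mulfI (lt0r_neq0 q0)); rewrite mulrBr E /GRing.scale /=.
by field; rewrite lt0r_neq0.
Qed.

Lemma log_remainder_le phi K r : 0 <= r < 1 ->
  `|log_remainder phi K r| <= 2 * r ^+ K / (1 - r) ^+ 2.
Proof.
move=> /andP[r0 r1].
have [||c] := @MVT_segment R (log_remainder phi K)
  (fun r => r ^+ K * (cos (K.+1%:R * phi) - r * cos (K%:R * phi)) /
     (1 - 2 * r * cos phi + r ^+ 2)) 0 r r0.
- move=> x; rewrite in_itv /= => /andP[x0 xr].
  by apply: is_derive_log_remainder; rewrite ltW//= (lt_trans xr).
- apply: derivable_within_continuous => x; rewrite in_itv /= => /andP[x0 xr].
  by apply: ex_derive; apply: is_derive_log_remainder; rewrite x0 (le_lt_trans xr).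
rewrite in_itv /= => /andP[c0 cr].
have -> : log_remainder phi K 0 = 0.
  rewrite /log_remainder mulr0 mul0r subr0 expr0n addr0 ln1 mulr0 oppr0 big1 ?subrr//.
  by move=> k _; rewrite expr0n mulr0.
rewrite !subr0 => ->; rewrite !normrM.
have q0 := quad_cos_ge phi c0.
have qr : (1 - r) ^+ 2 <= 1 - 2 * c * cos phi + c ^+ 2.
  by apply: le_trans q0; rewrite lerXn2r ?nnegrE; lra.
have r2 : 0 < (1 - r) ^+ 2 by rewrite exprn_gt0// subr_gt0.
rewrite normfV (ger0_norm (ltW (lt_le_trans r2 qr))) (ger0_norm r0).
rewrite ger0_norm ?exprn_ge0//.
have Hc : `|cos (K.+1%:R * phi) - c * cos (K%:R * phi)| <= 2.
  have := cos_le1 (K.+1%:R * phi); have := cos_le1 (K%:R * phi).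
  have := cos_geN1 (K.+1%:R * phi); have := cos_geN1 (K%:R * phi).
  by rewrite ler_norml; nra.
have cK : c ^+ K <= r ^+ K by rewrite lerXn2r ?nnegrE.
have q1 : (1 - 2 * c * cos phi + c ^+ 2)^-1 <= ((1 - r) ^+ 2)^-1.
  by rewrite lef_pV2 ?posrE// (lt_le_trans r2).
have cK0 := exprn_ge0 K c0.
have q10 : 0 <= (1 - 2 * c * cos phi + c ^+ 2)^-1.
  by rewrite invr_ge0 (le_trans (ltW r2)).
apply: (@le_trans _ _ (r ^+ K * 2 * ((1 - r) ^+ 2)^-1 * 1)).
  by rewrite !ler_pM ?mulr_ge0// ltW.
by rewrite mulr1 [r ^+ K * 2]mulrC.
Qed.
End LogSeries.

(** * Jensen's formula *)

Section CircleIntegral.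
Variable R : realType.
Implicit Types (r theta : R) (K k : nat).
Notation mu := (@lebesgue_measure R).
Notation circ := (`[0, 2 * pi]%classic : set R).

Lemma twopi_gt0 : 0 < 2 * pi :> R.
Proof. by rewrite mulr_gt0// pi_gt0. Qed.

Lemma measurable_circ : measurable (circ : set (measurableTypeR R)).
Proof. exact: measurable_itv. Qed.

Lemma mu_circ : mu circ = (2 * pi)%:E.
Proof. by rewrite lebesgue_measure_itv /= lte_fin twopi_gt0 oppr0 adde0. Qed.

Lemma continuous_circ_integrable (f : R -> R) :
  continuous f -> mu.-integrable circ (EFin \o f).
Proof.
move=> cf; apply: continuous_compact_integrable; first exact: segment_compact.
by apply: continuous_subspaceT.
Qed.

Lemma continuous_affine (a theta : R) : continuous (fun t : R => a * (t - theta)).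
Proof.
move=> t; apply: cvgM; first exact: cvg_cst.
by apply: cvgB; [exact: cvg_id|exact: cvg_cst].
Qed.

Lemma continuous_cos_affine (a theta : R) : continuous (fun t : R => cos (a * (t - theta))).
Proof.
move=> t; apply: (continuous_comp (f := fun t => a * (t - theta))).
  exact: continuous_affine.
exact: continuous_cos.
Qed.

Lemma Rintegral_cos_affine k theta :
  \int[mu]_(t in circ) cos (k.+1%:R * (t - theta)) = 0.
Proof.
pose F := fun t : R => k.+1%:R^-1 * sin (k.+1%:R * (t - theta)).
have k0 : k.+1%:R != 0 :> R by rewrite pnatr_eq0.
have dF (t : R) : is_derive t 1 F (cos (k.+1%:R * (t - theta))).
  have da : is_derive t 1 (fun t : R => k.+1%:R * (t - theta)) k.+1%:R.
    by apply: is_derive_eq; rewrite /GRing.scale /=; ring.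
  have ds : is_derive t 1 (fun t : R => sin (k.+1%:R * (t - theta)))
              (cos (k.+1%:R * (t - theta)) * k.+1%:R).
    exact: (is_derive1_comp (f := @sin R)).
  by apply: is_derive_eq; rewrite /GRing.scale /=; field.
rewrite /Rintegral (@continuous_FTC2 R _ F).
- rewrite -EFinB /= /F.
  have -> : k.+1%:R * (2 * pi - theta) = k.+1%:R * (0 - theta) + (pi *+ 2) *+ k.+1.
    by rewrite -mulr_natr -[pi *+ 2]mulr_natr; ring.
  by rewrite (periodicn (@sinD2pi R)) subrr.
- exact: twopi_gt0.
- by apply: continuous_subspaceT; exact: continuous_cos_affine.
- by split=> [t _||]; [exact: ex_derive|apply: cvg_at_right_filter|apply: cvg_at_left_filter];
    apply: differentiable_continuous; apply/derivable1_diffP; exact: ex_derive.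
- by move=> t _; rewrite derive1E; apply: derive_val.
Qed.
End CircleIntegral.

Section CircleLog.
Variable R : realType.
Implicit Types (r theta v : R) (f g : R -> R).
Notation mu := (@lebesgue_measure R).
Notation circ := (`[0, 2 * pi]%classic : set R).

(** The value is paired with integrability so that linear combinations of
    functions can be integrated without further hypotheses. *)
Definition circ_int f v : Prop :=
  mu.-integrable circ (EFin \o f) /\ \int[mu]_(t in circ) f t = v.

Lemma eq_circ_int f g v : f =1 g -> circ_int f v -> circ_int g v.
Proof. by move=> /funext ->. Qed.

Lemma circ_intD f g v w : circ_int f v -> circ_int g w ->
  circ_int (fun t => f t + g t) (v + w).
Proof.
move=> [fi <-] [gi <-]; split; last by rewrite RintegralD//; exact: measurable_circ.
rewrite (_ : _ \o _ = (EFin \o f) \+ (EFin \o g))%E; last exact/funext.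
by apply: integrableD => //; exact: measurable_circ.
Qed.

Lemma circ_intZ (k : R) f v : circ_int f v -> circ_int (fun t => k * f t) (k * v).
Proof.
move=> [fi <-]; split; last by rewrite RintegralZl//; exact: measurable_circ.
rewrite (_ : _ \o _ = (fun t => k%:E * (EFin \o f) t))%E; last exact/funext.
by apply: integrableZl => //; exact: measurable_circ.
Qed.

Lemma circ_int_cst v : circ_int (fun=> v) (2 * pi * v).
Proof.
split; first by apply: continuous_circ_integrable => t; exact: cvg_cst.
rewrite Rintegral_cst; last exact: measurable_circ.
by rewrite (congr1 fine (mu_circ R)) /= mulrC.
Qed.

Lemma circ_int_sum (I : Type) (s : seq I) (f : I -> R -> R) (v : I -> R) :
  (forall i, circ_int (f i) (v i)) ->
  circ_int (fun t => \sum_(i <- s) f i t) (\sum_(i <- s) v i).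
Proof.
move=> fv; elim: s => [|i s IHs].
  have := circ_int_cst 0; rewrite mulr0 big_nil.
  by apply: eq_circ_int => t; rewrite big_nil.
rewrite big_cons; apply: eq_circ_int (circ_intD (fv i) IHs) => t.
by rewrite big_cons.
Qed.

(** This is 2 ln |exp(i t) - r exp(i theta)|. *)
Definition log_quad r theta (t : R) : R := ln (1 - 2 * r * cos (t - theta) + r ^+ 2).

Lemma continuous_log_quad r theta : 0 <= r < 1 -> continuous (log_quad r theta).
Proof.
move=> /andP[r0 r1] t; rewrite /log_quad.
apply: (continuous_comp (f := fun t => 1 - 2 * r * cos (t - theta) + r ^+ 2)).
  apply: cvgD; last exact: cvg_cst.
  apply: cvgB; first exact: cvg_cst.
  apply: cvgM; first exact: cvg_cst.
  have := @continuous_cos_affine R 1 theta t.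
  by under [X in continuous_at _ X]funext do rewrite mul1r.
apply: continuous_ln; apply: lt_le_trans (quad_cos_ge _ r0).
by rewrite exprn_gt0// subr_gt0.
Qed.

Lemma circ_int_log_remainder r theta K : 0 <= r < 1 ->
  circ_int (fun t => log_remainder (t - theta) K r)
    (- (2^-1 * \int[mu]_(t in circ) log_quad r theta t)).
Proof.
move=> r01; rewrite /log_remainder -[X in circ_int _ X]addr0 -mulNr.
apply: circ_intD.
  have := circ_intZ (- 2^-1) (conj (continuous_circ_integrable
    (continuous_log_quad (theta := theta) r01)) erefl).
  by apply: eq_circ_int => t; rewrite mulNr.
have E0 : 0 = -1 * \sum_(k < K) k.+1%:R^-1 * r ^+ k.+1 * 0 :> R.
  by rewrite big1 ?mulr0// => k _; rewrite mulr0.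
rewrite [X in circ_int _ X]E0; pose S t :=
  -1 * \sum_(k < K) k.+1%:R^-1 * r ^+ k.+1 * cos (k.+1%:R * (t - theta)).
apply: (@eq_circ_int S).
  by move=> t; rewrite /S mulN1r; congr (- _); apply: eq_bigr => k _; rewrite mulrAC.
apply: circ_intZ; apply: circ_int_sum => k; apply: circ_intZ.
split; last exact: Rintegral_cos_affine.
by apply: continuous_circ_integrable; exact: continuous_cos_affine.
Qed.

(** Each term of the cosine series has integral zero, and the remainder tends to
    zero uniformly. *)
Lemma circ_int_log_quad_lt1 r theta : 0 <= r < 1 -> circ_int (log_quad r theta) 0.
Proof.
move=> r01; split.
  by apply: continuous_circ_integrable; exact: continuous_log_quad.
set J := Rintegral _ _ _.
have bound K : `|J| <= 4 * (2 * pi) / (1 - r) ^+ 2 * r ^+ K.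
  have [int_rem E] := circ_int_log_remainder theta K r01.
  have : `|\int[mu]_(t in circ) log_remainder (t - theta) K r| <=
          2 * r ^+ K / (1 - r) ^+ 2 * (2 * pi).
    have H1 := le_normr_Rintegral (@measurable_circ R) int_rem.
    apply: le_trans H1 _.
    rewrite -[leRHS]mulrC; have [i2 <-] := circ_int_cst (2 * r ^+ K / (1 - r) ^+ 2).
    apply: le_Rintegral => //.
      rewrite (_ : EFin \o _ = abse \o (EFin \o (fun t => log_remainder (t - theta) K r))).
        by apply: integrable_abse.
      exact/funext.
    by move=> t _; exact: log_remainder_le.
  rewrite E normrN normrM ger0_norm ?invr_ge0// -/J => H.
  have -> : `|J| = 2 * (2^-1 * `|J|) by field.
  apply: le_trans (ler_wpM2l _ H) _ => //.
  rewrite le_eqVlt; apply/orP; left; apply/eqP; ring.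
have /andP[r0 r1] := r01.
apply/normr0_eq0/eqP; rewrite eq_le normr_ge0 andbT.
have : (4 * (2 * pi) / (1 - r) ^+ 2 * r ^+ K @[K --> \oo] --> 0).
  rewrite -[X in _ --> X](mulr0 (4 * (2 * pi) / (1 - r) ^+ 2)).
  apply: cvgM; first exact: cvg_cst.
  by apply: cvg_expr; rewrite ger0_norm.
move=> H; rewrite -(cvg_lim (@Rhausdorff R) H).
by apply: limr_ge; [exact: cvgP H|apply: nearW].
Qed.
End CircleLog.

Section CircleLogSingular.
Variable R : realType.
Implicit Types (r theta v : R) (f g : R -> R).
Notation mu := (@lebesgue_measure R).
Notation circ := (`[0, 2 * pi]%classic : set R).

(** A null set that contains every t of [0, 2 pi] with cos t = x. *)
Definition cos_exceptions (x : R) : set R := [set acos x; 2 * pi - acos x].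

Lemma cos_exceptionsP (x t : R) : 0 <= t <= 2 * pi -> cos t = x -> cos_exceptions x t.
Proof.
move=> /andP[t0 t2] <-; rewrite /cos_exceptions /=.
have [tpi|pit] := lerP t pi; first by left; rewrite cosK// in_itv /= t0.
right; have -> : cos t = cos (2 * pi - t).
  by rewrite -(cosN t) -(cosD2pi (- t)) addrC mulr_natl.
by rewrite cosK ?in_itv/=; [ring|apply/andP; split; lra].
Qed.

Lemma measurable_cos_exceptions x :
  measurable (cos_exceptions x : set (measurableTypeR R)).
Proof. by apply: measurableU; exact: measurable_set1. Qed.

Lemma mu_cos_exceptions x : mu (cos_exceptions x) = 0%E.
Proof. by apply: countable_lebesgue_measure0; apply: finite_set_countable; apply: finite_set2. Qed.

Lemma cos_sub_eq1 theta t : cos (t - theta) = 1 -> cos t = cos theta.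
Proof.
move=> c1; have s0 : sin (t - theta) = 0.
  apply/eqP; rewrite -sqrf_eq0; apply/eqP.
  have := cos2Dsin2 (t - theta); rewrite c1 expr1n => /eqP.
  by rewrite -subr_eq0 addrAC subrr add0r => /eqP.
by rewrite -[t in LHS](subrK theta) cosD c1 s0 mul1r mul0r subr0.
Qed.

Let rr (n : nat) : R := 1 - n.+2%:R^-1.

Let rr_bound n : 2^-1 <= rr n < 1.
Proof.
rewrite /rr; have : (n.+2%:R : R)^-1 <= 2^-1 by rewrite lef_pV2 ?posrE ?ltr0n// ler_nat.
have : 0 < (n.+2%:R : R)^-1 by rewrite invr_gt0 ltr0n.
by move: (n.+2%:R^-1) => x x0 x2; apply/andP; split; lra.
Qed.

Let rr_cvg : rr n @[n --> \oo] --> (1 : R).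
Proof.
rewrite -[X in _ --> X]subr0; apply: cvgB; first exact: cvg_cst.
by have := @cvg_harmonic R; rewrite -(cvg_shiftn 1) /=; under eq_fun do rewrite addn1.
Qed.

Let rr_homo : {homo rr : n m / (n <= m)%N >-> n <= m}.
Proof. by move=> n m nm; rewrite /rr lerB// lef_pV2 ?posrE ?ltr0n// ler_nat !ltnS. Qed.

(** Division by r makes |exp(i t) - r exp(i theta)|^2 monotone in r: it
    decreases to its value at r = 1. *)
Let quad_over r theta t : R := r + r^-1 - 2 * cos (t - theta).

Let quad_overE r theta t : r != 0 ->
  r * quad_over r theta t = 1 - 2 * r * cos (t - theta) + r ^+ 2.
Proof. by move=> r0; rewrite /quad_over; field. Qed.

Let quad_over_gt0 r theta t : 0 < r < 1 -> 0 < quad_over r theta t.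
Proof.
move=> /andP[r0 r1]; rewrite -(pmulr_rgt0 _ r0) quad_overE ?lt0r_neq0//.
by apply: lt_le_trans (quad_cos_ge _ (ltW r0)); rewrite exprn_gt0// subr_gt0.
Qed.

Let quad_over_le5 r theta t : 2^-1 <= r < 1 -> quad_over r theta t <= 5.
Proof.
move=> /andP[r2 r1]; have := cos_geN1 (t - theta).
have : r^-1 <= 2 by rewrite -[leRHS]invrK lef_pV2 ?posrE ?invr_gt0//; lra.
by rewrite /quad_over; lra.
Qed.

Let quad_over_noninc r s theta t : 0 < r -> r <= s -> s < 1 ->
  quad_over s theta t <= quad_over r theta t.
Proof.
move=> r0 rs s1; have s0 := lt_le_trans r0 rs.
rewrite /quad_over lerD2r -subr_ge0.
have -> : r + r^-1 - (s + s^-1) = (s - r) * (1 - r * s) / (r * s).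
  by field; rewrite !lt0r_neq0.
by rewrite divr_ge0 ?mulr_ge0 ?subr_ge0// ?ltW//; nra.
Qed.

Let circ_int_ln_quad_over r theta : 0 < r < 1 ->
  circ_int (fun t => ln (quad_over r theta t)) (- (2 * pi * ln r)).
Proof.
move=> /andP[r0 r1]; have [|i1 i2] := @circ_int_log_quad_lt1 R r theta.
  by rewrite ltW.
have := circ_intD (conj i1 i2) (circ_int_cst (- ln r)).
rewrite add0r mulrN; apply: eq_circ_int => t.
rewrite /log_quad -quad_overE ?lt0r_neq0// lnM ?posrE//; first by rewrite addrC addKr.
by rewrite quad_over_gt0 ?r0.
Qed.

Lemma measurable_log_quad r theta :
  measurable_fun (setT : set (measurableTypeR R)) (log_quad r theta).
Proof.
apply: (@measurableT_comp _ _ _ _ _ _ (@ln R)); first exact: measurable_ln.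
apply: continuous_measurable_fun => t.
apply: cvgD; last exact: cvg_cst.
apply: cvgB; first exact: cvg_cst.
apply: cvgM; first exact: cvg_cst.
have := @continuous_cos_affine R 1 theta t.
by under [X in continuous_at _ X]funext do rewrite mul1r.
Qed.

(** The function is unbounded near t = theta.  After division by r, monotone
    convergence carries the case r < 1 to the limit r = 1. *)
Lemma circ_int_log_quad_eq1 theta : circ_int (log_quad 1 theta) 0.
Proof.
pose N := cos_exceptions (cos theta); pose D := circ `\` N.
have mN : measurable (N : set (measurableTypeR R)) := measurable_cos_exceptions _.
have mD : measurable (D : set (measurableTypeR R)).
  by apply: measurableD => //; exact: measurable_circ.
pose g n t := (ln 5 - ln (quad_over (rr n) theta t))%:E.
have rr0 n : 0 < rr n by have := rr_bound n; lra.
have rr01 n : 0 < rr n < 1 by rewrite rr0; have /andP[] := rr_bound n.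
have gint n : circ_int (fun t => ln 5 - ln (quad_over (rr n) theta t))
    (2 * pi * ln 5 + 2 * pi * ln (rr n)).
  have := circ_intD (circ_int_cst (ln 5)) (circ_intZ (-1) (circ_int_ln_quad_over theta (rr01 n))).
  rewrite mulN1r opprK; apply: eq_circ_int => t.
  by rewrite mulN1r.
have ig n : mu.-integrable D (g n).
  have [ig _] := gint n.
  by apply: integrableS ig => //; move=> t [].
have Eg n : (\int[mu]_(t in D) g n t)%E = (2 * pi * ln 5 + 2 * pi * ln (rr n))%:E.
  have [ig2 <-] := gint n.
  rewrite /D -negligible_integral//; last exact: mu_cos_exceptions.
  by rewrite fineK//; apply: integrable_fin_num.
have q0 t : D t -> 0 < quad_over 1 theta t.
  move=> [tc tN]; rewrite /quad_over invr1 lt_neqAle eq_sym subr_eq0.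
  have -> : (1 + 1 : R) = 2 * 1 by ring.
  rewrite (inj_eq (mulfI _)) ?pnatr_eq0// eq_sym; apply/andP; split.
    apply/eqP => c1; apply: tN; apply: cos_exceptionsP; last exact: cos_sub_eq1.
    by move: tc; rewrite /= in_itv.
  by have := cos_le1 (t - theta); lra.
have limg t : D t -> limn (g ^~ t) = (ln 5 - ln (quad_over 1 theta t))%:E.
  move=> Dt; apply: cvg_lim => //; apply: cvg_EFin; first exact: nearW.
  apply: cvgB; first exact: cvg_cst.
  apply: (@continuous_cvg _ R R _ _ (fun n => quad_over (rr n) theta t) (@ln R)).
    by apply: continuous_ln; exact: q0.
  apply: cvgB; last exact: cvg_cst.
  by apply: cvgD => //; apply: cvgV => //; exact: oner_neq0.
have cvgI : (\int[mu]_(t in D) g n t)%E @[n --> \oo] -->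
    (\int[mu]_(t in D) (ln 5 - ln (quad_over 1 theta t))%:E)%E.
  have -> : (\int[mu]_(t in D) (ln 5 - ln (quad_over 1 theta t))%:E =
             \int[mu]_(t in D) limn (g ^~ t))%E.
    by apply: eq_integral => t; rewrite inE => Dt; rewrite limg.
  apply: cvg_monotone_convergence => //.
  - by move=> n; exact: measurable_int (ig n).
  - move=> n t _; rewrite lee_fin subr_ge0 ler_ln ?posrE ?quad_over_gt0//.
    exact: quad_over_le5.
  - move=> t _ n m nm; rewrite lee_fin lerB// ler_ln ?posrE ?quad_over_gt0//.
    by apply: quad_over_noninc => //; [exact: rr_homo|have /andP[] := rr01 m].
have lim2 : (\int[mu]_(t in D) g n t)%E @[n --> \oo] --> (2 * pi * ln 5)%:E.
  under eq_fun do rewrite Eg.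
  apply: cvg_EFin; first exact: nearW.
  rewrite -[X in _ --> X]addr0 -(mulr0 (2 * pi)) -(@ln1 R).
  apply: cvgD; first exact: cvg_cst.
  apply: cvgM; first exact: cvg_cst.
  by apply: (@continuous_cvg _ R R _ _ rr (@ln R)) => //; exact: continuous_ln.
have EI : (\int[mu]_(t in D) (ln 5 - ln (quad_over 1 theta t))%:E)%E = (2 * pi * ln 5)%:E.
  by rewrite -(cvg_lim _ cvgI)// (cvg_lim _ lim2).
have E1 t : log_quad 1 theta t = ln (quad_over 1 theta t).
  by rewrite /log_quad -quad_overE ?oner_neq0// mul1r.
have mlq (S : set (measurableTypeR R)) : measurable_fun S (log_quad 1 theta).
  by apply: measurable_funS (measurable_log_quad 1 theta).
have iD : mu.-integrable D (fun t => (ln 5 - ln (quad_over 1 theta t))%:E).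
  apply/integrableP; split.
    apply/measurable_EFinP; apply: measurable_funB; first exact: measurable_cst.
    rewrite (_ : (fun t => ln (quad_over 1 theta t)) = log_quad 1 theta); first exact: mlq.
    by apply/funext => t; rewrite E1.
  under eq_integral => t /[!inE] Dt.
    rewrite gee0_abs; last first.
      rewrite lee_fin subr_ge0 ler_ln ?posrE ?q0// /quad_over invr1.
      by have := cos_geN1 (t - theta); lra.
    over.
  by rewrite EI ltry.
have iD' : mu.-integrable D (EFin \o log_quad 1 theta).
  have i5 : mu.-integrable D (EFin \o (fun=> ln 5)).
    have [i5 _] := circ_int_cst (ln 5 : R).
    by apply: integrableS i5 => //; move=> t [].
  have := integrableB mD i5 iD; apply: eq_integrable => // t _ /=.
  by rewrite -EFinB E1 opprB addrC subrK.
have ic : mu.-integrable circ (EFin \o log_quad 1 theta).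
  apply/(@negligible_integrable _ _ _ mu circ N) => //.
  - by apply/measurable_EFinP.
  - exact: mu_cos_exceptions.
split=> //; rewrite /Rintegral (@negligible_integral _ _ _ mu circ N)//; last first.
- exact: mu_cos_exceptions.
have [i5 E5] := circ_int_cst (ln 5 : R).
have : \int[mu]_(t in D) (ln 5 - log_quad 1 theta t) = 2 * pi * ln 5.
  by rewrite /Rintegral; under eq_integral do rewrite E1; rewrite EI.
rewrite RintegralB//; last first.
  by apply: integrableS i5 => //; move=> t [].
move: E5; rewrite /Rintegral (@negligible_integral _ _ _ mu circ N)//; last first.
- exact: mu_cos_exceptions.
by rewrite -/D => -> /eqP; rewrite -subr_eq0 addrAC subrr add0r oppr_eq0 => /eqP.
Qed.
End CircleLogSingular.

Section Jensen.
Variable R : realType.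
Import Normc.
Notation mu := (@lebesgue_measure R).
Notation circ := (`[0, 2 * pi]%classic : set R).

Lemma normc_ge0 (z : R[i]) : 0 <= normc z.
Proof. by case: z => a b; exact: sqrtr_ge0. Qed.

Lemma normc_eq0 (z : R[i]) : (normc z == 0) = (z == 0).
Proof.
by apply/eqP/eqP => [/eq0_normc//|->]; exact: normc0.
Qed.

Lemma normc_gt0 (z : R[i]) : (0 < normc z) = (z != 0).
Proof. by rewrite lt_neqAle normc_ge0 andbT eq_sym normc_eq0. Qed.

Lemma normc_prod (I : Type) (s : seq I) (P : pred I) (F : I -> R[i]) :
  normc (\prod_(i <- s | P i) F i) = \prod_(i <- s | P i) normc (F i).
Proof. by apply: big_morph; [exact: normcM|exact: normc1]. Qed.

Lemma normcX (z : R[i]) (k : nat) : normc (z ^+ k) = normc z ^+ k.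
Proof. by elim: k => [|k IHk]; rewrite ?expr0 ?normc1// !exprS normcM IHk. Qed.

Lemma ln_prod (I : Type) (s : seq I) (P : pred I) (F : I -> R) :
  (forall i, P i -> 0 < F i) ->
  ln (\prod_(i <- s | P i) F i) = \sum_(i <- s | P i) ln (F i).
Proof.
move=> F0; elim: s => [|i s IHs]; first by rewrite !big_nil ln1.
rewrite !big_cons; case: ifP => // Pi; rewrite lnM ?IHs// posrE ?F0//.
exact: prodr_gt0.
Qed.

Lemma unit_circle_expi (x y : R) : x ^+ 2 + y ^+ 2 = 1 ->
  exists theta, x = cos theta /\ y = sin theta.
Proof.
move=> xy1; have x1 : -1 <= x <= 1 by apply/andP; split; nra.
have ys : `|y| = sin (acos x).
  rewrite sin_acos//.
  by rewrite -sqrtr_sqr -xy1; congr Num.sqrt; ring.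
have [y0|y0] := lerP 0 y.
  by exists (acos x); rewrite acosK ?in_itv//= -ys ger0_norm.
exists (- acos x); rewrite cosN acosK ?in_itv//= sinN -ys ltr0_norm//.
by rewrite opprK.
Qed.

Lemma polar_form (z : R[i]) :
  exists theta, z = (normc z * cos theta +i* (normc z * sin theta))%C.
Proof.
have [->|z0] := eqVneq z 0.
  by exists 0; rewrite normc0 !mul0r.
have nz : normc z != 0 by rewrite normc_eq0.
case: z z0 nz => x y _; set r := normc _ => r0.
have r2 : r ^+ 2 = x ^+ 2 + y ^+ 2 by rewrite sqr_sqrtr// addr_ge0 ?sqr_ge0.
have [|t [ct st]] := @unit_circle_expi (x / r) (y / r).
  by rewrite !expr_div_n -mulrDl -r2 divff// expf_neq0.
by exists t; rewrite -ct -st ![r * _]mulrC !divfK.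
Qed.

Lemma normc_expi_sub (z : R[i]) (theta t : R) :
  z = (normc z * cos theta +i* (normc z * sin theta))%C ->
  ln (normc (expi t - z)) = 2^-1 * log_quad (normc z) theta t.
Proof.
set r := normc z => ->; rewrite /log_quad /expi; simpc => /=.
rewrite (_ : _ + _ = 1 - 2 * r * cos (t - theta) + r ^+ 2); last first.
  rewrite cosB; have := cos2Dsin2 t; have := cos2Dsin2 theta.
  by move: (cos t) (sin t) (cos theta) (sin theta) => a b c d; nra.
set q := 1 - _ + _; have q0 : 0 <= q.
  by apply: le_trans (quad_cos_ge _ (normc_ge0 z)); exact: sqr_ge0.
have [->|qn0] := eqVneq q 0; first by rewrite sqrtr0 ln0// mulr0.
have qp : 0 < q by rewrite lt_neqAle eq_sym qn0.
have -> : ln q = 2 * ln (Num.sqrt q).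
  by rewrite -[q in LHS](sqr_sqrtr q0) lnXn ?sqrtr_gt0// mulr_natl.
by rewrite mulKf.
Qed.

(** For |z| > 1, exp(i t) - z has the same modulus as |z| (exp(i t) - w) for the
    inverse w of the conjugate of z, which reduces to a radius below 1. *)
Lemma circ_int_ln_sub (z : R[i]) :
  circ_int (fun t => ln (normc (expi t - z))) (2 * pi * ln (Num.max 1 (normc z))).
Proof.
have [theta Dz] := polar_form z; set r := normc z in Dz *.
suff : circ_int (log_quad r theta) (2 * (2 * pi * ln (Num.max 1 r))).
  move/(circ_intZ 2^-1); rewrite mulrA mulVf ?mul1r//.
  by apply: eq_circ_int => t; rewrite (normc_expi_sub _ Dz).
have r0 : 0 <= r := normc_ge0 z.
case: (ltgtP 1 r) => [r1|r1|<-]; last 2 first.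
- by rewrite ln1 !mulr0; apply: circ_int_log_quad_lt1; rewrite r0.
- by rewrite ln1 !mulr0; exact: circ_int_log_quad_eq1.
have rp : 0 < r := lt_trans ltr01 r1.
have r01 : 0 <= r^-1 < 1 by rewrite invr_ge0 r0 invf_lt1.
have := circ_intD (circ_int_cst (2 * ln r)) (circ_int_log_quad_lt1 theta r01).
rewrite addr0 mulrCA; apply: eq_circ_int => t; rewrite /log_quad.
have q0 : 0 < 1 - 2 * r^-1 * cos (t - theta) + r^-1 ^+ 2.
  apply: lt_le_trans (quad_cos_ge _ _); rewrite ?invr_ge0// exprn_gt0// subr_gt0.
  by case/andP: r01.
have -> : 2 * ln r = ln (r ^+ 2) by rewrite lnXn// mulr_natl.
rewrite -lnM ?posrE ?exprn_gt0//; congr ln.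
by field; rewrite lt0r_neq0.
Qed.

(** The logarithm of the product is the sum of the logarithms except at the
    zeros of the polynomial, where the convention ln 0 = 0 breaks the identity;
    these form a null set. *)
Lemma jensen_formula (I : finType) (c : R[i]) (z : I -> R[i]) : c != 0 ->
  circ_int (fun t => ln (normc (c *: \prod_i ('X - (z i)%:P)).[expi t]))
    (2 * pi * (ln (normc c) + \sum_i ln (Num.max 1 (normc (z i))))).
Proof.
move=> c0.
pose f t := ln (normc c) + \sum_i ln (normc (expi t - z i)).
have [fi Ef] : circ_int f (2 * pi * (ln (normc c) + \sum_i ln (Num.max 1 (normc (z i))))).
  rewrite mulrDr mulr_sumr; apply: circ_intD; first exact: circ_int_cst.
  by apply: circ_int_sum => i; exact: circ_int_ln_sub.
pose g t := ln (normc (c *: \prod_i ('X - (z i)%:P)).[expi t]).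
pose N : set R := \bigcup_i cos_exceptions (complex.Re (z i)).
have mN : measurable (N : set (measurableTypeR R)).
  apply: fin_bigcup_measurable => [|i _]; first exact: finite_finset.
  exact: measurable_cos_exceptions.
have N0 : mu N = 0%E.
  apply: countable_lebesgue_measure0; apply: bigcup_countable => [|i _].
    by apply: finite_set_countable; exact: finite_finset.
  by apply: finite_set_countable; exact: finite_set2.
have normc_sub_cont i : continuous (fun t => normc (expi t - z i)).
  case: (z i) => a b; rewrite (_ : (fun t => normc _) =
    (fun t => Num.sqrt ((cos t - a) * (cos t - a) + (sin t - b) * (sin t - b)))).
    move=> t; apply: (@continuous_comp R R R
      (fun t => (cos t - a) * (cos t - a) + (sin t - b) * (sin t - b)) (@Num.sqrt R)).
      have ca : {for t, continuous (fun t => cos t - a)}.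
        by apply: cvgB; [exact: continuous_cos|exact: cvg_cst].
      have sb : {for t, continuous (fun t => sin t - b)}.
        by apply: cvgB; [exact: continuous_sin|exact: cvg_cst].
      by apply: cvgD; apply: cvgM.
    exact: sqrt_continuous.
  by apply/funext => t; rewrite /expi; simpc; rewrite /= !expr2.
have Eg t : g t = ln (normc c * \prod_i normc (expi t - z i)).
  rewrite /g hornerZ normcM horner_prod; congr (ln (_ * _)).
  rewrite normc_prod; apply: eq_bigr => i _; by rewrite hornerXsubC.
have mg : measurable_fun (circ : set (measurableTypeR R)) (EFin \o g).
  apply/measurable_EFinP; apply: measurable_funS (_ : measurable_fun setT g) => //.
  rewrite (funext Eg); apply: (@measurableT_comp _ _ _ _ _ _ (@ln R)).
    exact: measurable_ln.
  apply: continuous_measurable_fun => t; apply: cvgM; first exact: cvg_cst.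
  by apply: cvg_big; [exact: mul_continuous|move=> i _; exact: normc_sub_cont].
have fg t : (circ `\` N) t -> f t = g t.
  move=> [tc tN]; rewrite Eg /f.
  have z0 i : 0 < normc (expi t - z i).
    rewrite normc_gt0 subr_eq0; apply/eqP => tz; apply: tN; exists i => //.
    by apply: cos_exceptionsP; [move: tc; rewrite /= in_itv|rewrite -tz].
  rewrite lnM ?posrE ?normc_gt0// ?prodr_gt0//; congr (_ + _).
  by rewrite ln_prod.
have gi : mu.-integrable circ (EFin \o g).
  apply/(@negligible_integrable _ _ _ mu circ N) => //.
  have mD : measurable (circ `\` N : set (measurableTypeR R)) by apply: measurableD.
  have : mu.-integrable (circ `\` N) (EFin \o f) by apply: integrableS fi.
  apply: eq_integrable => //.
  by move=> t; rewrite inE => tD /=; rewrite fg.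
split=> //; rewrite -Ef /Rintegral (@negligible_integral _ _ _ mu circ N)//.
rewrite [in RHS](@negligible_integral _ _ _ mu circ N)//; congr fine.
by apply: eq_integral => t; rewrite inE => tD; rewrite fg.
Qed.
End Jensen.

(** * Energy of a configuration of complex numbers *)

Section Energy.
Variable R : realType.
Variable I : finType.

Lemma ln_le_sub1 (x : R) : 0 < x -> ln x <= x - 1.
Proof.
move=> x0; have := @le_ln1Dx R (x - 1).
by have -> : 1 + (x - 1) = x; [ring|apply; lra].
Qed.

Lemma sum_constR (x : R) : \sum_(i : I) x = #|I|%:R * x.
Proof. by rewrite sumr_const mulr_natl. Qed.

(** Subtracting the smallest value r m from all the r i removes r m times the
    square of the sum of the a i, and leaves a kernel of the same form, in
    which the index m no longer contributes. *)
Lemma min_kernel_ge0 (r a : I -> R) (A : pred I) : (forall i, A i -> 0 <= r i) ->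
  0 <= \sum_(i | A i) \sum_(j | A j) Num.min (r i) (r j) * (a i * a j).
Proof.
have [n] := ubnP #|A|; elim: n A r => // n IHn A r cA r0.
have [i0 Ai0|A0] := pickP A; last first.
  by rewrite big_pred0.
have [m Am mmin] := arg_minP r Ai0.
pose B := [pred i | A i && (i != m)].
have -> : \sum_(i | A i) \sum_(j | A j) Num.min (r i) (r j) * (a i * a j) =
    r m * (\sum_(i | A i) a i) ^+ 2 +
    \sum_(i | B i) \sum_(j | B j) Num.min (r i - r m) (r j - r m) * (a i * a j).
  have split1 (F : I -> R) : F m = 0 -> \sum_(i | A i) F i = \sum_(i | B i) F i.
    by move=> Fm; rewrite (bigD1 m)//= Fm add0r.
  rewrite expr2 mulr_suml mulr_sumr -[X in _ + X]split1; last first.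
    apply: big1 => j /andP[Aj _]; rewrite subrr min_l ?mul0r// subr_ge0; exact: mmin.
  rewrite -big_split /=; apply: eq_bigr => i Ai.
  rewrite mulr_sumr mulr_sumr -[X in _ + X]split1; last first.
    by rewrite subrr min_r ?mul0r// subr_ge0; exact: mmin.
  rewrite -big_split /=; apply: eq_bigr => j Aj.
  by rewrite -addr_minl; ring.
apply: addr_ge0; first by rewrite mulr_ge0 ?sqr_ge0 ?r0.
apply: IHn => [|i /andP[Ai _]]; last by rewrite subr_ge0; exact: mmin.
rewrite ltnS in cA; apply: leq_trans cA; apply: proper_card; apply/properP; split.
  by apply/fintype.subsetP => i /andP[].
by exists m; rewrite ?unfold_in//= eqxx andbF.
Qed.

Variables (rho theta : I -> R).
Hypothesis rho0 : forall i, 0 < rho i.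

Definition ratio i j : R := Num.min (rho i) (rho j) / Num.max (rho i) (rho j).

Lemma ratio_gt0 i j : 0 < ratio i j.
Proof. by rewrite divr_gt0 ?lt_min ?lt_max ?rho0. Qed.

Lemma ratio_le1 i j : ratio i j <= 1.
Proof. by rewrite ler_pdivrMr ?lt_max ?rho0// mul1r le_max !ge_min lexx. Qed.

(** As min(a, b) / max(a, b) = min(a^2, b^2) / (a b), powers of the ratio are
    kernels min after a rescaling of the coefficients. *)
Lemma ratio_kernel_ge0 (k : nat) (a : I -> R) :
  0 <= \sum_i \sum_j ratio i j ^+ k * (a i * a j).
Proof.
have -> : \sum_i \sum_j ratio i j ^+ k * (a i * a j) =
   \sum_i \sum_j Num.min (rho i ^+ (2 * k)) (rho j ^+ (2 * k)) *
      ((a i / rho i ^+ k) * (a j / rho j ^+ k)).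
  apply: eq_bigr => i _; apply: eq_bigr => j _.
  have ri : rho i != 0 := lt0r_neq0 (rho0 i).
  have rj : rho j != 0 := lt0r_neq0 (rho0 j).
  rewrite /ratio expr_div_n ![(2 * k)%N]mulnC !exprM.
  have [rij|rji] := lerP (rho i) (rho j).
    rewrite min_l; last by rewrite !lerXn2r ?nnegrE ?exprn_ge0 ?(ltW (rho0 _)).
    by field; rewrite !expf_neq0.
  rewrite min_r; last by rewrite !lerXn2r ?nnegrE ?exprn_ge0 ?(ltW (rho0 _))?(ltW rji).
  by field; rewrite !expf_neq0.
by apply: min_kernel_ge0 => i _; rewrite exprn_ge0 ?ltW.
Qed.

Lemma ratio_cos_ge0 (k : nat) :
  0 <= \sum_i \sum_j ratio i j ^+ k * cos (k%:R * (theta i - theta j)).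
Proof.
have -> : \sum_i \sum_j ratio i j ^+ k * cos (k%:R * (theta i - theta j)) =
  \sum_i \sum_j ratio i j ^+ k * (cos (k%:R * theta i) * cos (k%:R * theta j)) +
  \sum_i \sum_j ratio i j ^+ k * (sin (k%:R * theta i) * sin (k%:R * theta j)).
  rewrite -big_split; apply: eq_bigr => i _; rewrite -big_split.
  by apply: eq_bigr => j _ /=; rewrite mulrBr cosB mulrDr.
by rewrite addr_ge0// ratio_kernel_ge0.
Qed.

(** This is - ln |1 - t r exp(i (theta i - theta j))| with r = ratio i j.  The
    damping t < 1 keeps it finite on the diagonal. *)
Definition energy_kernel (t : R) i j : R :=
  - (2^-1 * ln (1 - 2 * (t * ratio i j) * cos (theta i - theta j) + (t * ratio i j) ^+ 2)).

(** The energy is the sum over k >= 1 of t^k / k times the nonnegative sums of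
    [ratio_cos_ge0], up to a remainder that tends to zero; the left-hand
    side is the term k = 1. *)
Lemma ratio_cos_le_energy (t : R) : 0 <= t < 1 ->
  t * \sum_i \sum_j ratio i j * cos (theta i - theta j) <=
  \sum_i \sum_j energy_kernel t i j.
Proof.
move=> /andP[t0 t1].
have tq i j : 0 <= t * ratio i j < 1.
  rewrite mulr_ge0 ?(ltW (ratio_gt0 _ _))//= (le_lt_trans _ t1)//.
  by rewrite ler_piMr// ratio_le1.
have step K : t * \sum_i \sum_j ratio i j * cos (theta i - theta j) -
    \sum_i \sum_j energy_kernel t i j <=
    \sum_(i : I) \sum_(j : I) 2 * t ^+ K.+1 / (1 - t) ^+ 2.
  have -> : \sum_i \sum_j energy_kernel t i j =
     \sum_i \sum_j log_remainder (theta i - theta j) K.+1 (t * ratio i j) +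
     (t * \sum_i \sum_j ratio i j * cos (theta i - theta j) +
     \sum_(k < K) k.+2%:R^-1 * t ^+ k.+2 *
       \sum_i \sum_j ratio i j ^+ k.+2 * cos (k.+2%:R * (theta i - theta j))).
    have -> : \sum_(k < K) k.+2%:R^-1 * t ^+ k.+2 *
       \sum_i \sum_j ratio i j ^+ k.+2 * cos (k.+2%:R * (theta i - theta j)) =
       \sum_i \sum_j \sum_(k < K)
         k.+2%:R^-1 * cos (k.+2%:R * (theta i - theta j)) * (t * ratio i j) ^+ k.+2.
      under [RHS]eq_bigr do rewrite exchange_big /=.
      rewrite [RHS]exchange_big /=; apply: eq_bigr => k _.
      rewrite mulr_sumr; apply: eq_bigr => i _; rewrite mulr_sumr.
      apply: eq_bigr => j _; rewrite (exprMn _ t (ratio i j)).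
      by move: (cos _) (k.+2%:R^-1) (t ^+ _) (ratio _ _ ^+ _) => a b c d; ring.
    rewrite mulr_sumr -!big_split; apply: eq_bigr => i _ /=.
    rewrite mulr_sumr -!big_split; apply: eq_bigr => j _ /=.
    rewrite /log_remainder /energy_kernel big_ord_recl /= !mul1r invr1 expr1.
    under [X in _ = _ - (_ + X) + _]eq_bigr do rewrite /bump /= add1n.
    by move: (\sum_(_ < _) _) => S; ring.
  set S := t * _; set P := \sum_(k < K) _; set Q := \sum_i \sum_j log_remainder _ _ _.
  have P0 : 0 <= P.
    apply: sumr_ge0 => k _; rewrite mulr_ge0 ?ratio_cos_ge0// mulr_ge0 ?exprn_ge0//.
  suff : - Q <= \sum_(i : I) \sum_(j : I) 2 * t ^+ K.+1 / (1 - t) ^+ 2 by lra.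
  rewrite -sumrN; apply: ler_sum => i _; rewrite -sumrN; apply: ler_sum => j _.
  have [q0 q1] := andP (tq i j).
  apply: le_trans (ler_norm _) _; rewrite normrN.
  apply: le_trans (log_remainder_le _ _ (tq i j)) _.
  have qt : t * ratio i j <= t by rewrite ler_piMr// ratio_le1.
  have t2 : 0 < (1 - t) ^+ 2 by rewrite exprn_gt0// subr_gt0.
  rewrite -!mulrA ler_pM2l// ler_pM ?exprn_ge0 ?invr_ge0 ?sqr_ge0//.
    by rewrite lerXn2r ?nnegrE.
  have le2 : (1 - t) ^+ 2 <= (1 - t * ratio i j) ^+ 2.
    by rewrite lerXn2r ?nnegrE; lra.
  by rewrite lef_pV2 ?posrE// (lt_le_trans t2).
rewrite -subr_le0; set X := (X in X <= 0).
have : (fun K => \sum_(i : I) \sum_(j : I) 2 * t ^+ K.+1 / (1 - t) ^+ 2) @ \oo --> (0 : R).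
  have -> : (fun K => \sum_(i : I) \sum_(j : I) 2 * t ^+ K.+1 / (1 - t) ^+ 2) =
    (fun K => #|I|%:R * #|I|%:R * 2 * t / (1 - t) ^+ 2 * t ^+ K).
    by apply/funext => K; rewrite !sum_constR exprS; ring.
  rewrite -[X in _ --> X](mulr0 (#|I|%:R * #|I|%:R * 2 * t / (1 - t) ^+ 2)).
  apply: cvgM; first exact: cvg_cst.
  by apply: cvg_expr; rewrite ger0_norm.
move=> H; rewrite -(cvg_lim (@Rhausdorff R) H).
by apply: limr_ge; [exact: cvgP H|apply: nearW].
Qed.

Let quad (r c : R) := 1 - 2 * r * c + r ^+ 2.

(** Taking logarithms, the damping t lowers ln |1 - r exp(i phi)|^2 by at most
    - ln t. *)
Lemma quad_contract (t r c : R) : 0 <= t <= 1 -> 0 <= r <= 1 -> c <= 1 ->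
  t * quad r c <= quad (t * r) c.
Proof.
move=> /andP[t0 t1] /andP[r0 r1] c1; rewrite -subr_ge0 /quad.
have -> : 1 - 2 * (t * r) * c + (t * r) ^+ 2 - t * (1 - 2 * r * c + r ^+ 2) =
   (1 - t) * (1 - t * r ^+ 2) by ring.
have r2 : r ^+ 2 <= 1 by rewrite expr_le1.
have : t * r ^+ 2 <= 1 by rewrite mulr_ile1 ?sqr_ge0.
by move=> ?; rewrite mulr_ge0 ?subr_ge0.
Qed.

End Energy.

Section EnergyBound.
Variable R : realType.
Variable I : finType.
Import Normc.
Variables (z : I -> R[i]) (theta : I -> R) (d : nat).
Hypothesis d0 : (0 < d)%N.
Hypothesis z0 : forall i, z i != 0.
Hypothesis zE : forall i,
  z i = (normc (z i) * cos (theta i) +i* (normc (z i) * sin (theta i)))%C.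
Hypothesis card_fibre : forall i, (#|[pred j | z i == z j]| * d)%N = #|I|.

Let rho i := normc (z i).
Let rho0 i : 0 < rho i. Proof. by rewrite /rho normc_gt0. Qed.
(** With this damping a diagonal term of the energy is - ln (1 - t) = ln (d + 1),
    and the loss - (ln t) / 2 off the diagonal is at most 1 / (2 d). *)
Let t : R := d%:R / (d%:R + 1).

Let dp : 0 < d%:R :> R. Proof. by rewrite ltr0n. Qed.

Let t_bounds : 2^-1 <= t < 1.
Proof.
have d1 : 1 <= d%:R :> R by rewrite ler1n.
rewrite /t ltr_pdivrMr ?ler_pdivlMr ?addr_gt0//.
by apply/andP; split; lra.
Qed.

Let t01 : 0 <= t < 1.
Proof. by case/andP: t_bounds => a b; rewrite b andbT (le_trans _ a)// invr_ge0. Qed.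

Lemma normc_sub_sqr i j :
  normc (z i - z j) ^+ 2 = Num.max (rho i) (rho j) ^+ 2 *
    (1 - 2 * ratio rho i j * cos (theta i - theta j) + ratio rho i j ^+ 2).
Proof.
have ri : rho i != 0 := lt0r_neq0 (rho0 i).
have rj : rho j != 0 := lt0r_neq0 (rho0 j).
have -> : normc (z i - z j) ^+ 2 =
    rho i ^+ 2 + rho j ^+ 2 - 2 * rho i * rho j * cos (theta i - theta j).
  rewrite (zE i) (zE j) -/(rho i) -/(rho j); simpc; rewrite /= sqr_sqrtr ?addr_ge0 ?sqr_ge0//.
  rewrite cosB; have := cos2Dsin2 (theta i); have := cos2Dsin2 (theta j).
  move: (cos (theta i)) (sin (theta i)) (cos (theta j)) (sin (theta j)) => a b c e H1 H2.
  have -> : (rho i * a - rho j * c) ^+ 2 + (rho i * b - rho j * e) ^+ 2 =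
    rho i ^+ 2 * (a ^+ 2 + b ^+ 2) + rho j ^+ 2 * (c ^+ 2 + e ^+ 2)
      - 2 * rho i * rho j * (a * c + b * e) by ring.
  by rewrite H1 H2 !mulr1.
by rewrite /ratio; case: (lerP (rho i) (rho j)) => _; field.
Qed.

Lemma ln_max_le i j :
  ln (Num.max (rho i) (rho j)) <= `|ln (rho i)| + `|ln (rho j)|.
Proof.
have := ler_norm (ln (rho i)); have := ler_norm (ln (rho j)).
have := normr_ge0 (ln (rho i)); have := normr_ge0 (ln (rho j)).
by case: (lerP (rho i) (rho j)) => _; lra.
Qed.

Lemma one_sub_ratio_le i j : 1 - ratio rho i j <= `|ln (rho i)| + `|ln (rho j)|.
Proof.
have q0 := ratio_gt0 rho0 i j.
have := ln_le_sub1 q0.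
rewrite ln_div ?posrE ?lt_min ?lt_max ?rho0//.
have := ler_norm (ln (rho i)); have := ler_norm (ln (rho j)).
have := ler_norm (- ln (rho i)); have := ler_norm (- ln (rho j)).
by rewrite !normrN; case: (lerP (rho i) (rho j)) => _; lra.
Qed.

Lemma energy_kernel_diag i j : z i = z j ->
  energy_kernel rho theta t i j = ln (d%:R + 1).
Proof.
move=> zij; have rij : rho i = rho j by rewrite /rho zij.
have ri : rho i != 0 := lt0r_neq0 (rho0 i).
have c1 : cos (theta i - theta j) = 1.
  have : (rho i * cos (theta i) +i* (rho i * sin (theta i)))%C =
         (rho i * cos (theta j) +i* (rho i * sin (theta j)))%C.
    by rewrite [X in _ = (X * _ +i* (X * _))%C]rij -[LHS]zE zij -[RHS]zE.
  move=> -[] /(mulfI ri) Ec /(mulfI ri) Es.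
  by rewrite cosB -Ec -Es -!expr2 cos2Dsin2.
rewrite /energy_kernel c1 /ratio rij maxxx minxx divff -?rij// !mulr1.
have -> : 1 - 2 * t + t ^+ 2 = (d%:R + 1)^-1 ^+ 2.
  by rewrite /t; field; rewrite lt0r_neq0// addr_gt0.
by rewrite lnXn ?invr_gt0 ?addr_gt0// lnV ?posrE ?addr_gt0//; field.
Qed.

(** The kernel is - ln (|z i - z j| / max(rho i, rho j)) up to the damping
    loss. *)
Lemma energy_kernel_offdiag i j : z i != z j ->
  energy_kernel rho theta t i j <= (2 * d%:R)^-1 - ln (normc (z i - z j)) +
    (`|ln (rho i)| + `|ln (rho j)|).
Proof.
move=> zij; have /andP[t2 t1] := t_bounds; have tp : 0 < t by lra.
have q0 := ratio_gt0 rho0 i j; have q1 := ratio_le1 rho0 i j.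
have := normc_sub_sqr i j.
set q := 1 - 2 * ratio rho i j * cos (theta i - theta j) + ratio rho i j ^+ 2.
move=> Eq; have mp : 0 < Num.max (rho i) (rho j) by rewrite lt_max rho0.
have nz : 0 < normc (z i - z j) by rewrite normc_gt0 subr_eq0.
have qp : 0 < q by rewrite -(pmulr_rgt0 _ (exprn_gt0 2 mp)) -Eq exprn_gt0.
have Eln : ln q = 2 * (ln (normc (z i - z j)) - ln (Num.max (rho i) (rho j))).
  apply/eqP; rewrite mulrBr eq_sym subr_eq; apply/eqP.
  have ln2 (x : R) : 0 < x -> ln (x ^+ 2) = 2 * ln x by move=> x0; rewrite lnXn// mulr_natl.
  have : ln (Num.max (rho i) (rho j) ^+ 2 * q) =
      ln (Num.max (rho i) (rho j) ^+ 2) + ln q by rewrite lnM ?posrE ?exprn_gt0.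
  by rewrite -Eq !ln2// => ->; rewrite addrC.
have lt : - ln t <= d%:R^-1.
  rewrite -lnV ?posrE// /t invf_div mulrDl divff ?lt0r_neq0// mul1r.
  by apply: le_ln1Dx; rewrite (lt_trans (ltrN10 _))// invr_gt0.
have : ln t + ln q <= ln (1 - 2 * (t * ratio rho i j) * cos (theta i - theta j) +
                          (t * ratio rho i j) ^+ 2).
  have le : t * q <= 1 - 2 * (t * ratio rho i j) * cos (theta i - theta j) +
                          (t * ratio rho i j) ^+ 2.
    apply: quad_contract; last exact: cos_le1.
      by rewrite (ltW tp) (ltW t1).
    by rewrite (ltW q0) q1.
  by rewrite -lnM ?posrE// ler_ln ?posrE ?(lt_le_trans _ le)// mulr_gt0.
have := ln_max_le i j; rewrite /energy_kernel Eln invfM.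
by lra.
Qed.

Let s : R := #|I|%:R.
Let E : R := - \sum_i \sum_(j | z i != z j) ln (normc (z i - z j)).
Let U : R := \sum_i `|ln (rho i)|.

Let card_fibreR i : #|[pred j | z i == z j]|%:R = s / d%:R :> R.
Proof. by rewrite /s -(card_fibre i) natrM mulfK// lt0r_neq0. Qed.

(** A value is repeated s / d times, so the diagonal pairs contribute
    s^2 ln(d + 1) / d; the damping loss of the other pairs is at most
    s^2 / (2 d), which is absorbed as 1 / 2 <= ln(d + 1). *)
Lemma energy_sum_le : \sum_i \sum_j energy_kernel rho theta t i j <=
  s ^+ 2 * (2 * (ln (d%:R + 1) / d%:R)) + E + 2 * s * U.
Proof.
have sumU : \sum_(i : I) \sum_(j : I) (`|ln (rho i)| + `|ln (rho j)|) = 2 * s * U.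
  under eq_bigr do rewrite big_split /= sum_constR.
  by rewrite big_split /= sum_constR -mulr_sumr -/U -/s; ring.
have ln0 : 0 <= ln (d%:R + 1 : R) by rewrite ln_ge0// lerDr ltW.
have lnd : 2^-1 <= ln (d%:R + 1 : R).
  have : ln (2^-1 : R) <= 2^-1 - 1 by apply: ln_le_sub1; rewrite invr_gt0.
  rewrite lnV ?posrE// => l2; have : ln 2 <= ln (d%:R + 1 : R).
    have d1 : 1 <= d%:R :> R by rewrite ler1n.
    by rewrite ler_ln ?posrE ?addr_gt0//; lra.
  by lra.
have row i : \sum_j energy_kernel rho theta t i j <=
    s * (2 * (ln (d%:R + 1) / d%:R)) -
    \sum_(j | z i != z j) ln (normc (z i - z j)) + \sum_j (`|ln (rho i)| + `|ln (rho j)|).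
  rewrite (bigID [pred j | z i == z j]) /=.
  have -> : \sum_(j | z i == z j) energy_kernel rho theta t i j = s / d%:R * ln (d%:R + 1).
    rewrite -(card_fibreR i) mulr_natl -sumr_const; apply: eq_bigr => j /eqP.
    exact: energy_kernel_diag.
  apply: (@le_trans _ _ (s / d%:R * ln (d%:R + 1) + \sum_(j | z i != z j)
    ((2 * d%:R)^-1 - ln (normc (z i - z j)) + (`|ln (rho i)| + `|ln (rho j)|)))).
    by rewrite lerD2l; apply: ler_sum => j; exact: energy_kernel_offdiag.
  rewrite big_split /= sumrB sumr_const.
  have c1 : (2 * d%:R)^-1 *+ #|(fun j => z i != z j)| <= s * (ln (d%:R + 1) / d%:R).
    rewrite -(mulr_natl (2 * d%:R)^-1); apply: ler_pM => //.
    - by rewrite /s ler_nat max_card.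
    - by rewrite invfM ler_pM2r// invr_gt0.
  have c2 : \sum_(j | z i != z j) (`|ln (rho i)| + `|ln (rho j)|) <=
            \sum_j (`|ln (rho i)| + `|ln (rho j)|).
    by rewrite [leRHS](bigID (fun j => z i != z j)) /= lerDl sumr_ge0// => j _; rewrite addr_ge0.
  have fin (L V W X Y : R) : X <= L -> W <= V -> L + (X - Y + W) <= 2 * L - Y + V by lra.
  have -> : s / d%:R * ln (d%:R + 1) = s * (ln (d%:R + 1) / d%:R) by ring.
  by rewrite [s * (2 * _)]mulrCA; apply: fin.
apply: (le_trans (ler_sum _ (fun i _ => row i))).
rewrite big_split /= sumrB sumU sum_constR -/s /E.
by rewrite le_eqVlt; apply/orP; left; apply/eqP; ring.
Qed.

(** The left-hand side is the double sum of the cosines; inserting the weights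
    ratio i j costs at most 1 - ratio i j per pair, and then t >= 1 / 2. *)
Lemma angular_sum_le :
  (\sum_i cos (theta i)) ^+ 2 + (\sum_i sin (theta i)) ^+ 2 <=
  s ^+ 2 * (4 * (ln (d%:R + 1) / d%:R)) + 2 * E + 6 * s * U.
Proof.
have -> : (\sum_i cos (theta i)) ^+ 2 + (\sum_i sin (theta i)) ^+ 2 =
    \sum_i \sum_j cos (theta i - theta j).
  rewrite !expr2 !mulr_suml -big_split; apply: eq_bigr => i _ /=.
  rewrite !mulr_sumr -big_split; apply: eq_bigr => j _ /=.
  by rewrite cosB.
pose Q := \sum_i \sum_j ratio rho i j * cos (theta i - theta j).
have Q0 : 0 <= Q.
  have := ratio_cos_ge0 theta rho0 1; congr (0 <= _).
  by apply: eq_bigr => i _; apply: eq_bigr => j _; rewrite expr1 mul1r.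
have tQ : t * Q <= s ^+ 2 * (2 * (ln (d%:R + 1) / d%:R)) + E + 2 * s * U.
  by apply: le_trans energy_sum_le; apply: ratio_cos_le_energy.
have Q2 : Q <= 2 * (t * Q) by have /andP[] := t_bounds; nra.
have sumU : \sum_(i : I) \sum_(j : I) (`|ln (rho i)| + `|ln (rho j)|) = 2 * s * U.
  under eq_bigr do rewrite big_split /= sum_constR.
  by rewrite big_split /= sum_constR -mulr_sumr -/U -/s; ring.
have : \sum_i \sum_j cos (theta i - theta j) <= Q + 2 * s * U.
  rewrite -sumU /Q -big_split; apply: ler_sum => i _; rewrite -big_split.
  apply: ler_sum => j _ /=; have := one_sub_ratio_le i j.
  have := cos_le1 (theta i - theta j); have := ratio_le1 rho0 i j.
  by move: (ratio _ _ _) (cos _) => r c r1 c1 H; nra.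
by lra.
Qed.
End EnergyBound.

(** * Heights and angular sums over a Galois orbit *)

Section OrbitHeight.
Variable R : realType.
Import Normc.
Variable iota : {rmorphism algC -> R[i]}.
Variables (I : finType) (N : nat) (xi : 'I_N -> algC) (x : I -> 'I_N -> algC).
Hypothesis orbx : enum_orbit xi x.
Hypothesis xi0 : forall l, xi l != 0.
Let s : R := #|I|%:R.

Lemma normc_intr (k : int) : normc (k%:~R : R[i]) = `|k%:~R|.
Proof.
rewrite -(rmorph_int (real_complex R)) /=.
by rewrite expr0n addr0 sqrtr_sqr.
Qed.

Lemma normc_iota_int_ge1 (y : algC) : y \in Num.int -> y != 0 -> 1 <= normc (iota y).
Proof.
move=> /intrP[k ->]; rewrite intr_eq0 rmorph_int normc_intr => k0.
by rewrite -intr_norm -[1]/(1%:~R) ler_int -gtz0_ge1 normr_gt0.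
Qed.

Lemma orbit_card_gt0 : (0 < #|I|)%N.
Proof. by have [i _] := orbit_base orbx; apply/card_gt0P; exists i. Qed.

(** Jensen's formula for a power of the integral minimal polynomial, the one
    that has each x i l as a root as many times as it occurs in the orbit. *)
Lemma orbit_height l : exists c : int,
  [/\ c != 0,
      c%:~R *: \prod_i ('X - (x i l)%:P) \is a polyOver Num.int &
      ln (normc (c%:~R : R[i])) + \sum_i ln (Num.max 1 (normc (iota (x i l)))) =
        s * weil_height R (xi l)].
Proof.
have [m] := orbit_coord_int l orbx.
set c := lead_coef _ ^+ m; set f := minZpoly (xi l) => -[Dm c0 Dc].
exists c; split => //.
  by rewrite Dc -rmorphXn; apply/polyOverP => i; rewrite coef_map /= rpred_int.
have sE : s = m%:R * (algdeg (xi l))%:R by rewrite /s -Dm natrM.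
have m0 : (0 < m)%N by move: orbit_card_gt0; rewrite -Dm muln_gt0 => /andP[].
have deg0 : (0 < algdeg (xi l))%N.
  by move: orbit_card_gt0; rewrite -Dm muln_gt0 => /andP[].
have c0' : (c%:~R : R[i]) != 0 by rewrite intr_eq0.
have := jensen_formula (fun i => iota (x i l)) c0'.
set H := ln _ + _ => J.
have Dp : c%:~R *: \prod_i ('X - (iota (x i l))%:P) = map_poly intr f ^+ m :> {poly R[i]}.
  transitivity (map_poly iota (c%:~R *: \prod_i ('X - (x i l)%:P))).
    rewrite map_polyZ rmorph_int rmorph_prod; congr (_ *: _).
    by apply: eq_bigr => i _; rewrite /= map_polyXsubC.
  rewrite Dc rmorphXn /=; congr (_ ^+ m); apply/polyP => k.
  by rewrite !coef_map /= rmorph_int.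
have mR0 : m%:R != 0 :> R by rewrite pnatr_eq0 -lt0n.
have [_ Ih] : circ_int (fun t => ln (normc (map_poly intr f : {poly R[i]}).[expi t]))
    (m%:R^-1 * (2 * pi * H)).
  apply: eq_circ_int (circ_intZ m%:R^-1 J) => t; rewrite Dp horner_exp.
  set y := (_).[_]; have [->|y0] := eqVneq y 0.
    by rewrite expr0n gtn_eqF// normc0 ln0// mulr0.
  by rewrite normcX lnXn ?normc_gt0// -(mulr_natl (ln _)) mulKf.
rewrite /weil_height -/f Ih sE.
have d0 : (algdeg (xi l))%:R != 0 :> R by rewrite pnatr_eq0 -lt0n.
have p0 : (2 * pi : R) != 0 by rewrite lt0r_neq0// twopi_gt0.
by move: p0; move: (2 * pi) => p p0; field; rewrite mR0 p0.
Qed.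

(** |ln a| = 2 ln max(1, a) - ln a, and the sum of the ln |x i l| is at least
    - ln |c| because c times the product of the x i l is a nonzero integer. *)
Lemma orbit_abs_ln l :
  \sum_i `|ln (normc (iota (x i l)))| <= 2 * (s * weil_height R (xi l)).
Proof.
have [c [c0 cP <-]] := orbit_height l.
have px : forall i, 0 < normc (iota (x i l)).
  by move=> i; rewrite normc_gt0 fmorph_eq0 (orbit_neq0 orbx xi0).
have lc : 0 <= ln (normc (c%:~R : R[i])).
  apply: ln_ge0; rewrite -(rmorph_int iota); apply: normc_iota_int_ge1.
    exact: rpred_int.
  by rewrite intr_eq0.
have D1 : 0 <= ln (normc (c%:~R : R[i])) + \sum_i ln (normc (iota (x i l))).
  rewrite -ln_prod// -lnM ?posrE ?normc_gt0 ?intr_eq0 ?prodr_gt0// -normc_prod.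
  rewrite -rmorph_prod -normcM -(rmorph_int iota) -rmorphM; apply: ln_ge0.
  apply: normc_iota_int_ge1; last first.
    rewrite mulf_neq0 ?intr_eq0//; apply/prodf_neq0 => i _; exact: orbit_neq0 orbx xi0 _ _.
  have /polyOverP/(_ 0%N) := cP.
  rewrite -horner_coef0 hornerZ horner_prod.
  under eq_bigr do rewrite hornerXsubC sub0r.
  by rewrite prodrN mulrCA rpredMsign.
have -> : \sum_i `|ln (normc (iota (x i l)))| =
   2 * \sum_i ln (Num.max 1 (normc (iota (x i l)))) - \sum_i ln (normc (iota (x i l))).
  rewrite mulr_sumr -sumrB; apply: eq_bigr => i _.
  case: (lerP 1 (normc (iota (x i l)))) => h.
    by rewrite ger0_norm ?ln_ge0//; ring.
  by rewrite ln1 ler0_norm ?ln_le0 ?ltW//; ring.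
by lra.
Qed.

Variable n : 'I_N -> int.

(** The energy bound for the conjugates of chi.  Their discriminant, multiplied
    by 2 s factors of denominator A, is a nonzero integer, which bounds
    - sum ln |b i - b j| by 2 s ln |A|, and ln |A| by s times the weighted
    heights. *)
Lemma orbit_angular_sum (theta : I -> R) :
  (forall i, iota (chi n (x i)) =
    (normc (iota (chi n (x i))) * cos (theta i) +i*
     (normc (iota (chi n (x i))) * sin (theta i)))%C) ->
  (\sum_i cos (theta i)) ^+ 2 + (\sum_i sin (theta i)) ^+ 2 <=
  s ^+ 2 * (4 * (ln ((algdeg (chi n xi))%:R + 1) / (algdeg (chi n xi))%:R) +
    16 * \sum_l `|n l|%:R * weil_height R (xi l)).
Proof.
move=> Hth; set d : R := (algdeg (chi n xi))%:R.
have [c Hc] := choice orbit_height.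
have c0 l : c l != 0 by have [] := Hc l.
have cP l : (c l)%:~R *: \prod_i ('X - (x i l)%:P) \is a polyOver Num.int.
  by have [] := Hc l.
have h0 l : 0 <= s * weil_height R (xi l).
  have := orbit_abs_ln l; have : 0 <= \sum_i `|ln (normc (iota (x i l)))|.
    by apply: sumr_ge0.
  by lra.
pose b i := iota (chi n (x i)).
have chi0 i : chi n (x i) != 0.
  by apply/prodf_neq0 => l _; rewrite expfz_neq0// (orbit_neq0 orbx xi0).
have b0 i : b i != 0 by rewrite /b fmorph_eq0.
have [i0 Di0] := orbit_base orbx.
have Dchi : chi n (x i0) = chi n xi by apply: eq_bigr => l _; rewrite Di0.
have [m [_ Dm Df]] := orbit_charpoly orbx i0 (equivariant_chi (x := x) n).
have d0 : (0 < algdeg (chi n xi))%N.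
  by move: orbit_card_gt0; rewrite -Dm muln_gt0 Dchi => /andP[].
have fib i : (#|[pred j | b i == b j]| * algdeg (chi n xi))%N = #|I|.
  rewrite -Dm Dchi -(Df i); congr (_ * _)%N; apply: eq_card => j.
  by rewrite !inE /b fmorph_eq eq_sym.
have := angular_sum_le d0 b0 Hth fib.
rewrite -/s -/d.
set E := - _; set U := \sum_i `|_|.
pose Hn := \sum_l `|n l|%:R * weil_height R (xi l); rewrite -/Hn.
have denom l : 0 <= ln (normc (iota (orbit_denom x c n l))) <= s * weil_height R (xi l).
  apply/andP; split.
    apply: ln_ge0; apply: normc_iota_int_ge1.
      exact: orbit_denom_int cP _.
    exact: (orbit_denom_neq0 orbx n xi0 c0).
  have [_ _ <-] := Hc l; rewrite /orbit_denom; case: ifP => _.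
    by rewrite rmorph_int lerDl sumr_ge0// => i _; rewrite ln_ge0// le_max lexx.
  rewrite rmorphM rmorph_int rmorph_prod normcM normc_prod.
  have px i : 0 < normc (iota (x i l)).
    by rewrite normc_gt0 fmorph_eq0 (orbit_neq0 orbx xi0).
  rewrite lnM ?posrE ?normc_gt0 ?intr_eq0 ?prodr_gt0// ln_prod// lerD2l.
  by apply: ler_sum => i _; rewrite ler_ln ?posrE ?lt_max ?ltr01// le_max lexx orbT.
have UH : U <= 2 * s * Hn.
  rewrite /Hn mulr_sumr.
  apply: (@le_trans _ _ (\sum_l `|n l|%:R * \sum_i `|ln (normc (iota (x i l)))|)); last first.
    apply: ler_sum => l _; apply: le_trans (ler_wpM2l _ (orbit_abs_ln l)) _ => //.
    by rewrite le_eqVlt; apply/orP; left; apply/eqP; ring.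
  under [leRHS]eq_bigr do rewrite mulr_sumr.
  rewrite exchange_big /=; apply: ler_sum => i _.
  rewrite /b /chi rmorph_prod normc_prod ln_prod; last first.
    move=> l _; rewrite normc_gt0 fmorph_eq0 expfz_neq0//; exact: orbit_neq0 orbx xi0 _ _.
  apply: le_trans (ler_norm_sum _ _ _) _; apply: ler_sum => l _.
  have px : 0 < normc (iota (x i l)).
    by rewrite normc_gt0 fmorph_eq0 (orbit_neq0 orbx xi0).
  rewrite fmorphXz; case: (n l) => k.
    by rewrite -exprnP normcX lnXn// -(mulr_natl (ln _)) normrM ger0_norm.
  rewrite NegzE -invr_expz -exprnP normcV normcX lnV ?posrE ?exprn_gt0// normrN.
  by rewrite lnXn// -(mulr_natl (ln _)) normrM ger0_norm// abszN.
have EH : E <= 2 * s * (s * Hn).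
  have bsub i j : b i != b j -> 0 < normc (b i - b j).
    by move=> bij; rewrite normc_gt0 subr_eq0.
  have beq i j : (chi n (x i) != chi n (x j)) = (b i != b j) by rewrite /b fmorph_eq.
  pose A := \prod_l orbit_denom x c n l ^+ `|n l|.
  have A0 : A != 0.
    by apply/prodf_neq0 => l _; rewrite expf_neq0// (orbit_denom_neq0 orbx n xi0 c0).
  pose P := \prod_i \prod_(j | chi n (x i) != chi n (x j)) (chi n (x i) - chi n (x j)).
  have P0 : P != 0.
    by apply/prodf_neq0 => i _; apply/prodf_neq0 => j; rewrite subr_eq0.
  have D1 : 0 <= ln (normc (iota (A ^+ (2 * #|I|) * P))).
    apply: ln_ge0; apply: normc_iota_int_ge1; first exact: (orbit_discriminant_int orbx n xi0 cP).
    by rewrite mulf_neq0// expf_neq0.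
  have lnA : ln (normc (iota A)) <= s * Hn.
    rewrite /A rmorph_prod normc_prod ln_prod; last first.
      by move=> l _; rewrite normc_gt0 fmorph_eq0 expf_neq0// (orbit_denom_neq0 orbx n xi0 c0).
    rewrite /Hn mulr_sumr; apply: ler_sum => l _.
    rewrite rmorphXn normcX lnXn; last first.
      by rewrite normc_gt0 fmorph_eq0 (orbit_denom_neq0 orbx n xi0 c0).
    rewrite -(mulr_natl (ln _)) mulrCA ler_wpM2l//.
    by have /andP[] := denom l.
  have lnP : ln (normc (iota P)) = - E.
    rewrite /E opprK /P rmorph_prod normc_prod ln_prod; last first.
      move=> i _; rewrite normc_gt0 fmorph_eq0.
      by apply/prodf_neq0 => j; rewrite subr_eq0.
    apply: eq_bigr => i _; rewrite rmorph_prod normc_prod ln_prod; last first.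
      by move=> j; rewrite normc_gt0 fmorph_eq0 subr_eq0.
    by apply: eq_big => j; [exact: beq|rewrite rmorphB].
  move: D1; rewrite rmorphM rmorphXn normcM normcX lnM ?posrE ?exprn_gt0 ?normc_gt0 ?fmorph_eq0//.
  rewrite lnP lnXn ?normc_gt0 ?fmorph_eq0// -(mulr_natl (ln _)) natrM -/s.
  have s0 : 0 <= 2 * s by rewrite mulr_ge0// /s ler0n.
  by have := ler_wpM2l s0 lnA; lra.
have s0 : 0 <= s by rewrite /s ler0n.
by have := ler_wpM2l s0 UH; lra.
Qed.
End OrbitHeight.

(** * Characters of the circle *)

Section UnitExponential.
Variable R : realType.
Import Normc.
Implicit Types (x y : R).

Definition ee x : R[i] := expi (2 * pi * x).

Lemma eeD x y : ee (x + y) = ee x * ee y.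
Proof.
rewrite /ee /expi mulrDr cosD sinD; simpc.
by rewrite [sin _ * cos _ + _]addrC.
Qed.

Lemma ee0 : ee 0 = 1.
Proof. by rewrite /ee /expi mulr0 cos0 sin0. Qed.

Lemma normc_ee x : normc (ee x) = 1.
Proof. by rewrite /= cos2Dsin2 sqrtr1. Qed.

Lemma ee_neq0 x : ee x != 0.
Proof. exact: expi_neq0. Qed.

Lemma eeN x : ee (- x) = (ee x)^-1.
Proof. by apply: (mulfI (ee_neq0 x)); rewrite -eeD subrr ee0 divff ?ee_neq0. Qed.

Lemma ee_nat (k : nat) : ee k%:R = 1.
Proof.
elim: k => [|k IHk]; first exact: ee0.
by rewrite -natr1 eeD IHk mul1r /ee /expi mulr1 mulr_natl cos2pi sin2pi.
Qed.

Lemma ee_int (k : int) : ee k%:~R = 1.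
Proof. by case: k => k; rewrite ?NegzE ?mulrNz ?eeN ee_nat ?invr1. Qed.

Lemma ee_mulrn x (k : nat) : ee (k%:R * x) = ee x ^+ k.
Proof.
elim: k => [|k IHk]; first by rewrite mul0r ee0.
by rewrite -natr1 mulrDl mul1r eeD IHk exprSr.
Qed.

Lemma ee_sum (I : Type) (s : seq I) (P : pred I) (F : I -> R) :
  ee (\sum_(i <- s | P i) F i) = \prod_(i <- s | P i) ee (F i).
Proof. by apply: (big_morph ee eeD ee0). Qed.

Lemma normc_ee_sub1 x : normc (ee x - 1) = 2 * `|sin (pi * x)|.
Proof.
rewrite -[2]ger0_norm// -normrM -sqrtr_sqr /ee /expi; simpc => /=; congr Num.sqrt.
have -> : 2 * pi * x = pi * x + pi * x by ring.
rewrite cosD sinD exprMn; have := cos2Dsin2 (pi * x).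
by move: (cos _) (sin _) => c s H; rewrite sqrrB; nra.
Qed.

Lemma normc_ee_sub x y : normc (ee x - ee y) = 2 * `|sin (pi * (x - y))|.
Proof.
rewrite -normc_ee_sub1 -[LHS]mul1r -(normc_ee (- y)) -normcM.
by rewrite mulrBr eeN mulVf ?ee_neq0// mulrC -eeN -eeD.
Qed.

Lemma normc_ee_sub_le2 x y : normc (ee x - ee y) <= 2.
Proof.
rewrite normc_ee_sub -[leRHS]mulr1 ler_wpM2l// ler_norml.
by rewrite sin_geN1 sin_le1.
Qed.

Lemma sin_le_id x : 0 <= x -> sin x <= x.
Proof.
move=> x0; have [|c] := @MVT_segment R sin cos 0 x x0.
  by apply: continuous_subspaceT; exact: continuous_sin.
by rewrite in_itv /= sin0 !subr0 => _ ->; rewrite ler_piMl// cos_le1.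
Qed.

Lemma abs_sin_le x : `|sin x| <= `|x|.
Proof.
wlog x0 : x / 0 <= x.
  have [x0|x0] := lerP 0 x; first by move/(_ x x0).
  by move/(_ (- x)); rewrite sinN !normrN; apply; rewrite oppr_ge0 ltW.
rewrite (ger0_norm x0) ler_norml sin_le_id// andbT lerNl.
have [x1|x1] := lerP 1 x; first by apply: le_trans x1; rewrite lerNl sin_geN1.
rewrite (@le_trans _ _ 0)// oppr_le0 sin_ge0_pi// x0 /= (le_trans (ltW x1))//.
by apply: le_trans (pi_ge2 R); rewrite ler1n.
Qed.

(** By the mean value theorem sin (x / 2) = (x / 2) cos c, and both cos c and
    cos (x / 2) are at least the square root of 1 / 2. *)
Lemma sin_ge_half x : 0 <= x <= pi / 2 -> x / 2 <= sin x.
Proof.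
move=> /andP[x0 xpi]; have x20 : 0 <= x / 2 by rewrite divr_ge0.
have [|c] := @MVT_segment R sin cos 0 (x / 2) x20.
  by apply: continuous_subspaceT; exact: continuous_sin.
have p0 := pi_gt0 R.
have cos_half y : 0 <= y <= pi / 4 -> 2^-1 <= cos y ^+ 2 /\ 0 <= cos y.
  move=> /andP[y0 y4].
  have : 0 <= cos (y + y) by apply: cos_ge0_pihalf; apply/andP; split; lra.
  rewrite cosD -!expr2; have := cos2Dsin2 y => H1 H2; split; first by lra.
  by apply: cos_ge0_pihalf; apply/andP; split; lra.
rewrite in_itv /= sin0 !subr0 => /andP[c0 cx] E.
have [|c2 cc0] := cos_half c; first by rewrite c0 /=; lra.
have [|h2 ch0] := cos_half (x / 2); first by rewrite x20 /=; lra.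
have -> : sin x = 2 * (sin (x / 2) * cos (x / 2)).
  by rewrite [in LHS](splitr x) sinD; ring.
have cc : 2^-1 <= cos c * cos (x / 2).
  rewrite -(@ler_pXn2r _ 2) ?nnegrE ?mulr_ge0 ?invr_ge0// exprMn.
  by rewrite expr2 ler_pM ?invr_ge0.
rewrite E; have := ler_wpM2l x20 cc; lra.
Qed.

(** The lower bound for the multipliers by which finite differences act on
    discrete Fourier coefficients. *)
Lemma normc_ee_sub1_ge x : `|x| <= 2^-1 -> `|x| <= normc (ee x - 1).
Proof.
move=> xh; rewrite normc_ee_sub1; have p2 := pi_ge2 R.
have -> : `|sin (pi * x)| = `|sin (pi * `|x|)|.
  have [x0|x0] := leP 0 x; first by rewrite (ger0_norm x0).
  by rewrite (ltr0_norm x0) mulrN sinN normrN.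
have x0 := normr_ge0 x; set y := `|x| in x0 xh *.
have : pi * y / 2 <= sin (pi * y) by apply: sin_ge_half; apply/andP; split; nra.
have := ler_norm (sin (pi * y)); nra.
Qed.

Lemma normc_ee_sub_le x y : normc (ee x - ee y) <= 2 * pi * `|x - y|.
Proof.
rewrite normc_ee_sub -mulrA ler_wpM2l//.
by apply: le_trans (abs_sin_le _) _; rewrite normrM ger0_norm// pi_ge0.
Qed.

Lemma ee_neq1 x : 0 < x < 1 -> ee x != 1.
Proof.
move=> /andP[x0 x1]; rewrite -subr_eq0 -normc_eq0 normc_ee_sub1.
rewrite mulf_neq0// normr_eq0 lt0r_neq0// sin_gt0_pi// mulr_gt0 ?pi_gt0//=.
by rewrite -[ltRHS]mulr1 ltr_pM2l ?pi_gt0.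
Qed.

Lemma ee_ratio_neq1 (M a b : nat) : (a < M)%N -> (b < M)%N -> a != b ->
  ee (a%:R / M%:R - b%:R / M%:R) != 1.
Proof.
wlog ab : a b / (b < a)%N.
  move=> W aM bM ab; have [lt|le] := ltnP b a; first exact: W.
  rewrite -opprB eeN invr_eq1; apply: W => //; last by rewrite eq_sym.
  by rewrite ltn_neqAle ab.
move=> aM bM _; have M0 : 0 < M%:R :> R by rewrite ltr0n (leq_ltn_trans _ aM).
apply: ee_neq1; rewrite -mulrBl divr_gt0 ?subr_gt0 ?ltr_nat//=.
rewrite ltr_pdivrMr// mul1r ltrBlDr (lt_le_trans (y := M%:R)) ?ltr_nat//.
by rewrite lerDl.
Qed.

(** A geometric sum: (z - 1) (1 + z + ... + z^(M-1)) = z^M - 1 = 0. *)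
Lemma sum_ee_ratio (M a b : nat) : (a < M)%N -> (b < M)%N ->
  \sum_(j < M) ee (j%:R * (a%:R / M%:R - b%:R / M%:R)) = (M * (a == b))%:R.
Proof.
move=> aM bM; have [->|ab] := eqVneq a b.
  by under eq_bigr do rewrite subrr mulr0 ee0; rewrite sumr_const card_ord muln1.
under eq_bigr do rewrite ee_mulrn.
set z := ee _; have z1 : z - 1 != 0 by rewrite subr_eq0 ee_ratio_neq1.
have M0 : M%:R != 0 :> R by rewrite pnatr_eq0 -lt0n (leq_ltn_trans _ aM).
rewrite muln0; apply: (mulfI z1); rewrite mulr0 -subrX1.
rewrite /z -ee_mulrn mulrBr [M%:R * (a%:R / _)]mulrC [M%:R * (b%:R / _)]mulrC !divfK//.
by rewrite eeD eeN !ee_nat invr1 mulr1 subrr.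
Qed.
End UnitExponential.

(** * Discrete Fourier coefficients and their decay *)

Section DiscreteFourier.
Variable R : realType.
Import Normc.
Variables (N K : nat).
Let M := K.*2.+1.
Notation grid := {ffun 'I_N -> 'I_M}.

Definition dotZ (n : 'I_N -> int) (t : 'rV[R]_N) : R := \sum_l (n l)%:~R * t 0 l.

Definition gridpt (k : grid) : 'rV[R]_N := \row_l ((k l)%:R / M%:R).

(** As M = 2 K + 1 is odd, the frequencies of the grid fill the symmetric
    interval [-K, K]. *)
Definition freq (m : grid) (l : 'I_N) : int := (m l)%:Z - K%:Z.

Definition dft (f : 'rV[R]_N -> R) (n : 'I_N -> int) : R[i] :=
  (M ^ N)%:R^-1 * \sum_(k : grid) (f (gridpt k))%:C%C * ee (- dotZ n (gridpt k)).

Lemma dotZB n t u : dotZ n (t - u) = dotZ n t - dotZ n u.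
Proof. by rewrite /dotZ -sumrB; apply: eq_bigr => l _; rewrite !mxE mulrBr. Qed.

Lemma dotZ_delta n t (h : R) l :
  dotZ n (t + h *: delta_mx 0 l) = dotZ n t + (n l)%:~R * h.
Proof.
rewrite /dotZ (bigD1 l) //= [in RHS](bigD1 l) //= !mxE !eqxx mulr1 mulrDr.
rewrite addrAC; congr (_ + _ + _); apply: eq_bigr => j jl.
by rewrite !mxE (negbTE jl) andbF mulr0 addr0.
Qed.

Let M0 : M%:R != 0 :> R. Proof. by rewrite pnatr_eq0. Qed.

Lemma sum_ee_dotZ_freq (k k' : grid) :
  \sum_(m : grid) ee (dotZ (freq m) (gridpt k' - gridpt k)) =
  ((M ^ N) * (k == k'))%:R :> R[i].
Proof.
under eq_bigr do rewrite /dotZ ee_sum.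
rewrite -(bigA_distr_bigA (fun l (j : 'I_M) =>
  ee ((j%:Z - K%:Z)%:~R * (gridpt k' - gridpt k) 0 l))) /=.
have Hl l : \sum_(j < M) ee ((j%:Z - K%:Z)%:~R * (gridpt k' - gridpt k) 0 l) =
    (M * (k' l == k l))%:R :> R[i].
  rewrite !mxE; set y := _ - _.
  under eq_bigr do rewrite rmorphB mulrBl eeD /=.
  rewrite -mulr_suml sum_ee_ratio// val_eqE /y.
  case: (eqVneq (k' l) (k l)) => [->|_]; last by rewrite muln0 mul0r.
  by rewrite subrr mulr0 oppr0 ee0 mulr1.
rewrite (eq_bigr _ (fun l _ => Hl l)).
have [<-|kk'] := eqVneq k k'.
  under eq_bigr do rewrite eqxx muln1.
  by rewrite prodr_const card_ord muln1 natrX.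
have /existsP[l kl] : [exists l, k' l != k l].
  rewrite -negb_forall; apply: contra kk' => /forallP kk; apply/eqP/ffunP => l.
  by apply/esym/eqP; exact: kk.
by rewrite (bigD1 l)//= (negbTE kl) !muln0 mulr0n mul0r.
Qed.

Lemma dft_inversion f (k : grid) :
  \sum_(m : grid) dft f (freq m) * ee (dotZ (freq m) (gridpt k)) = (f (gridpt k))%:C%C.
Proof.
rewrite /dft.
under eq_bigr do rewrite -mulrA mulr_suml.
rewrite -mulr_sumr exchange_big /=.
have Hk j : \sum_(m : grid) (f (gridpt j))%:C%C * ee (- dotZ (freq m) (gridpt j)) *
      ee (dotZ (freq m) (gridpt k)) =
    (f (gridpt j))%:C%C * ((M ^ N) * (j == k))%:R.
  rewrite -sum_ee_dotZ_freq mulr_sumr; apply: eq_bigr => m _.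
  by rewrite -mulrA -eeD dotZB addrC.
rewrite (eq_bigr _ (fun j _ => Hk j)) (bigD1 k)//= big1 => [|j /negbTE jk]; last first.
  by rewrite jk muln0 mulr0.
rewrite addr0 eqxx muln1 mulrCA mulVf ?mulr1// pnatr_eq0 -lt0n expn_gt0.
by [].
Qed.

Definition fdiff l (g : 'rV[R]_N -> R) (t : 'rV[R]_N) : R :=
  g (t + M%:R^-1 *: delta_mx 0 l) - g t.

Definition Zperiodic (V : Type) (g : 'rV[R]_N -> V) : Prop :=
  forall t l, g (t + delta_mx 0 l) = g t.

Lemma Zperiodic_fdiff l g : Zperiodic g -> Zperiodic (fdiff l g).
Proof. by move=> pg t j; rewrite /fdiff addrAC !pg. Qed.

Lemma sum_grid_shift l (g : 'rV[R]_N -> R[i]) : Zperiodic g ->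
  \sum_(k : grid) g (gridpt k + M%:R^-1 *: delta_mx 0 l) = \sum_(k : grid) g (gridpt k).
Proof.
move=> pg; pose sh (k : grid) : grid := [ffun j => if j == l then ordS (k j) else k j].
have inj_sh : injective sh.
  move=> k k' E; apply/ffunP => j; have := congr1 (fun q : grid => q j) E.
  by rewrite !ffunE; case: ifP => // _; apply: (bij_inj (@ordS_bij _)).
rewrite [RHS](reindex_inj inj_sh); apply: eq_bigr => k _.
have [kM|kM] := ltnP (k l).+1 M.
  congr g; apply/rowP => j; rewrite !mxE /sh ffunE.
  have [->|jl] := eqVneq j l; last by rewrite mulr0 addr0.
  by rewrite /= modn_small// mulr1 -[X in _ = X / _]natr1 mulrDl mul1r.
rewrite -[RHS](pg _ l); congr g; apply/rowP => j; rewrite !mxE /sh ffunE.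
have [->|jl] := eqVneq j l; last by rewrite !andbF mulr0 !addr0.
have kE : (k l).+1 = M by apply/eqP; rewrite eqn_leq kM ltn_ord.
by rewrite /= kE modnn mul0r add0r mulr1 -[X in _ + X]mul1r -mulrDl natr1 kE divff.
Qed.

(** Summation by parts: the grid is invariant under the step of the
    difference. *)
Lemma dft_fdiff l f n : Zperiodic f ->
  dft (fdiff l f) n = (ee ((n l)%:~R / M%:R) - 1) * dft f n.
Proof.
move=> pf; rewrite /dft mulrCA; congr (_ * _).
rewrite mulrBl mul1r.
pose g t : R[i] := (f t)%:C%C * ee (- dotZ n t).
have pg : Zperiodic g.
  move=> t j; rewrite /g pf; congr (_ * _).
  have := dotZ_delta n t 1 j; rewrite scale1r mulr1 => ->.
  by rewrite opprD eeD -[X in _ * ee X]rmorphN /= ee_int mulr1.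
rewrite -[X in _ * X - _](sum_grid_shift l pg) mulr_sumr -sumrB.
apply: eq_bigr => k _; rewrite /fdiff rmorphB /= mulrBl; congr (_ - _).
rewrite /g mulrCA -eeD dotZ_delta; congr (_ * ee _).
by ring.
Qed.

Lemma dft_iter_fdiff l f n p : Zperiodic f ->
  dft (iter p (fdiff l) f) n = (ee ((n l)%:~R / M%:R) - 1) ^+ p * dft f n.
Proof.
move=> pf; have pi j : Zperiodic (iter j (fdiff l) f).
  by elim: j => //= j; exact: Zperiodic_fdiff.
elim: p => [|p IHp]; first by rewrite mul1r.
by rewrite iterS dft_fdiff// IHp exprS mulrA.
Qed.
End DiscreteFourier.

Section WeightedSum.
Variable R : realType.
Import Normc.

Section PowerSeries.
Variable eps : R.
Hypothesis eps0 : 0 < eps.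

(** A summable substitute for |j|^-(1 + eps), equal to 1 at j = 0. *)
Definition weight (j : nat) : R := ((maxn 1 j)%:R `^ (1 + eps))^-1.

Lemma weight_ge0 j : 0 <= weight j.
Proof. by rewrite invr_ge0 powR_ge0. Qed.

(** Comparison with the increments of - x^-eps / eps, whose sum telescopes. *)
Lemma weight_step (k : nat) : (0 < k)%N ->
  weight k.+1 <= eps^-1 * ((k%:R `^ eps)^-1 - (k.+1%:R `^ eps)^-1).
Proof.
move=> k0; have kp : 0 < k%:R :> R by rewrite ltr0n.
have k1p : 0 < k.+1%:R :> R by rewrite ltr0n.
rewrite /weight (maxn_idPr _)// powRD; last by rewrite lt0r_neq0 ?implybT.
rewrite powRr1 ?(ltW k1p)// invfM.
have pk := powR_gt0 eps kp; have pk1 := powR_gt0 eps k1p.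
have E : (k%:R `^ eps)^-1 - (k.+1%:R `^ eps)^-1 =
    (k.+1%:R `^ eps)^-1 * (k.+1%:R `^ eps / k%:R `^ eps - 1).
  by field; rewrite !lt0r_neq0.
rewrite E mulrCA [leLHS]mulrC ler_pM2l ?invr_gt0// mulrC ler_pdivlMr//.
have L : k.+1%:R^-1 <= ln (k.+1%:R / k%:R) :> R.
  have := @ln_le_sub1 R (k%:R / k.+1%:R); rewrite divr_gt0// => /(_ isT).
  rewrite -[k.+1%:R / k%:R]invf_div lnV ?posrE ?divr_gt0//.
  have : k%:R / k.+1%:R = 1 - k.+1%:R^-1 :> R.
    by rewrite -[X in X / _](addrK 1) natr1 mulrBl divff ?lt0r_neq0// mul1r.
  by move=> ->; move: (ln _) => r; move: (k.+1%:R^-1) => q; lra.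
have -> : k.+1%:R `^ eps / k%:R `^ eps = expR (eps * ln (k.+1%:R / k%:R)) :> R.
  rewrite ln_div ?posrE// mulrBr expRD expRN /powR.
  by rewrite !ifF// gt_eqF.
have fin (q r e y : R) : 0 < e -> q <= r -> 1 + e * r <= y -> q * e <= y - 1 by nra.
exact: fin eps0 L (expR_ge1Dx _).
Qed.

Lemma sum_weight_le (k : nat) : \sum_(j < k) weight j.+1 <= 1 + eps^-1.
Proof.
have ei : 0 < eps^-1 by rewrite invr_gt0.
suff [->|H] : k = 0%N \/ \sum_(j < k) weight j.+1 <=
    1 + eps^-1 - eps^-1 * (k%:R `^ eps)^-1.
- by rewrite big_ord0; lra.
- apply: le_trans H _; rewrite gerDl oppr_le0 mulr_ge0 ?(ltW ei)// invr_ge0 powR_ge0.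
elim: k => [|k [->|IHk]]; first by left.
  right; rewrite big_ord_recl big_ord0 /weight /= !powR1 invr1; lra.
have [->|k0] := posnP k.
  right; rewrite big_ord_recl big_ord0 /weight /= !powR1 invr1; lra.
right; rewrite big_ord_recr /=.
by have := weight_step k0; lra.
Qed.

Lemma sum_weight_freq_le (K : nat) :
  \sum_(j < K.*2.+1) weight `|j%:Z - K%:Z| <= 3 + 2 * eps^-1.
Proof.
have -> : \sum_(j < K.*2.+1) weight `|j%:Z - K%:Z| =
    \sum_(j < K) weight j.+1 + (weight 0 + \sum_(j < K) weight j.+1).
  rewrite -(big_mkord xpredT (fun j => weight `|j%:Z - K%:Z|)).
  rewrite (@big_cat_nat _ _ _ K) //=; last by rewrite -addnn -addnS leq_addr.
  congr (_ + _).
    rewrite big_nat_rev big_mkord; apply: eq_bigr => j _; congr weight.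
    by rewrite add0n distnEr ?leq_subr// subKn.
  rewrite -{1}[K]add0n big_addn -addnn -addSn addnK big_mkord big_ord_recl.
  congr (_ + _); first by rewrite add0n distnn.
  by apply: eq_bigr => j _; rewrite distnEl ?leq_addl// addnK.
have w0 : weight 0 = 1 by rewrite /weight powR1 invr1.
by rewrite w0; have := sum_weight_le K; lra.
Qed.
End PowerSeries.

Variables (N K : nat).
Hypothesis N0 : (0 < N)%N.
Let M := K.*2.+1.
Notation grid := {ffun 'I_N -> 'I_M}.

Lemma normc_sum (I : Type) (s : seq I) (P : pred I) (F : I -> R[i]) :
  normc (\sum_(i <- s | P i) F i) <= \sum_(i <- s | P i) normc (F i).
Proof.
elim/big_ind2 : _ => [|a b c d ab cd|//]; first by rewrite normc0.
by apply: le_trans (le_normcD _ _) _; rewrite lerD.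
Qed.

Lemma normc_real (a : R) : normc a%:C%C = `|a|.
Proof. by rewrite /= expr0n addr0 sqrtr_sqr. Qed.

Lemma normc_nat (a : nat) : normc (a%:R : R[i]) = a%:R.
Proof. by rewrite -(rmorph_nat (real_complex R)) normc_real ger0_norm. Qed.

Lemma normc_dft_le (f : 'rV[R]_N -> R) n (b : R) : (forall t, `|f t| <= b) ->
  normc (dft K f n) <= b.
Proof.
move=> fb; rewrite /dft normcM normcV normc_nat.
have MN : 0 < (M ^ N)%:R :> R by rewrite ltr0n expn_gt0.
rewrite mulrC ler_pdivrMr//; apply: le_trans (normc_sum _ _ _) _.
apply: (@le_trans _ _ (\sum_(k : grid) b)).
  by apply: ler_sum => k _; rewrite normcM normc_ee mulr1 normc_real.
by rewrite sumr_const card_ffun !card_ord mulr_natr.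
Qed.

(** The discrete form of the bound of |n|^p times a Fourier coefficient by the
    p-th derivative. *)
Lemma dft_decay (f : 'rV[R]_N -> R) (B : R) p n l : Zperiodic f ->
  (`|n l| <= K)%N ->
  (forall t, `|iter p (fdiff K l) f t| <= B / M%:R ^+ p) ->
  (`|n l|)%:R ^+ p * normc (dft K f n) <= B.
Proof.
move=> pf nK fB; have := normc_dft_le n fB; rewrite dft_iter_fdiff// normcM.
have Mp : 0 < M%:R :> R by rewrite ltr0n.
rewrite normcX ler_pdivlMr ?exprn_gt0//; apply: le_trans.
rewrite mulrAC -exprMn ler_wpM2r ?normc_ge0//.
rewrite lerXn2r ?nnegrE ?mulr_ge0 ?normc_ge0 ?ler0n//.
rewrite -ler_pdivrMr//.
have absE : `|(n l)%:~R / M%:R| = `|n l|%:R / M%:R :> R.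
  by rewrite normrM normfV [`|M%:R|]ger0_norm// -intr_norm -abszE.
rewrite -absE; apply: normc_ee_sub1_ge.
rewrite absE ler_pdivrMr// mulrC ler_pdivlMr// -natrM ler_nat /M.
by apply: leq_trans (leq_mul nK (leqnn 2)) _; rewrite muln2.
Qed.

(** Chosen so that N (1 + eps) + 1 / 2 = N + 1: the decay of order N + 1 pays
    for the factor |n|_1^(1/2) and for N summable weights. *)
Let eps : R := (2 * N%:R)^-1.
Let Np : 0 < N%:R :> R. Proof. by rewrite ltr0n. Qed.
Let eps0 : 0 < eps. Proof. by rewrite invr_gt0 mulr_gt0. Qed.

Definition l1 (n : 'I_N -> int) : R := (l1norm n)%:R.

(** The decay is in terms of the largest coordinate a of the frequency, and
    a^-(1 + eps) is at most the weight of each coordinate. *)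
Lemma dft_weighted_le (f : 'rV[R]_N -> R) (B : R) (m : grid) : Zperiodic f ->
  (forall l t, `|iter N.+1 (fdiff K l) f t| <= B / M%:R ^+ N.+1) ->
  (exists l, freq m l != 0) ->
  normc (dft K f (freq m)) * Num.sqrt (l1 (freq m)) <=
  B * Num.sqrt N%:R * \prod_l weight eps `|freq m l|.
Proof.
move=> pf fB [l0 nl0]; set n := freq m.
have [lm _ lmax] := @arg_maxP _ _ _ l0 xpredT (fun l => `|n l|%N) isT.
set a := `|n lm|%N in lmax.
have {}lmax l : (`|n l| <= a)%N by have := lmax l isT.
have a1 : (0 < a)%N by apply: leq_trans (lmax l0); rewrite absz_gt0.
have ap : 0 < a%:R :> R by rewrite ltr0n.
have nK : (`|n lm| <= K)%N.
  rewrite /n /freq; have := ltn_ord (m lm); rewrite /M ltnS => mK.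
  have [h|h] := leqP (m lm) K; first by rewrite distnEr ?leq_subr.
  by rewrite distnEl ?(ltnW h)// leq_subLR addnn.
have dec : a%:R ^+ N.+1 * normc (dft K f n) <= B by apply: dft_decay.
have sqrt_le : Num.sqrt (l1 n) <= Num.sqrt N%:R * a%:R `^ 2^-1.
  rewrite powR12_sqrt ?(ltW ap)// -sqrtrM ?(ltW Np)// ler_wsqrtr// /l1 /l1norm -natrM ler_nat.
  rewrite -[X in (_ <= X * _)%N]card_ord -sum_nat_const; apply: leq_sum => l _.
  exact: lmax.
have prod_ge : ((a%:R `^ (1 + eps)) ^+ N)^-1 <= \prod_l weight eps `|n l|.
  rewrite -exprVn -[X in _ ^+ X]card_ord -prodr_const; apply: ler_prod => l _.
  rewrite invr_ge0 powR_ge0 /= lef_pV2 ?posrE ?powR_gt0 ?ltr0n//; last first.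
    by rewrite leq_max.
  rewrite ge0_ler_powR ?nnegrE ?ler_nat ?geq_max ?a1 ?lmax//.
  by rewrite addr_ge0// ltW.
have Ea : (a%:R `^ (1 + eps)) ^+ N * a%:R `^ 2^-1 = a%:R ^+ N.+1 :> R.
  rewrite -powR_mulrn ?powR_ge0// -powRrM -powRD; last by rewrite lt0r_neq0 ?implybT.
  rewrite -[RHS]powR_mulrn ?(ltW ap)//; congr (_ `^ _).
  by rewrite /eps -natr1; field; rewrite lt0r_neq0.
have pa := powR_gt0 (1 + eps) ap; have pa2 := powR_gt0 (2^-1) ap.
have B0 : 0 <= B.
  by apply: le_trans dec; rewrite mulr_ge0 ?exprn_ge0 ?normc_ge0// ltW.
apply: (@le_trans _ _ (B * Num.sqrt N%:R * ((a%:R `^ (1 + eps)) ^+ N)^-1)); last first.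
  by rewrite ler_wpM2l// mulr_ge0// sqrtr_ge0.
rewrite ler_pdivlMr ?exprn_gt0//.
apply: (@le_trans _ _ (normc (dft K f n) * (Num.sqrt N%:R * a%:R `^ 2^-1) *
    (a%:R `^ (1 + eps)) ^+ N)).
  by rewrite ler_wpM2r ?exprn_ge0 ?powR_ge0// ler_wpM2l ?normc_ge0.
have -> : normc (dft K f n) * (Num.sqrt N%:R * a%:R `^ 2^-1) * (a%:R `^ (1 + eps)) ^+ N =
   (a%:R ^+ N.+1 * normc (dft K f n)) * Num.sqrt N%:R.
  by rewrite -Ea; ring.
by rewrite ler_wpM2r ?sqrtr_ge0.
Qed.

Definition dft_constant (B : R) : R := B * Num.sqrt N%:R * (3 + 4 * N%:R) ^+ N.

Lemma sum_dft_weighted_le (f : 'rV[R]_N -> R) (B : R) : 0 <= B -> Zperiodic f ->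
  (forall l t, `|iter N.+1 (fdiff K l) f t| <= B / M%:R ^+ N.+1) ->
  \sum_(m : grid) normc (dft K f (freq m)) * Num.sqrt (l1 (freq m)) <= dft_constant B.
Proof.
move=> B0 pf fB; have BN : 0 <= B * Num.sqrt N%:R by rewrite mulr_ge0// sqrtr_ge0.
apply: (@le_trans _ _ (\sum_(m : grid) B * Num.sqrt N%:R * \prod_l weight eps `|freq m l|)).
  apply: ler_sum => m _; have [/existsP nm|] := boolP [exists l, freq m l != 0].
    exact: dft_weighted_le.
  rewrite negb_exists => /forallP nm.
  have -> : l1 (freq m) = 0.
    rewrite /l1 /l1norm big1// => l _; have /negPn/eqP -> := nm l; exact: absz0.
  by rewrite sqrtr0 mulr0 mulr_ge0// prodr_ge0// => l _; exact: weight_ge0.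
rewrite -mulr_sumr /dft_constant ler_wpM2l//.
rewrite -(bigA_distr_bigA (fun l (j : 'I_M) => weight eps `|j%:Z - K%:Z|)) /=.
rewrite prodr_const card_ord lerXn2r ?nnegrE ?sumr_ge0 ?addr_ge0 ?mulr_ge0//; last first.
  by apply: le_trans (sum_weight_freq_le eps0 K) _; rewrite /eps invrK; lra.
by move=> j _; exact: weight_ge0.
Qed.
End WeightedSum.

(** * Equidistribution from bounds on character sums *)

Section Equidistribution.
Variable R : realType.
Import Normc.
Variable N : nat.
Hypothesis N0 : (0 < N)%N.
Variables (f : 'rV[R]_N -> R) (L B : R).
Hypothesis L0 : 0 <= L.
Hypothesis B0 : 0 <= B.
Hypothesis pf : Zperiodic f.
Hypothesis fL : forall t u, `|f t - f u| <= L * \sum_l `|t 0 l - u 0 l|.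
Hypothesis fB : forall K l t,
  `|iter N.+1 (fdiff K l) f t| <= B / (K.*2.+1)%:R ^+ N.+1.
Let c1 := dft_constant N B.

Lemma dft_constant_ge0 : 0 <= c1.
Proof. by rewrite !mulr_ge0 ?exprn_ge0 ?sqrtr_ge0// addr_ge0// mulr_ge0. Qed.

Lemma grid_approx (K : nat) (t : 'rV[R]_N) : (forall l, 0 <= t 0 l < 1) ->
  exists k : {ffun 'I_N -> 'I_K.*2.+1}, forall l,
    `|t 0 l - gridpt R k 0 l| <= (K.*2.+1)%:R^-1.
Proof.
move=> t01; set M := K.*2.+1; have M0 : 0 < M%:R :> R by rewrite ltr0n.
have ex l : exists j : 'I_M, `|t 0 l - j%:R / M%:R| <= M%:R^-1.
  have /andP[t0 t1] := t01 l.
  have tM0 : 0 <= t 0 l * M%:R by rewrite mulr_ge0// ltW.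
  have /andP[a b] := truncn_itv tM0; set j := Num.truncn _ in a b.
  have jM : (j < M)%N.
    rewrite -(ltr_nat R) (le_lt_trans a)// -[ltRHS]mul1r ltr_pM2r//.
  exists (Ordinal jM) => /=.
  rewrite -(ler_pM2r M0) mulVf ?lt0r_neq0// -[X in _ * X](ger0_norm (ltW M0)) -normrM.
  rewrite mulrBl divfK ?lt0r_neq0// ger0_norm ?subr_ge0// lerBlDl.
  by rewrite natr1 ltW.
have [k Hk] := choice ex.
by exists [ffun l => k l] => l; rewrite !mxE ffunE.
Qed.

(** The geometric mean of the bounds 2 and 2 pi |x - y|.  The square root makes
    the interpolation error summable against the same |n|_1^(1/2). *)
Lemma normc_ee_sub_sqrt (x y : R) : normc (ee x - ee y) <= Num.sqrt (4 * pi * `|x - y|).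
Proof.
rewrite -[leLHS]ger0_norm ?normc_ge0// -sqrtr_sqr ler_wsqrtr//.
have := normc_ee_sub_le2 x y; have := normc_ee_sub_le x y.
have := normc_ge0 (ee x - ee y); move: (normc _) => a a0 a1 a2.
have -> : 4 * pi * `|x - y| = 2 * (2 * pi * `|x - y|) by ring.
by rewrite expr2 ler_pM.
Qed.

Definition dft_poly (K : nat) (t : 'rV[R]_N) : R[i] :=
  \sum_(m : {ffun 'I_N -> 'I_K.*2.+1}) dft K f (freq m) * ee (dotZ (freq m) t).

Let err (K : nat) : R := L * N%:R / (K.*2.+1)%:R.

(** The polynomial agrees with f at the nearest grid point, and moving from
    there to t changes f by the Lipschitz bound and each character by
    [normc_ee_sub_sqrt]. *)
Lemma dft_poly_approx (K : nat) (t : 'rV[R]_N) : (forall l, 0 <= t 0 l < 1) ->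
  normc ((f t)%:C%C - dft_poly K t) <=
  err K + c1 * Num.sqrt (4 * pi / (K.*2.+1)%:R).
Proof.
move=> t01; have [k Hk] := grid_approx K t01.
set M := K.*2.+1 in Hk *; have M0 : 0 < M%:R :> R by rewrite ltr0n.
have -> : (f t)%:C%C - dft_poly K t =
   (f t - f (gridpt R k))%:C%C + (dft_poly K (gridpt R k) - dft_poly K t).
  by rewrite rmorphB /= -(dft_inversion f k) addrA subrK.
apply: le_trans (le_normcD _ _) _; apply: lerD.
  rewrite normc_real; apply: le_trans (fL _ _) _; rewrite /err -mulrA ler_wpM2l//.
  apply: le_trans (ler_sum _ (fun l _ => Hk l)) _.
  by rewrite sumr_const card_ord mulr_natl.
rewrite /dft_poly -sumrB; apply: le_trans (normc_sum _ _ _) _.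
apply: le_trans (_ : _ <= \sum_(m : {ffun 'I_N -> 'I_M})
  normc (dft K f (freq m)) * Num.sqrt (l1 R (freq m)) * Num.sqrt (4 * pi / M%:R)) _; last first.
  by rewrite -mulr_suml ler_wpM2r ?sqrtr_ge0//; apply: sum_dft_weighted_le => //.
apply: ler_sum => m _; rewrite -mulrBr normcM -mulrA ler_wpM2l ?normc_ge0//.
apply: le_trans (normc_ee_sub_sqrt _ _) _.
rewrite -sqrtrM ?ler0n// ler_wsqrtr//.
have -> : l1 R (freq m) * (4 * pi / M%:R) = 4 * pi * (l1 R (freq m) / M%:R) by ring.
rewrite ler_wpM2l ?mulr_ge0 ?pi_ge0// -dotZB /dotZ.
apply: le_trans (ler_norm_sum _ _ _) _.
rewrite /l1 /l1norm natr_sum mulr_suml; apply: ler_sum => l _.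
rewrite normrM -intr_norm -abszE ler_wpM2l//.
by rewrite !mxE distrC; have := Hk l; rewrite !mxE.
Qed.

Variables (I : finType) (t : I -> 'rV[R]_N) (e Lam : R).
Hypothesis I0 : (0 < #|I|)%N.
Hypothesis e0 : 0 <= e.
Hypothesis t01 : forall i l, 0 <= t i 0 l < 1.
Hypothesis Hchi : forall n : 'I_N -> int, (exists l, n l != 0) ->
  normc (\sum_i ee (dotZ n (t i))) <= #|I|%:R * (Num.sqrt (l1 R n) * e).
Hypothesis HLam : forall K, normc (Lam%:C%C - dft K f (fun=> 0)) <= err K.

Lemma dft_poly_mean (K : nat) :
  normc (#|I|%:R^-1 * \sum_i dft_poly K (t i) - dft K f (fun=> 0)) <= c1 * e.
Proof.
have s0 : (#|I|%:R : R[i]) != 0 by rewrite pnatr_eq0 -lt0n.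
have sp : 0 < #|I|%:R :> R by rewrite ltr0n.
pose m0 : {ffun 'I_N -> 'I_K.*2.+1} := [ffun => inord K].
have freq0 m : (forall l, freq m l = 0) -> m = m0.
  move=> Hm; apply/ffunP => l; rewrite ffunE; apply/val_inj; rewrite /= inordK.
    by have /eqP := Hm l; rewrite /freq subr_eq0 => /eqP [].
  by rewrite ltnS -addnn leq_addr.
have freqm0 : freq m0 = (fun=> 0).
  apply/funext => l; rewrite /freq ffunE inordK ?subrr//.
  by rewrite ltnS -addnn leq_addr.
have -> : #|I|%:R^-1 * \sum_i dft_poly K (t i) - dft K f (fun=> 0) =
   \sum_(m | m != m0) dft K f (freq m) * (#|I|%:R^-1 * \sum_i ee (dotZ (freq m) (t i))).
  rewrite /dft_poly exchange_big /= mulr_sumr (bigD1 m0)//=.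
  rewrite -mulr_sumr freqm0 (_ : \sum_i _ = #|I|%:R); last first.
    rewrite (eq_bigr (fun=> 1)) ?sumr_const// => i _.
    by rewrite /dotZ big1 ?ee0// => l _; rewrite mul0r.
  rewrite [X in X + _ - _]mulrCA mulVf// mulr1 addrAC subrr add0r.
  by apply: eq_bigr => m _; rewrite -mulr_sumr mulrCA.
apply: le_trans (normc_sum _ _ _) _.
apply: le_trans (_ : _ <= \sum_(m : {ffun 'I_N -> 'I_K.*2.+1})
  normc (dft K f (freq m)) * Num.sqrt (l1 R (freq m)) * e) _; last first.
  by rewrite -mulr_suml ler_wpM2r//; apply: sum_dft_weighted_le => //.
rewrite big_mkcond; apply: ler_sum => m _; case: ifP => mm0; last first.
  by rewrite !mulr_ge0 ?normc_ge0 ?sqrtr_ge0.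
rewrite normcM -mulrA ler_wpM2l ?normc_ge0// normcM normcV normc_nat.
rewrite mulrC ler_pdivrMr// mulrC; apply: Hchi.
have [/existsP//|] := boolP [exists l, freq m l != 0].
rewrite negb_exists => /forallP H; case/eqP: mm0; apply: freq0 => l.
exact/eqP/negPn/H.
Qed.

(** All error terms tend to zero with the mesh of the grid, except c1 e. *)
Lemma equidistribution_of_characters :
  `|#|I|%:R^-1 * \sum_i f (t i) - Lam| <= c1 * e.
Proof.
have sp : 0 < #|I|%:R :> R by rewrite ltr0n.
set X := `|_|.
have bound K : X <= c1 * e + (2 * err K + c1 * Num.sqrt (4 * pi / (K.*2.+1)%:R)).
  have -> : X = normc ((#|I|%:R^-1 * \sum_i f (t i) - Lam)%:C%C) by rewrite normc_real.
  have -> : ((#|I|%:R^-1 * \sum_i f (t i) - Lam)%:C%C : R[i]) =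
     #|I|%:R^-1 * (\sum_i ((f (t i))%:C%C - dft_poly K (t i))) +
     ((#|I|%:R^-1 * \sum_i dft_poly K (t i) - dft K f (fun=> 0)) -
      (Lam%:C%C - dft K f (fun=> 0))).
    rewrite rmorphB rmorphM /= fmorphV rmorph_nat rmorph_sum /= sumrB.
    by move: (\sum_(_ : I) _) (\sum_(_ : I) _) => u v; ring.
  apply: le_trans (le_normcD _ _) _.
  have h1 : normc (#|I|%:R^-1 * (\sum_i ((f (t i))%:C%C - dft_poly K (t i)))) <=
      err K + c1 * Num.sqrt (4 * pi / (K.*2.+1)%:R).
    rewrite normcM normcV normc_nat mulrC ler_pdivrMr//.
    apply: le_trans (normc_sum _ _ _) _.
    apply: le_trans (ler_sum _ (fun i _ => dft_poly_approx K (t01 i))) _.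
    by rewrite sumr_const mulr_natr.
  have h2 : normc ((#|I|%:R^-1 * \sum_i dft_poly K (t i) - dft K f (fun=> 0)) -
      (Lam%:C%C - dft K f (fun=> 0))) <= c1 * e + err K.
    by apply: le_trans (le_normcD _ _) _; rewrite normcN lerD ?dft_poly_mean ?HLam.
  by have := lerD h1 h2; lra.
apply/ler_addgt0Pr => d d0.
pose C := 2 * (L * N%:R) + c1 * Num.sqrt (4 * pi).
have C0 : 0 <= C.
  by rewrite addr_ge0 ?mulr_ge0 ?sqrtr_ge0 ?dft_constant_ge0.
(* Then C / d <= (2 K + 1)^(1/2), and both errors decay at least as fast as
   the inverse of that square root. *)
pose K := (Num.truncn ((C / d) ^+ 2)).+1.
apply: le_trans (bound K) _; rewrite lerD2l.
set M := K.*2.+1; have M0 : 0 < M%:R :> R by rewrite ltr0n.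
have M1 : 1 <= Num.sqrt (M%:R : R) by rewrite -[leLHS]sqrtr1 ler_wsqrtr// ler1n.
have sM0 : 0 < Num.sqrt (M%:R : R) by apply: lt_le_trans M1.
have MM : Num.sqrt (M%:R : R) ^+ 2 = M%:R by rewrite sqr_sqrtr ?ler0n.
have e1 : 2 * err K <= 2 * (L * N%:R) / Num.sqrt M%:R.
  rewrite /err -/M -!mulrA !ler_wpM2l//.
  rewrite lef_pV2 ?posrE// -[leRHS]MM; set q := Num.sqrt _ in M1 *; nra.
have e2 : c1 * Num.sqrt (4 * pi / M%:R) = c1 * Num.sqrt (4 * pi) / Num.sqrt M%:R.
  by rewrite sqrtrM ?mulr_ge0 ?pi_ge0// sqrtrV ?ler0n// mulrA.
rewrite -/M e2; apply: (@le_trans _ _ (C / Num.sqrt M%:R)).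
  by rewrite /C [leRHS]mulrDl lerD2r.
rewrite ler_pdivrMr// -ler_pdivrMl// mulrC.
rewrite -[leLHS]ger0_norm ?mulr_ge0 ?invr_ge0 ?(ltW d0)// -sqrtr_sqr ler_wsqrtr//.
have /andP[_ b] := truncn_itv (sqr_ge0 (C / d)).
by apply: le_trans (ltW b) _; rewrite ler_nat /M /K -addnn -addnS leq_addr.
Qed.
End Equidistribution.

(** * Finite differences of smooth periodic functions *)

Section FiniteDifferences.
Variables (R : realType) (N : nat).
Implicit Types (g : 'rV[R]_N -> R) (t v : 'rV[R]_N).

Let line_quot g v t (s : R) :
  (fun h : R => h^-1 *:
    (((fun s : R => g (t + s *: v)) \o shift s) (h *: (1 : R)) - g (t + s *: v))) =
  (fun h : R => h^-1 *: ((g \o shift (t + s *: v)) (h *: v) - g (t + s *: v))).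
Proof.
apply/funext => h /=; congr (_ *: (g _ - _)).
by rewrite [h%:A]mulr1 scalerDl addrCA.
Qed.

Lemma is_derive_line g v t (s : R) : derivable g (t + s *: v) v ->
  is_derive s 1 (fun s : R => g (t + s *: v)) ('D_v g (t + s *: v)).
Proof.
move=> dg; apply: DeriveDef.
  by rewrite /derivable line_quot.
by rewrite /derive line_quot.
Qed.

Let shift_quot g a v t :
  (fun h : R => h^-1 *: (((fun t => g (t + a)) \o shift t) (h *: v) - g (t + a))) =
  (fun h : R => h^-1 *: ((g \o shift (t + a)) (h *: v) - g (t + a))).
Proof. by apply/funext => h /=; rewrite addrA. Qed.

Lemma derive_shift g a v t : 'D_v (fun t => g (t + a)) t = 'D_v g (t + a).
Proof. by rewrite /derive shift_quot. Qed.

Lemma derivable_shift g a v t : derivable g (t + a) v ->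
  derivable (fun t => g (t + a)) t v.
Proof. by rewrite /derivable shift_quot. Qed.

Definition iter_derive (l : 'I_N) (p : nat) g : 'rV[R]_N -> R :=
  iter p (fun g t => 'D_(delta_mx 0 l) g t) g.

(** Derivatives commute with differences, and the mean value theorem turns each
    difference of step 1 / M into a derivative and a factor 1 / M. *)
Lemma iter_fdiff_le (K p : nat) (l : 'I_N) g (b : R) :
  (forall j, (j < p)%N -> forall t, derivable (iter_derive l j g) t (delta_mx 0 l)) ->
  (forall t, `|iter_derive l p g t| <= b) ->
  forall t, `|iter p (fdiff K l) g t| <= b / (K.*2.+1)%:R ^+ p.
Proof.
set h : R := (K.*2.+1)%:R^-1; have h0 : 0 < h by rewrite invr_gt0 ltr0n.
elim: p g b => [|p IHp] g b dg gb t; first by rewrite expr0 divr1; exact: gb.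
have E j : (j <= p)%N -> iter_derive l j (fdiff K l g) = fdiff K l (iter_derive l j g).
  elim: j => // j IHj jp; rewrite /iter_derive iterS -/(iter_derive l j _).
  rewrite IHj ?(ltnW jp)//; apply/funext => u; rewrite /fdiff deriveB; last 2 first.
  - by apply: derivable_shift; apply: dg; rewrite ltnW.
  - by apply: dg; rewrite ltnW.
  by rewrite derive_shift.
rewrite iterSr exprS invfM mulrA.
apply: IHp => [j jp u|u].
  rewrite E ?(ltnW jp)//; apply: derivableB; last by apply: dg; rewrite ltnW.
  by apply: derivable_shift; apply: dg; rewrite ltnW.
rewrite E// /fdiff -/h; set G := iter_derive l p g.
have [||c _] := @MVT_segment R (fun s => G (u + s *: delta_mx 0 l))
  (fun s => iter_derive l p.+1 g (u + s *: delta_mx 0 l)) 0 h (ltW h0).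
- by move=> s _; apply: is_derive_line; exact: dg.
- apply: derivable_within_continuous => s _.
  by apply: ex_derive; apply: is_derive_line; exact: dg.
rewrite scale0r addr0 subr0 => ->.
by rewrite normrM (ger0_norm (ltW h0)) ler_wpM2r ?gb// ltW.
Qed.

Lemma class_C_iter_derive (k : nat) g (l : 'I_N) : class_C k g ->
  (forall j, (j < k)%N -> forall t, derivable (iter_derive l j g) t (delta_mx 0 l)) /\
  continuous (iter_derive l k g).
Proof.
elim: k g => [|k IHk] g; first by move=> [].
move=> [_ /(_ l)[dg /IHk[d1 c1]]]; split.
  by case=> [|j] jk t; [exact: dg|rewrite /iter_derive iterSr; exact: d1].
by rewrite /iter_derive iterSr.
Qed.

Lemma Zperiodic_derive g v : Zperiodic g -> Zperiodic (fun t => 'D_v g t).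
Proof.
move=> pg t l; rewrite -(derive_shift g (delta_mx 0 l) v t).
by rewrite (_ : (fun u => g (u + delta_mx 0 l)) = g)//; apply/funext => u; rewrite pg.
Qed.

Lemma Zperiodic_int g (n : 'I_N -> int) t : Zperiodic g ->
  g (t + \sum_l (n l)%:~R *: delta_mx 0 l) = g t.
Proof.
move=> pg; have p1 (k : nat) l u : g (u + k%:R *: delta_mx 0 l) = g u.
  elim: k => [|k IHk]; first by rewrite scale0r addr0.
  by rewrite -natr1 scalerDl scale1r addrA pg.
have p2 (k : int) l u : g (u + k%:~R *: delta_mx 0 l) = g u.
  case: k => k; first exact: p1.
  by rewrite NegzE mulrNz scaleNr -[LHS](p1 k.+1 l) subrK.
elim: (index_enum _) t => [|l s IHs] t; first by rewrite big_nil addr0.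
by rewrite big_cons addrA IHs p2.
Qed.

(** The values are those on the unit cube, which is compact. *)
Lemma Zperiodic_continuous_bounded g : Zperiodic g -> continuous g ->
  exists b, 0 <= b /\ forall t, `|g t| <= b.
Proof.
move=> pg cg.
pose Q := [set t : 'rV[R]_N | forall l, `[0, 1]%classic (t 0 l)].
have cQ : compact Q.
  by apply: (@rV_compact R N (fun=> `[0, 1]%classic)) => l; exact: segment_compact.
have : compact (g @` Q).
  by apply: continuous_compact => //; exact: continuous_subspaceT.
move=> /compact_bounded[M [_ HM]].
exists (`|M| + 1); split=> [|t]; first by rewrite addr_ge0.
pose n l : int := Num.floor (t 0 l).
rewrite -[g t](@Zperiodic_int g (fun l => - n l))//.
apply: (HM (`|M| + 1)); first by rewrite (le_lt_trans (ler_norm _))// ltrDl.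
exists (t + \sum_l (- n l)%:~R *: delta_mx 0 l) => // l.
have -> : (t + \sum_l (- n l)%:~R *: delta_mx 0 l : 'rV[R]_N) 0 l = t 0 l - (n l)%:~R.
  rewrite !mxE summxE (bigD1 l)//= !mxE !eqxx mulr1 mulrNz big1 ?addr0// => j jl.
  by rewrite !mxE eq_sym (negbTE jl) andbF mulr0.
rewrite /= in_itv /= subr_ge0 lerBlDr.
have /andP[a b] := Num.Theory.floor_itv (t 0 l).
by rewrite /n a /= addrC ltW//; move: b; rewrite rmorphD.
Qed.
End FiniteDifferences.

(** * Geometry of the polycircle and its Haar measure *)

Section TorusGeometry.
Variables (R : realType) (N : nat).
Import Normc.
Notation T := (ctorus R N).

Lemma unit_coordinate (z : R[i]) :
  exists t : R, 0 <= t < 1 /\ z = (normc z)%:C%C * ee t.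
Proof.
have [theta Dz] := polar_form z; pose u := theta / (2 * pi).
have p0 : (2 * pi : R) != 0 by rewrite lt0r_neq0// twopi_gt0.
exists (u - (Num.floor u)%:~R); split.
  have /andP[a b] := Num.Theory.floor_itv u.
  by rewrite subr_ge0 a ltrBlDl; move: b; rewrite rmorphD.
rewrite eeD -rmorphN ee_int mulr1 [LHS]Dz /ee /expi /u [2 * pi * _]mulrC divfK//.
by simpc.
Qed.

Lemma circle_paramE (t : 'rV[R]_N) l : val (circle_param t l : cstar R) = ee (t 0 l).
Proof. by rewrite /circle_param ffunE. Qed.

Lemma polycircle_circle_param (t : 'rV[R]_N) : polycircle (circle_param t).
Proof. by move=> l; rewrite circle_paramE normc_ee. Qed.

Lemma polycircleP (z : T) : polycircle z ->
  exists t : 'rV[R]_N, (forall l, 0 <= t 0 l < 1) /\ z = circle_param t.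
Proof.
move=> Pz; have [t Ht] := choice (fun l => unit_coordinate (val (z l : cstar R))).
exists (\row_l t l); split=> [l|]; first by rewrite mxE; have [] := Ht l.
apply/ffunP => l; apply/val_inj; rewrite circle_paramE mxE.
by have [_ {1}->] := Ht l; rewrite Pz mul1r.
Qed.

Lemma ctorusM_circle_param (t u : 'rV[R]_N) :
  ctorusM (circle_param t) (circle_param u) = circle_param (t + u).
Proof.
apply/ffunP => l; apply/val_inj; rewrite circle_paramE /ctorusM ffunE /= mxE eeD.
by rewrite -!circle_paramE.
Qed.

Lemma Zperiodic_circle_param : Zperiodic (fun t => circle_param t : T).
Proof.
move=> t l; apply/ffunP => j; apply/val_inj; rewrite !circle_paramE !mxE eeD.
by rewrite (ee_nat _ (_ && _)) mulr1.
Qed.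

Lemma unit_part_unit (z : cstar R) : normc (val z) = 1 -> unit_part z = val z.
Proof. by move=> z1; rewrite /unit_part z1 divr1. Qed.

Lemma acos_cos_le (x : R) : acos (cos x) <= `|x|.
Proof.
have -> : cos x = cos `|x|.
  by have [x0|x0] := leP 0 x; rewrite ?(ger0_norm x0)// (ltr0_norm x0) cosN.
have [h|h] := lerP `|x| pi; first by rewrite cosK// in_itv /= normr_ge0.
by apply: le_trans (ltW h); apply: acos_lepi; rewrite cos_geN1 cos_le1.
Qed.

Lemma dist_ang_circle_param (t u : 'rV[R]_N) l :
  0 <= dist_ang (circle_param t l : cstar R) (circle_param u l) <= `|t 0 l - u 0 l|.
Proof.
have p0 := twopi_gt0 R.
rewrite /dist_ang !unit_part_unit ?circle_paramE ?normc_ee//.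
have -> : complex.Re (ee (t 0 l) * (ee (u 0 l))^*%C) = cos (2 * pi * (t 0 l - u 0 l)).
  by rewrite /ee /expi /= mulrBr cosB mulrN opprK.
rewrite ler_pdivlMr// mul0r acos_ge0 ?cos_geN1 ?cos_le1//= ler_pdivrMr//.
by apply: le_trans (acos_cos_le _) _; rewrite normrM (gtr0_norm p0) mulrC.
Qed.

Lemma sqrt_sum_sqr_le (I : Type) (s : seq I) (x : I -> R) : (forall i, 0 <= x i) ->
  Num.sqrt (\sum_(i <- s) x i ^+ 2) <= \sum_(i <- s) x i.
Proof.
move=> x0; have s0 (r : seq I) : 0 <= \sum_(i <- r) x i by rewrite sumr_ge0.
rewrite -[leRHS]ger0_norm// -sqrtr_sqr ler_wsqrtr//.
elim: s => [|i s IHs]; first by rewrite !big_nil expr0n.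
rewrite !big_cons; have := s0 s; have := x0 i.
by move: (\sum_(_ <- _) _) (\sum_(_ <- _) _) (x i) IHs => a b c; nra.
Qed.

Lemma ctorus_dist_circle_param (t u : 'rV[R]_N) :
  ctorus_dist (circle_param t) (circle_param u) <= \sum_l `|t 0 l - u 0 l|.
Proof.
rewrite /ctorus_dist; apply: le_trans (sqrt_sum_sqr_le _ (fun l => normr_ge0 _)).
apply: ler_wsqrtr; apply: ler_sum => l _.
rewrite !circle_paramE !normc_ee subrr normr0 expr0n addr0.
by have /andP[a b] := dist_ang_circle_param t u l; rewrite lerXn2r ?nnegrE.
Qed.

Lemma ctorus_distM (w z z' : T) : polycircle w ->
  ctorus_dist (ctorusM w z) (ctorusM w z') = ctorus_dist z z'.
Proof.
move=> Pw; rewrite /ctorus_dist; congr Num.sqrt; apply: eq_bigr => l _.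
have wl : normc (val (w l : cstar R)) = 1 := Pw l.
have E (y : T) : val (ctorusM w y l : cstar R) = val (w l : cstar R) * val (y l : cstar R).
  by rewrite /ctorusM ffunE.
rewrite !E !normcM wl !mul1r; congr (_ ^+ 2 + _).
rewrite /dist_ang; congr (acos (complex.Re _) / _).
rewrite /unit_part !E !normcM wl !mul1r.
have ww : val (w l : cstar R) * (val (w l : cstar R))^*%C = 1.
  have := sqr_normc (val (w l : cstar R)); rewrite normc_def => <-.
  by move: (val (w l : cstar R)) wl => [a b] /= ->; rewrite -rmorphXn expr1n.
rewrite -!mulrA rmorphM mulrA [RHS]mulrA -[RHS]mul1r -ww; ring.
Qed.

(** Translations by the polycircle are isometries, so preimages of open sets are
    open. *)
Lemma ctorusM_measurable (w : T) : polycircle w -> measurable_fun setT (ctorusM w : T -> T).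
Proof.
move=> Pw; apply: (@measurability _ _ T T setT (ctorusM w) (@ctorus_open R N)) => //.
move=> _ [U oU <-]; rewrite setTI; apply: sub_sigma_algebra => z /= Uz.
have [e e0 He] := oU _ Uz; exists e => // z' zz'; apply: He.
by rewrite ctorus_distM.
Qed.

Lemma lipschitz_measurable (F : T -> R) (k : R) :
  (forall z w, `|F z - F w| <= k * ctorus_dist z w) -> measurable_fun setT F.
Proof.
move=> FL; apply: (measurability (RGenOInfty.G (R := R))).
  exact: RGenOInfty.measurableE.
move=> _ [_ [x ->] <-]; rewrite setTI; apply: sub_sigma_algebra => z /=.
rewrite in_itv /= andbT => xz.
have k0 : 0 < `|k| + 1 by rewrite ltr_wpDl.
exists ((F z - x) / (`|k| + 1)); first by rewrite divr_gt0// subr_gt0.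
move=> w; rewrite ltr_pdivlMr// => zw; rewrite /= in_itv /= andbT.
have d0 : 0 <= ctorus_dist z w by exact: sqrtr_ge0.
have := FL z w; have := ler_norm (F z - F w); have := ler_norm k.
by move: (ctorus_dist z w) `|k| (F z) (F w) `|_ - _| d0 zw => d a b c g; nra.
Qed.

Lemma ctorus_dist_ge_ln (z w : T) l :
  `|ln (normc (val (z l : cstar R))) - ln (normc (val (w l : cstar R)))| <= ctorus_dist z w.
Proof.
rewrite /ctorus_dist -[leLHS]ger0_norm// -sqrtr_sqr ler_wsqrtr//.
rewrite (bigD1 l)//= -addrA addrCA lerDl addr_ge0 ?sqr_ge0//.
by apply: sumr_ge0 => j _; rewrite addr_ge0 ?sqr_ge0.
Qed.

Lemma polycircle_measurable : measurable (@polycircle R N).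
Proof.
rewrite -[X in measurable X]setCK; apply: measurableC.
apply: sub_sigma_algebra => z /= /existsNP[l zl].
exists `|ln (normc (val (z l : cstar R)))|.
  rewrite normr_gt0 ln_eq0; first exact/eqP.
  by rewrite normc_gt0 (valP (z l : cstar R)).
move=> w zw Pw; have := ctorus_dist_ge_ln z w l.
by rewrite (Pw l) ln1 subr0 leNgt zw.
Qed.
End TorusGeometry.

Section HaarIntegral.
Variables (R : realType) (N : nat).
Import Normc.
Notation T := (ctorus R N).
Variable lambda : probability T R.
Hypothesis haar : is_haar_polycircle lambda.

Let P : set T := @polycircle R N.
Let mP : measurable P. Proof. exact: polycircle_measurable. Qed.
Let mPC : measurable (~` P). Proof. exact: measurableC. Qed.

Lemma haar_setC_polycircle : lambda (~` P) = 0%E.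
Proof. by rewrite probability_setC// (proj1 haar) subee. Qed.

Let setTDC : setT `\` (~` P) = P.
Proof. by rewrite setDE setTI setCK. Qed.

Lemma haar_integrable (G : T -> R) (b : R) : measurable_fun setT G ->
  (forall z, P z -> `|G z| <= b) -> lambda.-integrable setT (EFin \o G).
Proof.
move=> mG Gb; apply/(@negligible_integrable _ _ _ lambda setT (~` P)) => //.
- exact/measurable_EFinP.
- exact: haar_setC_polycircle.
rewrite setTDC; apply: measurable_bounded_integrable => //.
- by apply: le_lt_trans (probability_le1 lambda mP) _; rewrite ltry.
- exact: measurable_funS mG.
exists b; split; first exact: num_real.
by move=> x bx z Pz /=; apply: le_trans (Gb _ Pz) (ltW bx).
Qed.

(** A bound on the polycircle suffices, as its complement is a null set. *)
Lemma haar_integral_near (G : T -> R) (c e : R) : measurable_fun setT G ->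
  (forall z, P z -> `|G z - c| <= e) -> `|\int[lambda]_z G z - c| <= e.
Proof.
move=> mG Gc.
have iG : lambda.-integrable setT (EFin \o G).
  apply: (@haar_integrable G (e + `|c|)) => // z Pz.
  by rewrite -[G z](subrK c); apply: le_trans (ler_normD _ _) _; rewrite lerD2r Gc.
have iGP : lambda.-integrable P (EFin \o G) by apply: integrableS iG.
have lP : fine (lambda P) = 1 by rewrite (proj1 haar).
have icst (x : R) : lambda.-integrable P (EFin \o (fun=> x)).
  apply: measurable_bounded_integrable => //.
    by apply: le_lt_trans (probability_le1 lambda mP) _; rewrite ltry.
  by exists `|x|; split; [exact: num_real|move=> y xy z _ /=; exact: ltW].
have -> : \int[lambda]_z G z = \int[lambda]_(z in P) G z.
  rewrite /Rintegral (@negligible_integral _ _ _ lambda setT (~` P))// ?setTDC//.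
  exact: haar_setC_polycircle.
have Ec (x : R) : \int[lambda]_(z in P) x = x by rewrite Rintegral_cst// lP mulr1.
rewrite -[c in X in `|X|]Ec -RintegralB//.
apply: le_trans (le_normr_Rintegral _ _) _ => //.
  have := integrableB mP iGP (icst c); apply: eq_integrable => //.
rewrite -[leRHS]Ec; apply: le_Rintegral => //.
have := integrable_abse (integrableB mP iGP (icst c)); apply: eq_integrable => //.
Qed.

(** The image of the measure under a translation is the measure itself. *)
Lemma haar_integral_translate (G : T -> R) (b : R) (w : T) : measurable_fun setT G ->
  (forall z, P z -> `|G z| <= b) -> P w ->
  \int[lambda]_z G (ctorusM w z) = \int[lambda]_z G z.
Proof.
move=> mG Gb Pw; have mw := ctorusM_measurable Pw.
have PM z : P z -> P (ctorusM w z).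
  by move=> Pz l; rewrite /ctorusM ffunE /= normcM (Pw l) (Pz l) mulr1.
rewrite /Rintegral; congr fine.
rewrite -[LHS]/(\int[lambda]_(z in ctorusM w @^-1` setT) ((EFin \o G) \o ctorusM w) z)%E.
rewrite -integral_pushforward//.
- apply: eq_measure_integral => A mA _; rewrite /pushforward.
  exact: (proj2 haar).
- exact/measurable_EFinP.
- apply: (@haar_integrable (G \o ctorusM w) b); last by move=> z /PM; exact: Gb.
  exact: measurableT_comp.
Qed.
End HaarIntegral.

Section FiniteMeasure.
Variables (R : realType) (N : nat).
Notation T := (ctorus R N).

Lemma integral_mu_fin (S : set T) (F : T -> R) : measurable_fun setT F ->
  \int[mu_fin S]_z F z =
  (size (finmap.enum_fset (fset_set S)))%:R^-1 *
    \sum_(z <- finmap.enum_fset (fset_set S)) F z.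
Proof.
move=> mF; set s := finmap.enum_fset _.
have ge0 (G : T -> R) : measurable_fun setT G -> (forall z, 0 <= G z) ->
  (\int[mu_fin S]_z (G z)%:E)%E = ((size s)%:R^-1 * \sum_(z <- s) G z)%:E.
  move=> mG G0; rewrite /mu_fin ge0_integral_mscale//=; last first.
  - by move=> x _; rewrite lee_fin.
  - exact/measurable_EFinP.
  rewrite ge0_integral_measure_sum//; last first.
  - exact/measurable_EFinP.
  - by move=> x _; rewrite lee_fin.
  rewrite EFinM; congr (_ * _)%E.
  rewrite (big_nth point) big_mkord -sumEFin; apply: eq_bigr => i _.
  by rewrite integral_dirac ?diracT ?mul1e//; exact/measurable_EFinP.
rewrite /Rintegral integralE.
have -> : (\int[mu_fin S]_z ((fun z => (F z)%:E)^\+ z))%E =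
    ((size s)%:R^-1 * \sum_(z <- s) Num.max (F z) 0)%:E.
  rewrite -ge0//; last first.
  - by move=> z; rewrite le_max lexx orbT.
  - exact: measurable_maxr.
  by apply: eq_integral => z _; rewrite funeposE EFin_max.
have -> : (\int[mu_fin S]_z ((fun z => (F z)%:E)^\- z))%E =
    ((size s)%:R^-1 * \sum_(z <- s) Num.max (- F z) 0)%:E.
  rewrite -ge0//; last first.
  - by move=> z; rewrite le_max lexx orbT.
  - by apply: measurable_maxr => //; exact: measurable_funN.
  by apply: eq_integral => z _; rewrite funenegE EFin_max EFinN.
rewrite -EFinB /= -mulrBr -sumrB; congr (_ * _); apply: eq_bigr => z _.
case: (leP 0 (F z)) => h.
  by rewrite max_r ?subr0// oppr_le0.
by rewrite max_l ?oppr_ge0 ?(ltW h)//; ring.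
Qed.
End FiniteMeasure.

(** * Equidistribution for test functions *)

Section TestFunction.
Variables (R : realType) (N : nat).
Import Normc.
Notation T := (ctorus R N).
Hypothesis N0 : (0 < N)%N.
Variable lambda : probability T R.
Hypothesis haar : is_haar_polycircle lambda.

(** The grid is invariant under translation by one of its points modulo the
    periods. *)
Lemma sum_grid_translate (K : nat) (g : 'rV[R]_N -> R) (k0 : {ffun 'I_N -> 'I_K.*2.+1}) :
  Zperiodic g ->
  \sum_(k : {ffun 'I_N -> 'I_K.*2.+1}) g (gridpt R k + gridpt R k0) =
  \sum_(k : {ffun 'I_N -> 'I_K.*2.+1}) g (gridpt R k).
Proof.
move=> pg; set h : R := (K.*2.+1)%:R^-1.
have step l (u : 'rV[R]_N) :
    \sum_(k : {ffun 'I_N -> 'I_K.*2.+1}) g (gridpt R k + (u + h *: delta_mx 0 l)) =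
    \sum_(k : {ffun 'I_N -> 'I_K.*2.+1}) g (gridpt R k + u).
  have pgu : Zperiodic (fun t => (g (t + u))%:C%C : R[i]).
    by move=> t j; rewrite addrAC pg.
  have /(congr1 (@complex.Re R)) := sum_grid_shift K l pgu.
  rewrite -!(rmorph_sum (real_complex R)) /= => <-.
  by apply: eq_bigr => k _; rewrite addrA addrAC.
have steps l (j : nat) (u : 'rV[R]_N) :
    \sum_(k : {ffun 'I_N -> 'I_K.*2.+1}) g (gridpt R k + (u + j%:R *: (h *: delta_mx 0 l))) =
    \sum_(k : {ffun 'I_N -> 'I_K.*2.+1}) g (gridpt R k + u).
  elim: j => [|j IHj]; first by rewrite scale0r addr0.
  by rewrite -natr1 scalerDl scale1r [u + _]addrA step.
have -> : gridpt R k0 = \sum_l (k0 l)%:R *: (h *: delta_mx 0 l) :> 'rV[R]_N.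
  apply/rowP => j; rewrite !mxE summxE (bigD1 j)//= !mxE !eqxx mulr1 big1 ?addr0// => l lj.
  by rewrite !mxE [j == l]eq_sym (negbTE lj) andbF !mulr0.
have : forall (s : seq 'I_N) (u : 'rV[R]_N),
    \sum_(k : {ffun 'I_N -> 'I_K.*2.+1})
      g (gridpt R k + (u + \sum_(l <- s) (k0 l)%:R *: (h *: delta_mx 0 l))) =
    \sum_(k : {ffun 'I_N -> 'I_K.*2.+1}) g (gridpt R k + u).
  elim=> [|l s IHs] u; first by rewrite big_nil addr0.
  by rewrite big_cons addrA IHs steps.
move=> /(_ (index_enum _) 0); rewrite add0r => ->.
by apply: eq_bigr => k _; rewrite addr0.
Qed.

Lemma Rintegral_fsum (J : Type) (s : seq J) (G : J -> T -> R) :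
  (forall j, lambda.-integrable setT (EFin \o G j)) ->
  lambda.-integrable setT (EFin \o (fun z => \sum_(j <- s) G j z)) /\
  \int[lambda]_z (\sum_(j <- s) G j z) = \sum_(j <- s) \int[lambda]_z G j z.
Proof.
move=> iG; elim: s => [|j s [IH1 IH2]].
  split; last first.
    by rewrite big_nil; under eq_Rintegral do rewrite big_nil; rewrite Rintegral_cst// mul0r.
  by apply: eq_integrable (integrable0 _ _) => // z _ /=; rewrite big_nil.
split.
  by apply: eq_integrable (integrableD _ (iG j) IH1) => // z _ /=; rewrite big_cons.
rewrite big_cons -IH2 -RintegralD//; apply: eq_Rintegral => z _; exact: big_cons.
Qed.

Variable F : T -> R.
Variable L : R.
Hypothesis L0 : 0 <= L.
Hypothesis FL : forall z w, `|F z - F w| <= L * ctorus_dist z w.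
Let f := F \o (@circle_param R N).
Hypothesis fC : class_C N.+1 f.

Let pf : Zperiodic f.
Proof. by move=> t l; rewrite /f /= Zperiodic_circle_param. Qed.

Let fL t u : `|f t - f u| <= L * \sum_l `|t 0 l - u 0 l|.
Proof. by apply: le_trans (FL _ _) _; rewrite ler_wpM2l// ctorus_dist_circle_param. Qed.

Let mF : measurable_fun setT F. Proof. exact: lipschitz_measurable FL. Qed.

(** One bound serves for all grids, as a pure derivative of order N + 1 of F in
    the angles is continuous and periodic. *)
Lemma test_function_fdiff_bound : exists B, 0 <= B /\ forall K l t,
  `|iter N.+1 (fdiff K l) f t| <= B / (K.*2.+1)%:R ^+ N.+1.
Proof.
have Hl l : exists b, 0 <= b /\ forall t, `|iter_derive l N.+1 f t| <= b.
  have [_ cf] := class_C_iter_derive l fC; apply: Zperiodic_continuous_bounded cf.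
  by rewrite /iter_derive; elim: N.+1 => //= p IHp; exact: Zperiodic_derive.
have [b Hb] := choice Hl.
exists (\sum_l b l); split; first by apply: sumr_ge0 => l _; have [] := Hb l.
move=> K l t; have [d1 _] := class_C_iter_derive l fC.
apply: iter_fdiff_le => // u; have [_ /(_ u)] := Hb l; move/le_trans; apply.
by rewrite (bigD1 l)//= lerDl; apply: sumr_ge0 => j _; have [] := Hb j.
Qed.

(** By invariance the integral of F is that of the mean of its translates by the
    grid points.  Moving a point of the polycircle to the nearest grid point,
    which permutes the grid, compares that mean with the coefficient of
    frequency 0 everywhere. *)
Lemma haar_integral_grid K :
  normc ((\int[lambda]_z F z)%:C%C - dft K f (fun=> 0)) <= L * N%:R / (K.*2.+1)%:R.
Proof.
set M := K.*2.+1; set a : R := (M ^ N)%:R^-1.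
have a0 : 0 < a by rewrite invr_gt0 ltr0n expn_gt0.
have aM : a * (M ^ N)%:R = 1 by rewrite mulVf// pnatr_eq0 -lt0n expn_gt0.
have -> : dft K f (fun=> 0) = (a * \sum_(k : {ffun 'I_N -> 'I_M}) f (gridpt R k))%:C%C.
  rewrite rmorphM /= fmorphV rmorph_nat rmorph_sum /dft; congr (_ * _).
  apply: eq_bigr => k _; rewrite /dotZ big1 ?oppr0 ?ee0 ?mulr1// => l _.
  by rewrite mul0r.
rewrite -rmorphB normc_real.
have [b [b0 fb]] : exists b, 0 <= b /\ forall t, `|f t| <= b.
  by apply: Zperiodic_continuous_bounded => //; case: fC.
have Fb z : polycircle z -> `|F z| <= b.
  by move=> /polycircleP[t [_ ->]]; exact: fb.
pose w (k : {ffun 'I_N -> 'I_M}) : T := circle_param (gridpt R k).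
have Pw k : polycircle (w k) := polycircle_circle_param _.
pose G (k : {ffun 'I_N -> 'I_M}) z := F (ctorusM (w k) z).
have mG k : measurable_fun setT (G k).
  by apply: measurableT_comp => //; exact: ctorusM_measurable.
have iG k : lambda.-integrable setT (EFin \o G k).
  apply: (haar_integrable haar (b := b)) => // z /polycircleP[t [_ ->]].
  by rewrite /G /w ctorusM_circle_param; exact: fb.
have [iS ES] := Rintegral_fsum (index_enum _) iG.
have -> : \int[lambda]_z F z = \int[lambda]_z (a * \sum_k G k z).
  rewrite RintegralZl// ES (eq_bigr (fun=> \int[lambda]_z F z)).
    by rewrite sumr_const card_ffun !card_ord -(mulr_natl (Rintegral _ _ _)) mulrA aM mul1r.
  by move=> k _; exact: (haar_integral_translate haar mF Fb (Pw k)).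
apply: haar_integral_near => //.
  by apply: measurable_funM => //; exact: measurable_sum.
move=> z /polycircleP[t [t01 ->]]; have [k0 Hk0] := grid_approx K t01.
rewrite -(sum_grid_translate k0 pf) -mulrBr -sumrB normrM (gtr0_norm a0).
have -> : L * N%:R / M%:R = a * ((M ^ N)%:R * (L * N%:R / M%:R)) by rewrite mulrA aM mul1r.
rewrite ler_wpM2l ?(ltW a0)//.
apply: le_trans (ler_norm_sum _ _ _) _.
apply: (@le_trans _ _ (\sum_(k : {ffun 'I_N -> 'I_M}) L * N%:R / M%:R)); last first.
  by rewrite sumr_const card_ffun !card_ord -(mulr_natl (L * N%:R / M%:R)).
apply: ler_sum => k _; rewrite /G /w ctorusM_circle_param.
apply: le_trans (fL _ _) _; rewrite -mulrA ler_wpM2l//.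
apply: (@le_trans _ _ (\sum_(l < N) M%:R^-1)); last first.
  by rewrite sumr_const card_ord -(mulr_natl M%:R^-1).
apply: ler_sum => l _; apply: le_trans (Hk0 l).
by rewrite ![(_ + _ : 'rV[R]_N) 0 l]mxE opprD addrACA subrr add0r.
Qed.

(** The constant comes from the bounds of the pure derivatives of order N + 1 of
    F on the polycircle, thus it depends on F only. *)
Lemma test_function_equidistribution : exists c, 0 <= c /\
  forall (I : finType) (t : I -> 'rV[R]_N) (e : R), (0 < #|I|)%N -> 0 <= e ->
    (forall i l, 0 <= t i 0 l < 1) ->
    (forall n : 'I_N -> int, (exists l, n l != 0) ->
      normc (\sum_i ee (dotZ n (t i))) <= #|I|%:R * (Num.sqrt (l1 R n) * e)) ->
    `|#|I|%:R^-1 * \sum_i F (circle_param (t i)) - \int[lambda]_z F z| <= c * e.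
Proof.
have [B [B0 fB]] := test_function_fdiff_bound.
exists (dft_constant N B); split; first exact: dft_constant_ge0.
move=> I t e I0 e0 t01 Hchi.
apply: (equidistribution_of_characters N0 L0 B0 pf fL fB I0 e0 t01 Hchi).
exact: haar_integral_grid.
Qed.
End TestFunction.

(** * Equidistribution of Galois orbits *)

Section OrbitEnumeration.
Variables (R : realType) (iota : {rmorphism algC -> R[i]}) (N : nat).
Variable xi : 'I_N -> algC.
Hypothesis xi0 : forall l, xi l != 0.
Let S : set (ctorus R N) := galois_orbit iota xi.

(** The coordinates of the conjugates are among the roots of the minimal
    polynomials. *)
Lemma finite_galois_orbit : finite_set S.
Proof.
pose rs : seq algC :=
  flatten [seq sval (closed_field_poly_normal (minCpoly (xi l))) | l <- enum 'I_N].
have rsP (sigma : {rmorphism algC -> algC}) l : sigma (xi l) \in rs.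
  apply/flatten_mapP; exists l; first by rewrite mem_enum.
  have := root_minCpoly (sigma (xi l)); rewrite minCpoly_aut.
  have lc := monicP (minCpoly_monic (xi l)).
  case: (closed_field_poly_normal _) => r /= Dr.
  by rewrite {1}Dr lc scale1r root_prod_XsubC.
pose Phi (g : {ffun 'I_N -> 'I_(size rs)}) : ctorus R N :=
  [ffun l => odflt (cstar1 R) (insub (iota (nth 0 rs (g l))))].
apply: (@sub_finite_set _ _ (range Phi)); last exact/finite_image/finite_finset.
move=> z [sigma Dz].
have idx l : (index (sigma (xi l)) rs < size rs)%N by rewrite index_mem rsP.
suff -> : z = Phi [ffun l => Ordinal (idx l)] by exact: imageT.
apply/ffunP => l; apply/val_inj; rewrite !ffunE /= nth_index// insubT /=.
  by rewrite -Dz; exact: (valP (z l : cstar R)).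
by move=> _; rewrite Dz.
Qed.

Lemma enum_galois_orbit :
  let s := finmap.enum_fset (fset_set S) in
  exists x : 'I_(size s) -> 'I_N -> algC, enum_orbit xi x /\
    forall (i : 'I_(size s)) l, val (nth point s i l : cstar R) = iota (x i l).
Proof.
move=> s.
have memS z : z \in s -> S z by rewrite (in_fset_set finite_galois_orbit) inE.
have Sz (i : 'I_(size s)) : exists sigma : {rmorphism algC -> algC},
    forall l, val (nth point s i l : cstar R) = iota (sigma (xi l)).
  by apply: memS; exact: mem_nth.
have [sigma Hsigma] := choice Sz.
exists (fun i l => sigma i (xi l)); split=> //; split=> [i|tau|i j Hij].
- by exists (sigma i).
- have tau0 l : iota (tau (xi l)) != 0 by rewrite !fmorph_eq0.
  pose w : ctorus R N := [ffun l => exist _ (iota (tau (xi l))) (tau0 l)].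
  have ws : w \in s.
    rewrite (in_fset_set finite_galois_orbit) inE; exists tau => l.
    by rewrite ffunE.
  have ltw : (index w s < size s)%N by rewrite index_mem.
  exists (Ordinal ltw) => l; apply: (fmorph_inj iota).
  by rewrite -Hsigma /= nth_index// ffunE.
- have us : uniq s := finmap.fset_uniq (fset_set S).
  apply/val_inj/eqP; rewrite -(nth_uniq point (ltn_ord i) (ltn_ord j) us).
  by apply/eqP/ffunP => l; apply/val_inj; rewrite !Hsigma Hij.
Qed.
End OrbitEnumeration.

Section PolarMonomials.
Variable R : realType.
Import Normc.

Lemma ee_mulrz (x : R) (k : int) : ee (k%:~R * x) = ee x ^ k.
Proof.
case: k => k; first by rewrite -pmulrn ee_mulrn.
by rewrite NegzE mulrNz mulNr eeN -pmulrn ee_mulrn -exprnN.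
Qed.

Lemma chi_polar (iota : {rmorphism algC -> R[i]}) (N : nat) (n : 'I_N -> int)
    (y : 'I_N -> algC) (t : 'rV[R]_N) :
  (forall l, iota (y l) = (normc (iota (y l)))%:C%C * ee (t 0 l)) ->
  iota (chi n y) = (normc (iota (chi n y)))%:C%C * ee (dotZ n t).
Proof.
move=> Hy; pose rho : R := \prod_l normc (iota (y l)) ^ n l.
have E : iota (chi n y) = rho%:C%C * ee (dotZ n t).
  rewrite /chi rmorph_prod /dotZ ee_sum /rho rmorph_prod -big_split /=.
  apply: eq_bigr => l _; rewrite ee_mulrz fmorphXz {1}Hy expfzMl.
  by rewrite fmorphXz.
have rho0 : 0 <= rho by apply: prodr_ge0 => l _; apply: exprz_ge0; exact: normc_ge0.
by rewrite E normcM normc_real normc_ee mulr1 (ger0_norm rho0).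
Qed.
End PolarMonomials.

Section DegreeBound.
Variable R : realType.

(** If d <= D, ln is monotone and 1 / d <= m / D.  If d > D, already
    ln(d + 1) / d <= ln(D + 1) / D, by concavity. *)
Lemma ln_ratio_le (D d m : nat) : (0 < D)%N -> (0 < d)%N -> (0 < m)%N ->
  (D <= m * d)%N ->
  ln (d%:R + 1) / d%:R <= m%:R * (ln (D%:R + 1) / D%:R) :> R.
Proof.
move=> D0 d0 m0 Dmd.
have m1 : 1 <= m%:R :> R by rewrite ler1n.
have D1 : 0 < D%:R :> R by rewrite ltr0n.
have d1 : 0 < d%:R :> R by rewrite ltr0n.
have Dmd' : D%:R <= m%:R * d%:R :> R by rewrite -natrM ler_nat.
move: (d%:R) (m%:R) (D%:R) m1 D1 d1 Dmd' => {D d m D0 d0 m0 Dmd} d m D m1 D0 d0 Dmd.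
have D1 : 0 < D + 1 by rewrite addr_gt0.
have d1 : 0 < d + 1 by rewrite addr_gt0.
have lnD0 : 0 <= ln (D + 1) by apply: ln_ge0; rewrite lerDr ltW.
rewrite ler_pdivrMr// mulrAC mulrA ler_pdivlMr//.
have [dD|Dd] := leP d D.
  have ln_le : ln (d + 1) <= ln (D + 1) by rewrite ler_ln ?posrE// lerD2r.
  apply: (@le_trans _ _ (ln (D + 1) * D)); first by rewrite ler_pM2r.
  by rewrite mulrC ler_wpM2r.
(* The tangent to ln at D + 1. *)
have key : ln (d + 1) <= ln (D + 1) + (d - D) / (D + 1).
  have -> : d + 1 = (D + 1) * ((d + 1) / (D + 1)) by field; rewrite lt0r_neq0.
  rewrite lnM ?posrE ?divr_gt0// lerD2l.
  apply: le_trans (ln_le_sub1 _) _; first by rewrite divr_gt0.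
  by rewrite [leRHS](_ : _ = (d + 1) / (D + 1) - 1)//; field; rewrite lt0r_neq0.
have key2 : D / (D + 1) <= ln (D + 1).
  have := ln_le_sub1 (x := (D + 1)^-1); rewrite invr_gt0 lnV ?posrE// => /(_ D1).
  have -> : D / (D + 1) = 1 - (D + 1)^-1 by field; rewrite lt0r_neq0.
  by lra.
have : ln (d + 1) * D <= ln (D + 1) * d.
  apply: (@le_trans _ _ (ln (D + 1) * D + (d - D) * (D / (D + 1)))).
    by have := ler_wpM2r (ltW D0) key; rewrite mulrDl -!mulrA [_^-1 * D]mulrC.
  by nra.
move=> /le_trans; apply; rewrite -mulrA [ln _ * d]mulrC.
by rewrite ler_peMl// mulr_ge0// (ltW d0).
Qed.

Lemma algdeg_gt0 (x : algC) : (0 < algdeg x)%N.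
Proof. by have := size_minCpoly x; rewrite /algdeg; case: (size _) => [|[]]. Qed.

Lemma l1norm_gt0 (N : nat) (n : 'I_N -> int) l : n l != 0 -> (0 < l1norm n)%N.
Proof. by move=> nl; rewrite /l1norm (bigD1 l)//= ltn_addr// absz_gt0. Qed.

Lemma absz_le_l1norm (N : nat) (n : 'I_N -> int) l : (`|n l| <= l1norm n)%N.
Proof. by rewrite /l1norm (bigD1 l)//= leq_addr. Qed.

Lemma gen_deg_gt0 (N : nat) (xi : 'I_N -> algC) : (0 < N)%N -> (0 < gen_deg xi)%N.
Proof.
move=> N0; have [[n [l nl] ->] _] := gen_degP xi N0.
by rewrite muln_gt0 algdeg_gt0 (l1norm_gt0 nl).
Qed.
End DegreeBound.

Section OrbitEquidistribution.
Variable R : realType.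
Import Normc.

Lemma normc_sum_ee (I : finType) (y : I -> R) :
  normc (\sum_i ee (y i)) =
  Num.sqrt ((\sum_i cos (2 * pi * y i)) ^+ 2 + (\sum_i sin (2 * pi * y i)) ^+ 2).
Proof.
suff -> : \sum_i ee (y i) =
    ((\sum_i cos (2 * pi * y i)) +i* (\sum_i sin (2 * pi * y i)))%C by [].
elim/big_rec3: _ => [//|i a b c _ ->].
by rewrite /ee /expi; simpc.
Qed.

(** The two points have the same angles. *)
Lemma ctorus_dist_radial (N : nat) (z : ctorus R N) (t : 'rV[R]_N) :
  (forall l, val (z l : cstar R) = (normc (val (z l : cstar R)))%:C%C * ee (t 0 l)) ->
  ctorus_dist z (circle_param t) <= \sum_l `|ln (normc (val (z l : cstar R)))|.
Proof.
move=> Dz; rewrite /ctorus_dist; apply: le_trans (sqrt_sum_sqr_le _ (fun l => normr_ge0 _)).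
apply: ler_wsqrtr; apply: ler_sum => l _.
have z0 : (normc (val (z l : cstar R)))%:C%C != 0 :> R[i].
  by rewrite fmorph_eq0 normc_eq0 (valP (z l : cstar R)).
have -> : dist_ang (z l) (circle_param t l) = 0.
  have /andP[a b] := dist_ang_circle_param t t l.
  apply/eqP; rewrite subrr normr0 in b; move: a b.
  rewrite /dist_ang (unit_part_unit (z := circle_param t l)) ?circle_paramE ?normc_ee//.
  have -> : unit_part (z l) = ee (t 0 l) by rewrite /unit_part {1}Dz mulrC mulKf.
  by move=> a b; rewrite eq_le a b.
by rewrite expr0n add0r circle_paramE normc_ee ln1 subr0.
Qed.

Variables (iota : {rmorphism algC -> R[i]}) (N : nat).
Hypothesis N0 : (0 < N)%N.
Variable xi : 'I_N -> algC.
Hypothesis xi0 : forall l, xi l != 0.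
Let h : R := weil_heightN R xi.
Let Lam : R := ln ((gen_deg xi)%:R + 1) / (gen_deg xi)%:R.

Section Enumeration.
Variables (I : finType) (x : I -> 'I_N -> algC) (t : I -> 'rV[R]_N).
Hypothesis orbx : enum_orbit xi x.
Hypothesis Dt : forall i l,
  iota (x i l) = (normc (iota (x i l)))%:C%C * ee (t i 0 l).

Lemma weil_height_ge0 l : 0 <= weil_height R (xi l).
Proof.
have := orbit_abs_ln iota orbx xi0 l.
have : 0 <= \sum_i `|ln (normc (iota (x i l)))| by apply: sumr_ge0.
have : 0 < #|I|%:R :> R by rewrite ltr0n (orbit_card_gt0 orbx).
by move: (\sum_i _) (weil_height _ _) #|I|%:R => a b c; nra.
Qed.

(** By definition of the generalized degree D, the degree d of the monomial
    satisfies D <= |n|_1 d. *)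
Lemma orbit_character_sum (n : 'I_N -> int) : (exists l, n l != 0) ->
  normc (\sum_i ee (dotZ n (t i))) <=
    #|I|%:R * (Num.sqrt (l1 R n) * Num.sqrt (4 * Lam + 16 * h)).
Proof.
move=> n0; have [l nl] := n0.
rewrite normc_sum_ee.
have s0 : 0 <= #|I|%:R :> R by [].
have l10 : 0 <= l1 R n by rewrite /l1.
rewrite -sqrtrM// -[#|I|%:R]ger0_norm// -sqrtr_sqr -sqrtrM ?sqr_ge0//.
apply: ler_wsqrtr.
apply: le_trans (orbit_angular_sum (iota := iota) orbx xi0 (n := n) _) _ => [i|].
  by rewrite {1}(chi_polar n (Dt i)) /ee /expi; simpc.
rewrite ler_wpM2l ?sqr_ge0// mulrDr lerD//.
  rewrite [leRHS]mulrCA ler_wpM2l//; apply: ln_ratio_le.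
  - exact: gen_deg_gt0.
  - exact: algdeg_gt0.
  - exact: l1norm_gt0 nl.
  - exact: (proj2 (gen_degP xi N0)).
rewrite [leRHS]mulrCA ler_wpM2l// /h /weil_heightN mulr_sumr ler_sum// => j _.
by rewrite ler_wpM2r ?weil_height_ge0// ler_nat absz_le_l1norm.
Qed.

Lemma orbit_mean_radial (F : ctorus R N -> R) (L : R) (z : I -> ctorus R N) :
  0 <= L -> (forall z w, `|F z - F w| <= L * ctorus_dist z w) ->
  (forall i l, val (z i l : cstar R) = iota (x i l)) ->
  `|#|I|%:R^-1 * \sum_i F (z i) - #|I|%:R^-1 * \sum_i F (circle_param (t i))| <=
    L * (2 * h).
Proof.
move=> L0 FL Dz; have s0 : 0 < #|I|%:R :> R by rewrite ltr0n (orbit_card_gt0 orbx).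
rewrite -mulrBr -sumrB normrM gtr0_norm ?invr_gt0// mulrC ler_pdivrMr//.
apply: le_trans (ler_norm_sum _ _ _) _.
apply: (@le_trans _ _ (\sum_i L * \sum_l `|ln (normc (iota (x i l)))|)).
  apply: ler_sum => i _; apply: le_trans (FL _ _) _; rewrite ler_wpM2l//.
  apply: le_trans (ctorus_dist_radial (t := t i) _) _ => [l|]; first by rewrite Dz.
  by apply: ler_sum => l _; rewrite Dz.
rewrite -mulr_sumr -mulrA ler_wpM2l// exchange_big /=.
rewrite /h /weil_heightN -mulrA mulr_suml mulr_sumr; apply: ler_sum => l _.
by rewrite [weil_height _ _ * _]mulrC; exact: orbit_abs_ln.
Qed.
End Enumeration.

(** The radial error is 2 L h <= L (4 h)^(1/2) as h <= 1, and
    4 Lam + 16 h <= 4 (4 h + 64 Lam). *)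
Lemma galois_orbit_equidistribution (F : ctorus R N -> R) (L c1 I0 : R) :
  0 <= L -> (forall z w, `|F z - F w| <= L * ctorus_dist z w) -> 0 <= c1 ->
  (forall (I : finType) (t : I -> 'rV[R]_N) (e : R), (0 < #|I|)%N -> 0 <= e ->
    (forall i l, 0 <= t i 0 l < 1) ->
    (forall n : 'I_N -> int, (exists l, n l != 0) ->
      normc (\sum_i ee (dotZ n (t i))) <= #|I|%:R * (Num.sqrt (l1 R n) * e)) ->
    `|#|I|%:R^-1 * \sum_i F (circle_param (t i)) - I0| <= c1 * e) ->
  h <= 1 ->
  `|\int[mu_fin (galois_orbit iota xi)]_z F z - I0| <=
    (L + 2 * c1) * Num.sqrt (4 * h + 64 * Lam).
Proof.
move=> L0 FL c10 Fequi h1.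
have [x [orbx Dx]] := enum_galois_orbit iota xi0.
set s := finmap.enum_fset _ in x orbx Dx.
have /choice[t Ht] : forall i : 'I_(size s), exists t : 'rV[R]_N, forall l,
    0 <= t 0 l < 1 /\ iota (x i l) = (normc (iota (x i l)))%:C%C * ee (t 0 l).
  move=> i; have [t Ht] := choice (fun l => unit_coordinate (iota (x i l))).
  by exists (\row_l t l) => l; rewrite mxE.
have t01 i l : 0 <= t i 0 l < 1 by have [] := Ht i l.
have Dt i l : iota (x i l) = (normc (iota (x i l)))%:C%C * ee (t i 0 l).
  by have [] := Ht i l.
have h0 : 0 <= h by apply: sumr_ge0 => l _; exact: weil_height_ge0 orbx _.
have Lam0 : 0 <= Lam.
  by rewrite /Lam divr_ge0// ln_ge0// lerDr.
have -> : \int[mu_fin (galois_orbit iota xi)]_z F z =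
    #|'I_(size s)|%:R^-1 * \sum_(i < size s) F (nth point s i).
  rewrite integral_mu_fin; last exact: lipschitz_measurable FL.
  by rewrite card_ord -/s (big_nth point) big_mkord.
pose e := Num.sqrt (4 * Lam + 16 * h).
have He := Fequi 'I_(size s) t e (orbit_card_gt0 orbx) (sqrtr_ge0 _) t01
  (fun n => orbit_character_sum orbx Dt (n := n)).
have Hr := orbit_mean_radial orbx Dt L0 FL (z := fun i => nth point s i) Dx.
set X := Num.sqrt (_ + _).
have X0 : 0 <= X by exact: sqrtr_ge0.
have X2 : X ^+ 2 = 4 * h + 64 * Lam by rewrite sqr_sqrtr// addr_ge0// mulr_ge0.
have e0 : 0 <= e by exact: sqrtr_ge0.
have e2 : e ^+ 2 = 4 * Lam + 16 * h by rewrite sqr_sqrtr// addr_ge0// mulr_ge0.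
have eX : e <= 2 * X.
  by rewrite -(@ler_pXn2r _ 2)// ?nnegrE ?mulr_ge0// exprMn X2 e2; lra.
have hX : 2 * h <= X.
  rewrite -(@ler_pXn2r _ 2)// ?nnegrE ?mulr_ge0// exprMn X2.
  by have : h ^+ 2 <= h; [rewrite expr2 ler_piMl|lra].
rewrite -[X in `|X - _|](subrK (#|'I_(size s)|%:R^-1 * \sum_i F (circle_param (t i)))).
rewrite -addrA; apply: le_trans (ler_normD _ _) _; rewrite mulrDl lerD//.
  by apply: le_trans Hr _; rewrite ler_wpM2l.
by apply: le_trans He _; rewrite [2 * c1]mulrC -mulrA ler_wpM2l.
Qed.
End OrbitEquidistribution.

Theorem theorem1p2 (R : realType) (iota : {rmorphism algC -> R[i]})
    (N : nat) (hN : (1 <= N)%N)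
    (lambda : probability (ctorus R N) R) (hlambda : is_haar_polycircle lambda) :
  exists C : R, C <= 64 /\
    forall F : ctorus R N -> R, test_function F ->
    exists c : R, 0 < c /\
      forall xi : 'I_N -> algC, (forall l, xi l != 0) ->
        weil_heightN R xi <= 1 ->
        `| \int[mu_fin (galois_orbit iota xi)]_z F z - \int[lambda]_z F z | <=
        c * Num.sqrt (4 * weil_heightN R xi +
              C * (ln ((gen_deg xi)%:R + 1) / (gen_deg xi)%:R)).
Proof.
exists 64; split=> // F [[k Fk] fC].
have FL z w : `|F z - F w| <= `|k| * ctorus_dist z w.
  by apply: le_trans (Fk z w) _; rewrite ler_wpM2r ?ler_norm ?sqrtr_ge0.
have [c1 [c10 Fequi]] := test_function_equidistribution hN hlambda (normr_ge0 k) FL fC.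
(* The summand 1 keeps the constant positive when F is constant. *)
exists (`|k| + 2 * c1 + 1); split=> [|xi xi0 h1].
  by rewrite ltr_wpDl// addr_ge0// mulr_ge0.
apply: le_trans (galois_orbit_equidistribution iota hN xi0 (normr_ge0 k) FL c10 Fequi h1) _.
by rewrite ler_wpM2r ?sqrtr_ge0// lerDl.
Qed.
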